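(* Let $\Bbbk$ be a commutative ring and let $O$ be a cyclic operad with multiplication (in $\Bbbk$-modules), with cyclic operators $\tau_n:O(n)\to O(n)$. Then: a) The structure of cosimplicial module on $O$ extends to a structure of cocyclic module (with cocyclic operators $\tau_n$). b) The Connes coboundary map $B$ on $\mathcal C^*(O)$ induces a natural structure of Batalin-Vilkovisky algebra on the Gerstenhaber algebra $H^*(\mathcal C^*(O))$. c) The cyclic cohomology of $\mathcal C^*(O)$, denoted $HC^*(\mathcal C^*(O))$, has naturally a graded Lie algebra structure of degree $-2$ (with the bracket described in the context).
   Context: **Operads.** Operad means non-$\Sigma$ operad in $\Bbbk$-modules: modules $O(n)$, $n\in\mathbb N$ (including $n=0$), an element $id\in O(1)$, and structure maps $\gamma:O(n)\otimes O(i_1)\otimes\cdots\otimes O(i_n)\to O(i_1+\cdots+i_n)$ satisfying associativity and unit. For $f\in O(m)$, $g\in O(n)$, $1\le i\le m$, put $f\circ_ig:=\gamma(f;id,\dots,g,\dots,id)\in O(m+n-1)$ ($g$ in $i$-th place). An operad with multiplication is an operad with elements $\mu\in O(2)$, $e\in O(0)$ such that $\mu\circ_1\mu=\mu\circ_2\mu$ and $\mu\circ_1e=id=\mu\circ_2e$. A cyclic operad is an operad $O$ with linear maps $\tau_n:O(n)\to O(n)$, $n\in\mathbb N$, such that $\tau_n^{n+1}=\mathrm{id}$; for $m,n\ge1$, $\tau_{m+n-1}(f\circ_1g)=\tau_ng\circ_n\tau_mf$; and for $m\ge2$, $n\ge0$, $2\le i\le m$, $\tau_{m+n-1}(f\circ_ig)=\tau_mf\circ_{i-1}g$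 (for all $f\in O(m)$, $g\in O(n)$). A cyclic operad with multiplication is an operad which is both an operad with multiplication and a cyclic operad, such that $\tau_2\mu=\mu$. **Cosimplicial structure and cochain complex.** An operad with multiplication is a cosimplicial module: $\delta_i:O(n)\to O(n+1)$ is $\delta_0f=\mu\circ_2f$, $\delta_if=f\circ_i\mu$ ($1\le i\le n$), $\delta_{n+1}f=\mu\circ_1f$; $\sigma_{i-1}:O(n)\to O(n-1)$ is $\sigma_{i-1}f=f\circ_ie$ ($1\le i\le n$). $\mathcal C^*(O)$ is the cochain complex with $\mathcal C^n(O)=O(n)$ and $d=\sum_{i=0}^{n+1}(-1)^i\delta_i$. A cocyclic module is a cosimplicial module with operators $\tau_n$ such that $\tau_n^{n+1}=\mathrm{id}$, $\tau_n\delta_i=\delta_{i-1}\tau_{n-1}$ ($1\le i\le n$), $\tau_n\delta_0=\delta_n$, $\tau_n\sigma_i=\sigma_{i-1}\tau_{n+1}$ ($1\le i\le n$), $\tau_n\sigma_0=\sigma_n\tau_{n+1}^2$. **Cup product and bracket.** For $f\in O(m)$, $g\in O(n)$: $f\cup g:=(\mu\circ_1f)\circ_{m+1}g$, $f\overline{\circ}g:=(-1)^{(m-1)(n-1)}\sum_{i=1}^m(-1)^{(n-1)(i-1)}f\circ_ig$, $\{f,g\}:=f\overline\circ g-(-1)^{(m-1)(n-1)}g\overline\circ f$. It is known that $\cup$ and $\{-,-\}$ make $H^*(\mathcal C^*(O))$ a Gerstenhaber algebra. **Connes coboundary.** Let $\overline{\mathcal C}^n(O)=\{f\in O(n):\sigma_jf=0,\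 0\le j\le n-1\}$ be the normalized subcomplex; its inclusion in $\mathcal C^*(O)$ is a cochain homotopy equivalence. For $n\ge1$ put $\sigma_n:=\sigma_{n-1}\tau_n:O(n)\to O(n-1)$ and $B:=\sum_{i=0}^{n-1}(-1)^{i(n-1)}\tau_{n-1}^i\,\sigma_n:\overline{\mathcal C}^n(O)\to\overline{\mathcal C}^{n-1}(O)$, with $B=0$ in degree $0$. Also write $B$ for the induced map on $H^*(\mathcal C^*(O))$. **Gerstenhaber and Batalin-Vilkovisky algebras.** A Gerstenhaber algebra is a graded module $G=\{G^i\}_{i\in\mathbb Z}$ with a graded commutative algebra structure $\cup:G^i\otimes G^j\to G^{i+j}$ and a linear map $\{-,-\}:G^i\otimes G^j\to G^{i+j-1}$ such that $\{a,b\}=-(-1)^{(|a|-1)(|b|-1)}\{b,a\}$, $\{a,\{b,c\}\}=\{\{a,b\},c\}+(-1)^{(|a|-1)(|b|-1)}\{b,\{a,c\}\}$ and $\{a,bc\}=\{a,b\}c+(-1)^{|b|(|a|-1)}b\{a,c\}$. A Batalin-Vilkovisky algebra is a Gerstenhaber algebra $G$ with a linear map $B:G^i\to G^{i-1}$ such that $B\circ B=0$ and $\{a,b\}=(-1)^{|a|}\big(B(a\cup b)-(Ba)\cup b-(-1)^{|a|}a\cup(Bb)\big)$. **Cyclic cohomology.** $HC^*(\mathcal C^*(O))$ is the cohomology of the complex $\mathrm{Tot}^n=\bigoplus_{k\ge0}\overline{\mathcal C}^{\,n+2k}(O)$ ($n\in\mathbb Z$, with $\overline{\mathcal C}^{i}=0$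 for $i<0$) with differential $(c_0,c_1,\dots)\mapsto(dc_0+Bc_1,\,dc_1+Bc_2,\dots)$. (This is the homology of the complex $M_n\oplus M_{n-2}\oplus\cdots$ of the mixed complex $M_n:=\overline{\mathcal C}^{-n}(O)$.) There are maps $I:H^n(\mathcal C^*(O))\to HC^n$, $[c]\mapsto[(c,0,0,\dots)]$, and $\partial:HC^n\to H^{n-1}(\mathcal C^*(O))$, $[(c_0,c_1,\dots)]\mapsto[Bc_0]$. The bracket is $[a,b]:=(-1)^{|a|}I(\partial a\cup\partial b)$. **Graded Lie algebra of degree $-2$.** A graded module $L$ with a linear map $[-,-]:L^i\otimes L^j\to L^{i+j-2}$ satisfying $[a,b]=-(-1)^{|a||b|}[b,a]$ and $[a,[b,c]]=[[a,b],c]+(-1)^{|a||b|}[b,[a,c]]$. *)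

(* Defs.v *)
From HB Require Import structures.
From mathcomp Require Import all_boot all_order all_algebra.
From mathcomp Require Import boolp zify.

Set Implicit Arguments.
Unset Strict Implicit.
Unset Printing Implicit Defensive.

Import GRing.Theory.
Local Open Scope ring_scope.
Local Open Scope quotient_scope.

(* Transport along an equality of degrees. *)
Definition gcast (k : pzRingType) (I : Type) (G : I -> lmodType k) (i j : I)
  (e : i = j) (x : G i) : G j := ecast l (G l) e x.

Lemma gcast_is_linear (k : pzRingType) (I : Type) (G : I -> lmodType k)
  (i j : I) (e : i = j) : linear (@gcast k I G i j e).
Proof. by case: _ / e. Qed.

HB.instance Definition _ k I G i j e :=
  GRing.isLinear.Build k (G i) (G j) *:%R (@gcast k I G i j e)
    (@gcast_is_linear k I G i j e).

(* (-1)^z for z : int; only the parity of z matters, so `|z| serves as the    *)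
(* exponent (-1 need not be declared a unit of k).                            *)
Definition gsign (k : pzRingType) (z : int) : k := (-1) ^+ `|z|%N.
Arguments gsign : clear implicits.

Lemma sum_Rank (n : nat) (i : 'I_n -> nat) (p : 'I_(\sum_j i j) -> nat) :
  (\sum_l p l = \sum_(j < n) \sum_(t < i j) p (tagnat.Rank j t))%N.
Proof.
rewrite sig_big_dep /= (reindex _ (@tagnat.rank_bij_on n i)) /=.
by apply: eq_bigr => -[].
Qed.

Lemma sum_const1 (n : nat) : (\sum_(j < n) 1 = n)%N.
Proof. by rewrite sum1_card card_ord. Qed.

(* In op_gammaA, tagnat.Rank j t is the position i_0 + ... + i_(j-1) + t. *)
Record operad (k : comPzRingType) := Operad {
  op_mod :> nat -> lmodType k;
  op_id : op_mod 1%N;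
  op_gamma : forall (n : nat) (i : 'I_n -> nat),
    op_mod n -> (forall j, op_mod (i j)) -> op_mod (\sum_j i j)%N;
  op_gamma_linl : forall n (i : 'I_n -> nat) (g : forall j, op_mod (i j)),
    linear (fun f => op_gamma f g);
  op_gamma_linr : forall n (i : 'I_n -> nat) (f : op_mod n) (j : 'I_n)
    (a : k) (g g1 g2 : forall j, op_mod (i j)),
    g j = a *: g1 j + g2 j ->
    (forall l, l != j -> g1 l = g l /\ g2 l = g l) ->
    op_gamma f g = a *: op_gamma f g1 + op_gamma f g2;
  op_gammaA : forall n (i : 'I_n -> nat) (p : 'I_(\sum_j i j) -> nat)
    (f : op_mod n) (g : forall j, op_mod (i j)) (h : forall l, op_mod (p l)),
    gcast (sum_Rank p) (op_gamma (op_gamma f g) h) =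
    op_gamma f (fun j => op_gamma (g j) (fun t => h (tagnat.Rank j t)));
  op_gamma1l : forall m (g : op_mod m),
    gcast (big_ord1 addn (fun=> m)) (op_gamma op_id (fun=> g)) = g;
  op_gamma1r : forall n (f : op_mod n),
    gcast (sum_const1 n) (op_gamma f (fun=> op_id)) = f
}.

Section PartialComposition.
Variables (k : comPzRingType) (O : operad k).

Definition part_arg (m n : nat) (i : 'I_m) (g : O n) (l : 'I_m) :
    O (if l == i then n else 1%N) :=
  match l == i as b return O (if b then n else 1%N) with
  | true => g
  | false => op_id O
  end.

Lemma sum_part (m n : nat) (i : 'I_m) :
  (\sum_(l < m) (if l == i then n else 1) = (m + n).-1)%N.
Proof.
rewrite (bigD1 i) //= eqxx (eq_bigr (fun=> 1%N)) => [|l /negbTE -> //].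
rewrite sum1_card cardC1 card_ord.
by case: m i => [[]//|m] i; rewrite addnC.
Qed.

(* Positions are counted from 0: pcomp f i g is f o_(i+1) g in the usual      *)
(* 1-based notation, so ord0 is the first input and ord_max the last.         *)
Definition pcomp (m n : nat) (f : O m) (i : 'I_m) (g : O n) : O (m + n).-1 :=
  gcast (sum_part n i) (op_gamma f (part_arg i g)).

Lemma pcomp_linl m n (i : 'I_m) (g : O n) : linear (fun f => pcomp f i g).
Proof. by move=> a f f'; rewrite /pcomp op_gamma_linl linearP. Qed.

Lemma pcomp_linr m n (f : O m) (i : 'I_m) : linear (@pcomp m n f i).
Proof.
move=> a g g'; rewrite /pcomp -linearP; congr gcast.
apply: (@op_gamma_linr _ O _ _ f i) => [|l /negbTE]; rewrite /part_arg.
  by move: (eqxx i); case: (i == i).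
by case: (l == i).
Qed.

End PartialComposition.

Record multiplication (k : comPzRingType) (O : operad k) := Multiplication {
  op_mu : O 2%N;
  op_e : O 0%N;
  mu_assoc : pcomp op_mu ord0 op_mu = pcomp op_mu ord_max op_mu;
  mu_unitl : pcomp op_mu ord0 op_e = op_id O;
  mu_unitr : pcomp op_mu ord_max op_e = op_id O
}.

Record cyclic_structure (k : comPzRingType) (O : operad k) := CyclicStructure {
  op_tau : forall n, {linear O n -> O n};
  tau_order : forall n (f : O n), iter n.+1 (op_tau n) f = f;
  tau_pcomp1 : forall m n (f : O m.+1) (g : O n.+1),
    op_tau _ (pcomp f ord0 g) =
    gcast (congr1 predn (addnC n.+1 m.+1))
      (pcomp (op_tau _ g) ord_max (op_tau _ f));
  tau_pcomp : forall m n (f : O m) (g : O n) (i j : 'I_m), i = j.+1 :> nat ->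
    op_tau _ (pcomp f i g) = pcomp (op_tau _ f) j g
}.

Record cyclic_mult_operad (k : comPzRingType) := CyclicMultOperad {
  cmo_operad :> operad k;
  cmo_mult : multiplication cmo_operad;
  cmo_cyc : cyclic_structure cmo_operad;
  tau_mu : op_tau cmo_cyc 2 (op_mu cmo_mult) = op_mu cmo_mult
}.

(* The operators are indexed by nat; only delta_i, 0 <= i <= n+1, and         *)
(* sigma_j, 0 <= j <= n, are meaningful on X n and X n.+1 respectively.       *)
Record is_cosimplicial (k : comPzRingType) (X : nat -> lmodType k)
    (delta : forall n, nat -> X n -> X n.+1)
    (sigma : forall n, nat -> X n.+1 -> X n) : Prop := IsCosimplicial {
  delta_linear : forall n i, (i <= n.+1)%N -> linear (delta n i);
  sigma_linear : forall n j, (j <= n)%N -> linear (sigma n j);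
  delta_delta : forall n i j (x : X n), (i < j)%N -> (j <= n.+2)%N ->
    delta _ j (delta _ i x) = delta _ i (delta _ j.-1 x);
  sigma_sigma : forall n i j (x : X n.+2), (i <= j)%N -> (j <= n)%N ->
    sigma _ j (sigma _ i x) = sigma _ i (sigma _ j.+1 x);
  sigma_delta_lt : forall n i j (x : X n.+1), (i < j)%N -> (j <= n.+1)%N ->
    sigma _ j (delta _ i x) = delta _ i (sigma _ j.-1 x);
  sigma_delta_eq : forall n j (x : X n), (j <= n)%N ->
    sigma _ j (delta _ j x) = x;
  sigma_delta_eqS : forall n j (x : X n), (j <= n)%N ->
    sigma _ j (delta _ j.+1 x) = x;
  sigma_delta_gt : forall n i j (x : X n.+1), (j.+1 < i)%N -> (i <= n.+2)%N ->
    sigma _ j (delta _ i x) = delta _ i.-1 (sigma _ j x)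
}.

Record is_cocyclic (k : comPzRingType) (X : nat -> lmodType k)
    (delta : forall n, nat -> X n -> X n.+1)
    (sigma : forall n, nat -> X n.+1 -> X n)
    (tau : forall n, {linear X n -> X n}) : Prop := IsCocyclic {
  cocyclic_cosimplicial : is_cosimplicial delta sigma;
  cocyclic_order : forall n (x : X n), iter n.+1 (tau n) x = x;
  tau_delta : forall n i (x : X n), (0 < i)%N -> (i <= n.+1)%N ->
    tau _ (delta _ i x) = delta _ i.-1 (tau _ x);
  tau_delta0 : forall n (x : X n), tau _ (delta _ 0%N x) = delta _ n.+1 x;
  tau_sigma : forall n i (x : X n.+1), (0 < i)%N -> (i <= n)%N ->
    tau _ (sigma _ i x) = sigma _ i.-1 (tau _ x);
  tau_sigma0 : forall n (x : X n.+1),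
    tau _ (sigma _ 0%N x) = sigma _ n (tau _ (tau _ x))
}.

Section CochainOperations.
Variables (k : comPzRingType) (O : operad k) (M : multiplication O).
Local Notation mu := (op_mu M).
Local Notation e := (op_e M).

Lemma deg_coface (n : nat) : ((n + 2).-1 = n.+1)%N.
Proof. by rewrite addn2. Qed.

Definition coface (n i : nat) (f : O n) : O n.+1 :=
  if i is i'.+1 then
    if insub i' is Some j then gcast (deg_coface n) (pcomp f j mu)
    else pcomp mu ord0 f
  else pcomp mu ord_max f.

Definition codegeneracy (n j : nat) (f : O n.+1) : O n :=
  if insub j is Some j' then gcast (addn0 n) (pcomp f j' e) else 0.

Lemma coface_is_linear n i : linear (@coface n i).
Proof.
rewrite /coface => a f g; case: i => [|i].
  exact: (pcomp_linr mu ord_max a f g).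
case: insub => [j|]; first by rewrite pcomp_linl linearP.
exact: (pcomp_linr mu ord0 a f g).
Qed.

HB.instance Definition _ n i := GRing.isLinear.Build k (O n) (O n.+1) *:%R
  (@coface n i) (@coface_is_linear n i).

Lemma codegeneracy_is_linear n j : linear (@codegeneracy n j).
Proof.
rewrite /codegeneracy => a f g; case: insub => [j'|].
  by rewrite pcomp_linl linearP.
by rewrite scaler0 addr0.
Qed.

HB.instance Definition _ n j := GRing.isLinear.Build k (O n.+1) (O n) *:%R
  (@codegeneracy n j) (@codegeneracy_is_linear n j).

Definition codiff (n : nat) (f : O n) : O n.+1 :=
  \sum_(i < n.+2) (-1) ^+ i *: coface i f.

Lemma codiff_is_linear n : linear (@codiff n).
Proof.
move=> a f g; rewrite /codiff scaler_sumr -big_split /=.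
by apply: eq_bigr => i _; rewrite coface_is_linear scalerDr !scalerA commr_sign.
Qed.

HB.instance Definition _ n := GRing.isLinear.Build k (O n) (O n.+1) *:%R
  (@codiff n) (@codiff_is_linear n).

Definition normalized (n : nat) : pred (O n) :=
  if n is n'.+1 then fun f => [forall j : 'I_n'.+1, codegeneracy j f == 0]
  else predT.

Definition cupc (m n : nat) (f : O m) (g : O n) : O (m + n)%N :=
  pcomp (pcomp mu ord0 f : O m.+1) ord_max g.

Definition circ (m n : nat) (f : O m) (g : O n) : O (m + n).-1 :=
  gsign k ((m%:Z - 1) * (n%:Z - 1)) *:
    \sum_(i < m) gsign k ((n%:Z - 1) * i%:Z) *: pcomp f i g.

Definition bracketc (m n : nat) (f : O m) (g : O n) : O (m + n).-1 :=
  circ f g - gsign k ((m%:Z - 1) * (n%:Z - 1)) *: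
               gcast (congr1 predn (addnC n m)) (circ g f).

Variable T : cyclic_structure O.
Local Notation tau := (op_tau T).

Definition connesB (n : nat) (f : O n.+1) : O n :=
  \sum_(i < n.+1) (-1) ^+ (i * n) *: iter i (tau n) (codegeneracy n (tau _ f)).

Lemma connesB_is_linear n : linear (@connesB n).
Proof.
move=> a f g; rewrite /connesB scaler_sumr -big_split /=.
apply: eq_bigr => i _; rewrite linearP codegeneracy_is_linear.
have -> : forall x y, iter i (tau n) (a *: x + y) =
    a *: iter i (tau n) x + iter i (tau n) y.
  by move=> x y; elim: (nat_of_ord i) => //= p ->; rewrite linearP.
by rewrite scalerDr !scalerA mulrC.
Qed.

HB.instance Definition _ n := GRing.isLinear.Build k (O n.+1) (O n) *:%R
  (@connesB n) (@connesB_is_linear n).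

End CochainOperations.

Section Degrees.
Variables i j l : int.
Lemma deg_brC : j + i - 1 = i + j - 1. Proof. by rewrite (addrC j). Qed.
Lemma deg_jacobi1 : (i + j - 1) + l - 1 = i + (j + l - 1) - 1.
Proof. lia. Qed.
Lemma deg_jacobi2 : j + (i + l - 1) - 1 = i + (j + l - 1) - 1.
Proof. lia. Qed.
Lemma deg_poisson1 : (i + j - 1) + l = i + (j + l) - 1. Proof. lia. Qed.
Lemma deg_poisson2 : j + (i + l - 1) = i + (j + l) - 1. Proof. lia. Qed.
Lemma deg_bv1 : (i - 1) + j = i + j - 1. Proof. lia. Qed.
Lemma deg_bv2 : i + (j - 1) = i + j - 1. Proof. lia. Qed.
Lemma deg_lieC : j + i - 2 = i + j - 2. Proof. lia. Qed.
Lemma deg_lie1 : (i + j - 2) + l - 2 = i + (j + l - 2) - 2. Proof. lia. Qed.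
Lemma deg_bracket : (i - 1) + (j - 1) = i + j - 2. Proof. lia. Qed.
Lemma deg_lie2 : j + (i + l - 2) - 2 = i + (j + l - 2) - 2. Proof. lia. Qed.
End Degrees.

Record gerstenhaber (k : comPzRingType) (G : int -> lmodType k) :=
Gerstenhaber {
  g_one : G 0;
  g_cup : forall i j, G i -> G j -> G (i + j);
  g_br : forall i j, G i -> G j -> G (i + j - 1);
  g_cup_linl : forall i j (b : G j), linear (fun a : G i => g_cup a b);
  g_cup_linr : forall i j (a : G i), linear (fun b : G j => g_cup a b);
  g_br_linl : forall i j (b : G j), linear (fun a : G i => g_br a b);
  g_br_linr : forall i j (a : G i), linear (fun b : G j => g_br a b);
  g_cupA : forall i j l (a : G i) (b : G j) (c : G l),
    gcast (addrA i j l) (g_cup a (g_cup b c)) = g_cup (g_cup a b) c;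
  g_cup1l : forall i (a : G i), gcast (add0r i) (g_cup g_one a) = a;
  g_cup1r : forall i (a : G i), gcast (addr0 i) (g_cup a g_one) = a;
  g_cupC : forall i j (a : G i) (b : G j),
    g_cup a b = gsign k (i * j) *: gcast (addrC j i) (g_cup b a);
  g_brC : forall i j (a : G i) (b : G j),
    g_br a b =
      - (gsign k ((i - 1) * (j - 1)) *: gcast (deg_brC i j) (g_br b a));
  g_jacobi : forall i j l (a : G i) (b : G j) (c : G l),
    g_br a (g_br b c) =
      gcast (deg_jacobi1 i j l) (g_br (g_br a b) c) +
      gsign k ((i - 1) * (j - 1)) *:
        gcast (deg_jacobi2 i j l) (g_br b (g_br a c));
  g_poisson : forall i j l (a : G i) (b : G j) (c : G l),
    g_br a (g_cup b c) =
      gcast (deg_poisson1 i j l) (g_cup (g_br a b) c) +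
      gsign k (j * (i - 1)) *:
        gcast (deg_poisson2 i j l) (g_cup b (g_br a c))
}.

Record batalin_vilkovisky (k : comPzRingType) (G : int -> lmodType k) :=
BatalinVilkovisky {
  bv_gerst :> gerstenhaber G;
  bv_B : forall i, {linear G i -> G (i - 1)};
  bv_BB : forall i (a : G i), bv_B _ (bv_B _ a) = 0;
  bv_br : forall i j (a : G i) (b : G j),
    g_br bv_gerst a b = gsign k i *:
      (bv_B _ (g_cup bv_gerst a b)
       - gcast (deg_bv1 i j) (g_cup bv_gerst (bv_B _ a) b)
       - gsign k i *: gcast (deg_bv2 i j) (g_cup bv_gerst a (bv_B _ b)))
}.

Record lie_algebra_deg_m2 (k : comPzRingType) (L : int -> lmodType k) :=
LieAlgebraDegM2 {
  lie_br : forall i j, L i -> L j -> L (i + j - 2);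
  lie_br_linl : forall i j (b : L j), linear (fun a : L i => lie_br a b);
  lie_br_linr : forall i j (a : L i), linear (fun b : L j => lie_br a b);
  lie_brC : forall i j (a : L i) (b : L j),
    lie_br a b = - (gsign k (i * j) *: gcast (deg_lieC i j) (lie_br b a));
  lie_jacobi : forall i j l (a : L i) (b : L j) (c : L l),
    lie_br a (lie_br b c) =
      gcast (deg_lie1 i j l) (lie_br (lie_br a b) c) +
      gsign k (i * j) *: gcast (deg_lie2 i j l) (lie_br b (lie_br a c))
}.

Section Submodule.
Variables (k : pzRingType) (V : lmodType k) (S : submodClosed V).

Definition submod_of := {x : V | x \in S}.
HB.instance Definition _ := SubChoice.on submod_of.
HB.instance Definition _ := [SubChoice_isSubLmodule of submod_of by <:].
End Submodule.

Section QuotientModule.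
Variables (k : pzRingType) (V : lmodType k) (S : submodClosed V).

(* Quotient.quot wants a zmodClosed predicate. *)
Definition zmod_pred : V -> bool := fun x => x \in S.

Lemma zmod_pred_closed : zmod_closed zmod_pred.
Proof. exact: (GRing.submod_closedB (submodClosedP S)). Qed.

HB.instance Definition _ := GRing.isZmodClosed.Build V zmod_pred
  zmod_pred_closed.

Definition quot_by := @Quotient.quot V (GRing.ZmodClosed.clone V zmod_pred _).
HB.instance Definition _ := GRing.Zmodule.on quot_by.
HB.instance Definition _ := EqQuotient.on quot_by.

Definition quot_scale (a : k) (q : quot_by) : quot_by :=
  \pi_quot_by (a *: repr q).

Lemma pi_scale (a : k) (x : V) :
  quot_scale a (\pi_quot_by x) = \pi_quot_by (a *: x).
Proof.
have [S0 SP] := submodClosedP S.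
apply/eqP; rewrite -Quotient.idealrBE -scalerBr -[_ *: _]addr0.
apply: SP => //; rewrite -[_ \in _]/(_ \in zmod_pred).
by rewrite Quotient.idealrBE reprK.
Qed.

Lemma quot_scalerA a b q :
  quot_scale a (quot_scale b q) = quot_scale (a * b) q.
Proof.
by elim/quotW: q => x; rewrite [quot_scale b _]pi_scale !pi_scale scalerA.
Qed.

Lemma quot_scale1r : left_id 1 quot_scale.
Proof. by elim/quotW=> x; rewrite pi_scale scale1r. Qed.

Lemma pi_quotD : {morph \pi_quot_by : x y / x + y}.
Proof. exact: Quotient.pi_add. Qed.

Lemma quot_scalerDr : right_distributive quot_scale +%R.
Proof.
move=> a; elim/quotW=> x; elim/quotW=> y.
by rewrite -pi_quotD !pi_scale -pi_quotD scalerDr.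
Qed.

Lemma quot_scalerDl q : {morph quot_scale^~ q : a b / a + b}.
Proof.
by move=> a b; elim/quotW: q => x; rewrite !pi_scale -pi_quotD scalerDl.
Qed.

HB.instance Definition _ := GRing.Zmodule_isLmodule.Build k quot_by
  quot_scalerA quot_scale1r quot_scalerDr quot_scalerDl.
End QuotientModule.

(* N i is the degree i part of a subcomplex of (C, d): a class is a cocycle   *)
(* in N, modulo the cocycles that are coboundaries of elements of N. The      *)
(* construction makes sense without assuming that d o d = 0.                  *)
Section Cohomology.
Variables (k : pzRingType) (C : int -> lmodType k).
Variable d : forall i, {linear C i -> C (i + 1)}.
Variable N : forall i, submodClosed (C i).

Definition cocycle_pred (i : int) : {pred C i} :=
  [pred x | (x \in N i) && (d i x == 0)].

Lemma cocycle_pred_closed i : submod_closed (@cocycle_pred i).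
Proof.
have [N0 NP] := submodClosedP (N i).
split=> [|a x y]; rewrite !inE; first by rewrite N0 linear0 eqxx.
move=> /andP[Nx /eqP dx] /andP[Ny /eqP dy].
by rewrite NP //= linearP dx dy scaler0 addr0 eqxx.
Qed.

HB.instance Definition _ i := GRing.isSubmodClosed.Build k (C i)
  (@cocycle_pred i) (@cocycle_pred_closed i).

Definition cocycle (i : int) :=
  submod_of (GRing.SubmodClosed.clone k (C i) (@cocycle_pred i) _).
HB.instance Definition _ i := GRing.Lmodule.on (cocycle i).
HB.instance Definition _ i := SubType.on (cocycle i).

Definition coboundary_pred (i : int) : {pred cocycle i} :=
  [pred u | `[< exists2 y : C (i - 1), y \in N (i - 1) &
                  gcast (subrK 1 i) (d _ y) = val u >]].

Lemma coboundary_pred_closed i : submod_closed (@coboundary_pred i).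
Proof.
have [N0 NP] := submodClosedP (N (i - 1)).
split=> [|a u v]; rewrite !inE.
  by apply/asboolP; exists 0; rewrite // !linear0.
move=> /asboolP[x Nx xu] /asboolP[y Ny yv].
by apply/asboolP; exists (a *: x + y); rewrite ?NP // !linearP /= xu yv.
Qed.

HB.instance Definition _ i := GRing.isSubmodClosed.Build k (cocycle i)
  (@coboundary_pred i) (@coboundary_pred_closed i).

Definition cohomology (i : int) : lmodType k :=
  quot_by (GRing.SubmodClosed.clone k (cocycle i) (@coboundary_pred i) _).

(* x, up to the identification i = j, is a cocycle of N whose class is a.     *)
Definition represents (i j : int) (x : C i) (a : cohomology j) : Prop :=
  exists (eij : i = j) (u : cocycle j),
    val u = gcast eij x /\ a = \pi_(cohomology j) u.
End Cohomology.

Section Product.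
Variables (k : pzRingType) (V : nat -> lmodType k).

Definition prod_mod : Type := forall n, V n.
HB.instance Definition _ := Choice.copy prod_mod (forall n, V n).

Implicit Types c : prod_mod.
Definition prod_zero : prod_mod := fun=> 0.
Definition prod_opp c : prod_mod := fun n => - c n.
Definition prod_add c c' : prod_mod := fun n => c n + c' n.
Definition prod_scale (a : k) c : prod_mod := fun n => a *: c n.

Lemma prod_addA : associative prod_add.
Proof.
by move=> c1 c2 c3; apply: functional_extensionality_dep => n; apply: addrA.
Qed.
Lemma prod_addC : commutative prod_add.
Proof.
by move=> c1 c2; apply: functional_extensionality_dep => n; apply: addrC.
Qed.
Lemma prod_add0 : left_id prod_zero prod_add.
Proof.
by move=> c; apply: functional_extensionality_dep => n; apply: add0r.
Qed.
Lemma prod_addN : left_inverse prod_zero prod_opp prod_add.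
Proof.
by move=> c; apply: functional_extensionality_dep => n; apply: addNr.
Qed.

HB.instance Definition _ := GRing.isZmodule.Build prod_mod
  prod_addA prod_addC prod_add0 prod_addN.

Lemma prod_scalerA a b c : prod_scale a (prod_scale b c) = prod_scale (a * b) c.
Proof. by apply: functional_extensionality_dep => n; apply: scalerA. Qed.
Lemma prod_scale1 : left_id 1 prod_scale.
Proof.
by move=> c; apply: functional_extensionality_dep => n; apply: scale1r.
Qed.
Lemma prod_scalerDr : right_distributive prod_scale +%R.
Proof.
by move=> a c c'; apply: functional_extensionality_dep => n; apply: scalerDr.
Qed.
Lemma prod_scalerDl c : {morph prod_scale^~ c : a b / a + b}.
Proof.
by move=> a b; apply: functional_extensionality_dep => n; apply: scalerDl.
Qed.

HB.instance Definition _ := GRing.Zmodule_isLmodule.Build k prod_mod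
  prod_scalerA prod_scale1 prod_scalerDr prod_scalerDl.
End Product.

Section OperadCohomology.
Variables (k : comPzRingType) (O : operad k) (M : multiplication O).

Definition cochain (z : int) : lmodType k :=
  match z with Posz n => O n | Negz _ => 'rV[k]_0 end.

Lemma deg_zd (n : nat) : n.+1%:Z = n%:Z + 1. Proof. by rewrite -addn1. Qed.

Definition zd (z : int) : cochain z -> cochain (z + 1) :=
  match z with
  | Posz n => fun f => gcast (G := cochain) (deg_zd n) (codiff M f)
  | Negz n => fun=> 0
  end.

Lemma zd_is_linear z : linear (@zd z).
Proof.
case: z => n a f g /=; last by rewrite scaler0 addr0.
by rewrite codiff_is_linear linearP.
Qed.

HB.instance Definition _ z := GRing.isLinear.Build k (cochain z)
  (cochain (z + 1)) *:%R (@zd z) (@zd_is_linear z).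

Definition everything (V : lmodType k) : {pred V} := predT.

Lemma everything_closed V : submod_closed (@everything V).
Proof. by []. Qed.

HB.instance Definition _ V := GRing.isSubmodClosed.Build k V
  (@everything V) (@everything_closed V).

Definition operad_cohomology : int -> lmodType k :=
  cohomology zd
    (fun z => GRing.SubmodClosed.clone k _ (@everything (cochain z)) _).

(* f : O n is a cocycle whose class is a; this includes n = z. *)
Definition has_class (n : nat) (f : O n) (z : int) (a : operad_cohomology z) :
    Prop :=
  represents (f : cochain n%:Z) a.

Variable T : cyclic_structure O.

Lemma deg_zB (n : nat) : n%:Z = n.+1%:Z - 1.
Proof. by rewrite deg_zd addrK. Qed.

Definition zB (z : int) : cochain z -> cochain (z - 1) :=
  match z with
  | Posz n.+1 => fun f => gcast (G := cochain) (deg_zB n) (connesB M T f)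
  | _ => fun=> 0
  end.

Lemma zB_is_linear z : linear (@zB z).
Proof.
case: z => [[|n]|n] a f g /=; rewrite ?scaler0 ?addr0 //.
by rewrite connesB_is_linear linearP.
Qed.

Definition znormalized (z : int) : {pred cochain z} :=
  match z with Posz n => @normalized k O M n | Negz _ => predT end.

Lemma znormalized_closed z : submod_closed (@znormalized z).
Proof.
case: z => [[|n]|n] //; split=> [|a f g].
  by apply/forallP => j; rewrite linear0.
move=> /forallP fN /forallP gN; apply/forallP => j.
by rewrite codegeneracy_is_linear (eqP (fN j)) (eqP (gN j)) scaler0 addr0.
Qed.

(* Tot^z as the finitely supported families (c_0, c_1, ...) of normalized     *)
(* c_m in C^(z + 2m), inside the product of the C^(z + 2m).                   *)
Definition tot_prod (z : int) : lmodType k :=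
  prod_mod (fun m : nat => cochain (z + (2 * m)%:Z)).

Definition tot_pred (z : int) : {pred tot_prod z} :=
  [pred c : tot_prod z | `[< (forall m, c m \in @znormalized _) /\
             (exists K, forall m, (K <= m)%N -> c m = 0) >]].

Lemma tot_pred_closed z : submod_closed (@tot_pred z).
Proof.
split=> [|a b c]; rewrite !inE.
  apply/asboolP; split=> [m|]; last by exists 0%N.
  exact: (znormalized_closed _).1.
move=> /asboolP[bN [K bK]] /asboolP[cN [L cL]]; apply/asboolP; split=> [m|].
  exact: (znormalized_closed _).2.
exists (maxn K L) => m; rewrite geq_max => /andP[Km Lm].
by rewrite -[LHS]/(a *: b m + c m) bK ?cL // scaler0 addr0.
Qed.

HB.instance Definition _ z := GRing.isSubmodClosed.Build k (tot_prod z)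
  (@tot_pred z) (@tot_pred_closed z).

Section TotDegrees.
Variables (z : int) (m : nat).
Lemma deg_tot_d : z + (2 * m)%:Z + 1 = z + 1 + (2 * m)%:Z.
Proof. lia. Qed.
Lemma deg_tot_B : z + (2 * m.+1)%:Z - 1 = z + 1 + (2 * m)%:Z.
Proof. lia. Qed.
End TotDegrees.

Definition tot_d (z : int) (c : tot_prod z) : tot_prod (z + 1) := fun m =>
  gcast (deg_tot_d z m) (zd (c m)) + gcast (deg_tot_B z m) (zB (c m.+1)).

Lemma tot_d_is_linear z : linear (@tot_d z).
Proof.
move=> a b c; apply: functional_extensionality_dep => m; rewrite /tot_d.
rewrite -[RHS]/(a *: (_ + _) + (_ + _)) /= zd_is_linear zB_is_linear !linearP.
by rewrite /= scalerDr addrACA.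
Qed.

HB.instance Definition _ z := GRing.isLinear.Build k (tot_prod z)
  (tot_prod (z + 1)) *:%R (@tot_d z) (@tot_d_is_linear z).

Definition cyclic_cohomology : int -> lmodType k :=
  cohomology tot_d (fun z => GRing.SubmodClosed.clone k _ (@tot_pred z) _).

Definition tot_single (z : int) (c : cochain z) : tot_prod z := fun m =>
  if m is 0%N then gcast (esym (addr0 z)) c else 0.

End OperadCohomology.

(* Main.v *)
Require Import Defs.
From HB Require Import structures.
From mathcomp Require Import all_boot all_order all_algebra.
From mathcomp Require Import boolp zify.

(** Everything is computed in one module, the product of all O(n), where the
   casts between arities disappear. The partial compositions are replaced by
   their operadic suspension x *[i] y, which is (-1)^((n+1)i) times the
   composition of x with y of arity n at the input i, and the cofaces by D_i =
   (-1)^i delta_i. With these signs an insertion commutes with D_i up to one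
   global sign, and all the homotopies below come from a single formula: the
   defect of the Leibniz rule for d(x *[a] f) is a difference of two
   consecutive terms of a sequence indexed by a (diff_scomp_telescope), hence
   telescopes as soon as one sums over the input a.

   Gerstenhaber structure. Summing over all inputs of f shows that the circle
   product of f and g is a homotopy between the two orders of the cup product
   (diff_circ). Summing over pairs of inputs shows that the brace operation is
   a homotopy for the Poisson rule on cocycles (diff_brace). The Jacobi
   identity already holds on cochains, because the associator of the circle
   product is a sum over insertions at two distinct inputs (pcirc_assoc).

   Cyclic structure. Picture an n-ary operation as a planar tree with n inputs
   and a root; tau_n turns it by one notch, so that the first input becomes
   the root and the root becomes the last input. Cofaces and codegeneracies
   are insertions of mu and e, and mu is invariant under rotation, so the
   axioms of a cyclic operad directly give those of a cocyclic module. The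
   operator B is, up to sign, the sum over the n inputs of the operation that
   makes this input the root and plugs the former root with e. The coboundary
   of one such term is again telescopic in the input (diff_reroot), whence dB
   + Bd = 0.

   Batalin-Vilkovisky identity. Among the m + n terms of B(f cup g), the first
   m put the root at an input of f. Up to a coboundary and a sign, their sum
   differs from (B f) cup g by the circle product of f and g (pcirc_connes);
   the homotopy is the sum over the ways to insert g into f and then to put
   the root at an input of f on the right of g. The last n terms are, up to
   sign, the first n terms of B(g cup f), to which the same result applies.
   Adding both halves yields the bracket (bracket_connes). The identity B B =
   0 holds on normalized cochains, where each term of B B contains e inserted
   at an input of f; every cocycle is cohomologous to a normalized one
   (normalize).

   Lie structure. In the exact couple of H and HC one has partial I = B and I
   partial = 0, so I B = 0 and B partial = 0. Hence partial [a, b] = -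
   {partial a, partial b}, and applying I to the Batalin-Vilkovisky identity
   for x = partial a and a product y z, with y = partial b and z = partial c,
   kills its term B(x y z); what remains is the Jacobi identity (hI_jacobi). *)

Set Implicit Arguments.
Unset Strict Implicit.
Unset Printing Implicit Defensive.

Import GRing.Theory.
Local Open Scope ring_scope.
Local Open Scope quotient_scope.
Local Notation pcomp := Defs.pcomp.

Reserved Notation "x *[ i ] y"
  (at level 40, left associativity, format "x  *[ i ]  y").

(** * Operations of unspecified arity *)

Section Trees.
Variables (k : comPzRingType) (O : operad k).
(** Packing the arity with the operation turns the associativity axiom, which
   is stated up to casts between equal arities, into the plain equality
   graftA. *)
Definition elt := {n : nat & O n}.
Definition el n (x : O n) : elt := existT (fun n => O n) n x.
Definition arity (F : elt) : nat := projT1 F.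
Definition id_elt : elt := el (op_id O).

Lemma el_gcast m n (e : m = n) (x : O m) : el (gcast e x) = el x.
Proof. by case: _ / e. Qed.

(** Only the values of G below the arity of F matter (eq_graft); a total
   function avoids tracking the index bounds. *)
Definition graft (F : elt) (G : nat -> elt) : elt :=
  el (op_gamma (projT2 F) (fun j : 'I_(arity F) => projT2 (G j))).

Lemma graftE n (f : O n) i (g : forall j : 'I_n, O (i j)) (G : nat -> elt) :
  (forall j : 'I_n, G j = el (g j)) -> el (op_gamma f g) = graft (el f) G.
Proof.
move=> Gg; pose G' (j : 'I_n) := G j.
have E : G' = fun j => el (g j) by apply: funext.
rewrite /graft /= -/G'.
have -> : op_gamma f (fun j => projT2 (G j)) =
  op_gamma f (fun j => projT2 (G' j)) by [].
by rewrite -[RHS]/(el (op_gamma f (fun j : 'I_n => projT2 (G' j)))) E.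
Qed.

Lemma eq_graft F G G' : (forall j, (j < arity F)%N -> G j = G' j) ->
  graft F G = graft F G'.
Proof.
move=> GG'; case: F GG' => n f /= GG'; apply: (@graftE n f _ _ G') => j.
by rewrite -GG' //; case: (G j).
Qed.

(** The position, among the inputs of a grafting, of the first input of the
   j-th grafted operation. *)
Definition offset (G : nat -> elt) (j : nat) : nat :=
  (\sum_(l < j) arity (G l))%N.

Lemma graftA F G H :
  graft (graft F G) H =
  graft F (fun j => graft (G j) (fun t => H (offset G j + t)%N)).
Proof.
rewrite {1}/graft -(el_gcast (sum_Rank _)) op_gammaA.
case: F => n f; apply: graftE => j; symmetry.
rewrite [RHS](_ : _ = graft (el (projT2 (G j)))
    (fun t => H (offset G j + t)%N)); first last.
  by case: (G j).
apply: graftE => t; rewrite tagnat.RankEsum /offset.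
rewrite (big_ord_widen n (fun l => arity (G l)) (ltnW (ltn_ord j))).
by case: (H _).
Qed.

Lemma graft_id1 G : graft id_elt G = G 0%N.
Proof.
rewrite (@eq_graft id_elt _ (fun=> G 0%N)); last by case.
case: (G 0%N) => n g; rewrite -[RHS]/(el g) -[in RHS](op_gamma1l g) el_gcast.
by symmetry; apply: graftE.
Qed.

Lemma graft_id F : graft F (fun=> id_elt) = F.
Proof.
case: F => n f; rewrite -[RHS]/(el f) -[in RHS](op_gamma1r f) el_gcast.
by symmetry; apply: graftE.
Qed.

Definition arg_at (i : nat) (G : elt) (l : nat) : elt :=
  if l == i then G else id_elt.

Definition insertion (F : elt) (i : nat) (G : elt) : elt :=
  graft F (arg_at i G).

Lemma el_pcomp m n (f : O m) (i : 'I_m) (g : O n) :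
  el (pcomp f i g) = insertion (el f) i (el g).
Proof.
rewrite /pcomp el_gcast; apply: graftE => j; rewrite /arg_at /part_arg.
by rewrite -[nat_of_ord j == i]/(j == i); case: (j == i).
Qed.

Lemma offset_leaf i G j :
  offset (arg_at i G) j = if (i < j)%N then (j + arity G).-1 else j.
Proof.
rewrite /offset; elim: j => [|j IH]; first by rewrite big_ord0.
rewrite big_ord_recr /= IH /arg_at ltnS; have id1 : arity id_elt = 1%N by [].
by case: ltngtP; rewrite ?id1; lia.
Qed.

(** Both axioms of partial composition are instances of graftA in which all
   but one or two of the grafted operations are the identity. *)
Lemma insertion_nested F i G j H : (i < arity F)%N -> (j < arity G)%N ->
  insertion (insertion F i G) (i + j) H = insertion F i (insertion G j H).
Proof.
move=> lt_i lt_j; rewrite /insertion graftA; apply: eq_graft => l _.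
rewrite offset_leaf /arg_at; case: (eqVneq l i) => [->|ne_li].
  by rewrite ltnn; apply: eq_graft => t _; rewrite eqn_add2l.
by rewrite graft_id1 addn0; case: ltnP => ?; case: eqP => //; lia.
Qed.

Lemma insertion_parallel F i G j H : (i < j < arity F)%N ->
  insertion (insertion F i G) (j + arity G).-1 H =
  insertion (insertion F j H) i G.
Proof.
move=> /andP[lt_ij lt_j]; rewrite /insertion !graftA.
have ij : (i == j) = false by lia.
have ji : (j < i)%N = false by lia.
apply: eq_graft => l lt_l; rewrite !offset_leaf /arg_at.
case: (eqVneq l i) => [->|ne_li].
  rewrite ltnn ij ji graft_id1 addn0 eqxx -[RHS]graft_id.
  by apply: eq_graft => t lt_t; case: eqP => //; lia.
case: (eqVneq l j) => [->|ne_lj].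
  rewrite lt_ij ltnn graft_id1 addn0 eqxx -[LHS]graft_id.
  by apply: eq_graft => t lt_t; case: eqP => //; lia.
rewrite !graft_id1 !addn0; case: (ltnP i l) => ?; case: (ltnP j l) => ?.
all: by case: eqP; case: eqP => //; lia.
Qed.

Lemma insertion_id F i : insertion F i id_elt = F.
Proof.
rewrite -[RHS]graft_id; apply: eq_graft => l _; rewrite /arg_at.
by case: (l == i).
Qed.

Lemma id_insertion G : insertion id_elt 0 G = G.
Proof. exact: graft_id1. Qed.

Lemma arity_insertion F i G : (i < arity F)%N ->
  arity (insertion F i G) = (arity F + arity G).-1.
Proof.
case: F => m f; case: G => n g lt_i.
by rewrite -[i]/(nat_of_ord (Ordinal lt_i)) -(el_pcomp f (Ordinal lt_i) g).
Qed.
End Trees.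

(** * The product of all arities *)

Section TotalModule.
Variables (k : comPzRingType) (O : operad k).

Definition total : lmodType k := prod_mod (op_mod O).
Local Notation U := total.

(** The cast is by decision on the arities, so that the value at a given arity
   is computed by tinjK and tinj_neq. *)
Definition tinj n (f : O n) : U := fun d =>
  match n =P d with ReflectT e => gcast e f | ReflectF _ => 0 end.

Lemma tinjK n (f : O n) : tinj f n = f.
Proof. by rewrite /tinj; case: eqP => // e; rewrite (eq_irrelevance e erefl).
  Qed.

Lemma tinj_neq n d (f : O n) : n != d -> tinj f d = 0.
Proof. by rewrite /tinj; case: eqP. Qed.

Lemma total_ext (x y : U) : (forall n, x n = y n) -> x = y.
Proof. exact: functional_extensionality_dep. Qed.

Lemma tinj_is_linear n : linear (@tinj n).
Proof.
move=> a f g; apply: total_ext => d.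
rewrite -[RHS]/(a *: tinj f d + tinj g d) /tinj.
by case: eqP => [e|_]; rewrite ?linearP // scaler0 addr0.
Qed.

HB.instance Definition _ n := GRing.isLinear.Build k (O n) U *:%R
  (@tinj n) (@tinj_is_linear n).

Lemma tinj_gcast m n (e : m = n) (f : O m) : tinj (gcast e f) = tinj f.
Proof. by case: _ / e. Qed.

Lemma tinj_inj n : injective (@tinj n).
Proof. by move=> f g E; rewrite -(tinjK f) E tinjK. Qed.

Definition hom n (x : U) : Prop := x = tinj (x n).

Lemma hom_tinj n (f : O n) : hom n (tinj f).
Proof. by rewrite /hom tinjK. Qed.

Lemma hom0 n : hom n 0. Proof. by rewrite /hom [_ n]/= linear0. Qed.

Lemma homD n x y : hom n x -> hom n y -> hom n (x + y).
Proof. by move=> hx hy; rewrite /hom {1}hx {1}hy -linearD. Qed.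

Lemma homZ n a x : hom n x -> hom n (a *: x).
Proof. by move=> hx; rewrite /hom {1}hx -linearZ. Qed.

Lemma homN n x : hom n x -> hom n (- x).
Proof. by move=> hx; rewrite -scaleN1r; apply: homZ. Qed.

Lemma homB n x y : hom n x -> hom n y -> hom n (x - y).
Proof. by move=> hx hy; apply: homD => //; apply: homN. Qed.

Lemma hom_sum n I (r : seq I) (P : pred I) (F : I -> U) :
  (forall i, P i -> hom n (F i)) -> hom n (\sum_(i <- r | P i) F i).
Proof.
move=> hF; elim/big_ind: _ => // [|x y]; [exact: hom0 | exact: homD].
Qed.

Lemma hom_neq n d x : hom n x -> n != d -> x d = 0.
Proof. by move=> -> /tinj_neq ->. Qed.

Definition pcomp_in m n (i : nat) (f : O m) (g : O n) : U :=
  if insub i is Some j then tinj (pcomp f j g) else 0.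

Lemma pcomp_in_linl m n i (g : O n) : linear (fun f : O m => pcomp_in i f g).
Proof.
move=> a f f'; rewrite /pcomp_in; case: insub => [j|].
  by rewrite pcomp_linl linearP.
by rewrite scaler0 addr0.
Qed.

Lemma pcomp_in_linr m n i (f : O m) : linear (@pcomp_in m n i f).
Proof.
move=> a g g'; rewrite /pcomp_in; case: insub => [j|].
  by rewrite pcomp_linr linearP.
by rewrite scaler0 addr0.
Qed.

Lemma pcomp_in0l m n i (g : O n) : pcomp_in i (0 : O m) g = 0.
Proof. by have := pcomp_in_linl i g (-1) 0 (0 : O m);
  rewrite scaler0 addr0 scaleN1r addNr. Qed.

Lemma pcomp_in0r m n i (f : O m) : pcomp_in i f (0 : O n) = 0.
Proof. by have := pcomp_in_linr i f (-1) 0 (0 : O n);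
  rewrite scaler0 addr0 scaleN1r addNr. Qed.

(** An output of arity d comes from arities m and n with (m + n).-1 = d, so
   both are at most d.+1 and the sum is finite. *)
Definition tcomp (i : nat) (x y : U) : U := fun d =>
  \sum_(m < d.+2) \sum_(n < d.+2) pcomp_in i (x m) (y n) d.

Lemma tcomp_linl i y : linear (fun x => tcomp i x y).
Proof.
move=> a x x'; apply: total_ext => d.
rewrite -[RHS]/(a *: tcomp i x y d + tcomp i x' y d) /tcomp scaler_sumr
  -big_split.
apply: eq_bigr => m _; rewrite /= scaler_sumr -big_split.
by apply: eq_bigr => n _; rewrite /= pcomp_in_linl.
Qed.

Lemma tcomp_linr i x : linear (tcomp i x).
Proof.
move=> a y y'; apply: total_ext => d.
rewrite -[RHS]/(a *: tcomp i x y d + tcomp i x y' d) /tcomp scaler_sumr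
  -big_split.
apply: eq_bigr => m _; rewrite /= scaler_sumr -big_split.
by apply: eq_bigr => n _; rewrite /= pcomp_in_linr.
Qed.

HB.instance Definition _ i x := GRing.isLinear.Build k U U *:%R
  (tcomp i x) (tcomp_linr i x).

Definition ltcomp i y x := tcomp i x y.
HB.instance Definition _ i y := GRing.isLinear.Build k U U *:%R
  (ltcomp i y) (tcomp_linl i y).

Lemma tcompZl i a x y : tcomp i (a *: x) y = a *: tcomp i x y.
Proof. exact: (linearZ_LR (ltcomp i y)). Qed.

Lemma tcompZr i a x y : tcomp i x (a *: y) = a *: tcomp i x y.
Proof. exact: linearZ_LR. Qed.

Lemma pcomp_in_out m n d i (f : O m) (g : O n) :
  ((d.+2 <= m) || (d.+2 <= n))%N -> pcomp_in i f g d = 0.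
Proof.
rewrite /pcomp_in; case: insubP => // j _ _ le_d; rewrite tinj_neq //.
by have := ltn_ord j; lia.
Qed.

Lemma tcomp_tinj m n i (f : O m) (g : O n) :
  tcomp i (tinj f) (tinj g) = pcomp_in i f g.
Proof.
apply: total_ext => d; rewrite /tcomp; case: (ltnP m d.+2) => lt_m; last first.
  rewrite pcomp_in_out ?lt_m // big1 // => m' _; rewrite big1 // => n' _.
  by rewrite [tinj f _]tinj_neq ?pcomp_in0l //; have := ltn_ord m'; lia.
rewrite (bigD1 (Ordinal lt_m)) //= [X in _ + X]big1 ?addr0; last first.
  move=> m' ne_m; rewrite big1 // => n' _;
    rewrite [tinj f _]tinj_neq ?pcomp_in0l //.
  by apply: contraNneq ne_m => e; apply/eqP/val_inj.
case: (ltnP n d.+2) => lt_n; last first.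
  rewrite pcomp_in_out ?lt_n ?orbT // big1 // => n' _.
  by rewrite [tinj g _]tinj_neq ?pcomp_in0r //; have := ltn_ord n'; lia.
rewrite (bigD1 (Ordinal lt_n)) //= [X in _ + X]big1 ?addr0; last first.
  move=> n' ne_n; rewrite [tinj g _]tinj_neq ?pcomp_in0r //.
  by apply: contraNneq ne_n => e; apply/eqP/val_inj.
by rewrite !tinjK.
Qed.

Definition total_el (F : elt O) : U := tinj (projT2 F).

Lemma tcomp_el F i G : (i < arity F)%N ->
  tcomp i (total_el F) (total_el G) = total_el (insertion F i G).
Proof.
case: F => m f; case: G => n g lt_i;
  rewrite /total_el tcomp_tinj /pcomp_in insubT.
by rewrite -[RHS]/(total_el (insertion (el f) (Ordinal lt_i) (el g))) -el_pcomp.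
Qed.

Lemma tcomp_pcomp m n (f : O m) (i : 'I_m) (g : O n) :
  tinj (pcomp f i g) = tcomp i (tinj f) (tinj g).
Proof. by rewrite tcomp_tinj /pcomp_in valK. Qed.

Lemma hom_el n x : hom n x -> {F : elt O | arity F = n & x = total_el F}.
Proof. by move=> hx; exists (el (x n)). Qed.

Lemma tcomp_out m i x y n : hom m x -> hom n y -> (m <= i)%N -> tcomp i x y = 0.
Proof.
move=> -> -> le_mi; rewrite tcomp_tinj /pcomp_in; case: insubP => // j lt_i.
by rewrite ltnNge le_mi in lt_i.
Qed.

Lemma hom_tcomp m n i x y : hom m x -> hom n y -> hom (m + n).-1 (tcomp i x y).
Proof.
move=> hx hy; case: (ltnP i m) => [lt_i|]; last first.
  by move=> /(tcomp_out hx hy) ->; apply: hom0.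
rewrite hx hy tcomp_tinj /pcomp_in insubT; exact: hom_tinj.
Qed.

Lemma tcomp_nested m n p i j f g h : hom m f -> hom n g -> hom p h ->
  (i < m)%N -> (j < n)%N ->
  tcomp (i + j) (tcomp i f g) h = tcomp i f (tcomp j g h).
Proof.
move=> /hom_el[F <- ->] /hom_el[G <- ->] /hom_el[H _ ->] lt_i lt_j.
rewrite !tcomp_el ?insertion_nested //.
by rewrite arity_insertion //; lia.
Qed.

Lemma tcomp_parallel m n p i j f g h : hom m f -> hom n g -> hom p h ->
  (i < j < m)%N ->
  tcomp (j + n).-1 (tcomp i f g) h = tcomp i (tcomp j f h) g.
Proof.
move=> /hom_el[F <- ->] /hom_el[G <- ->] /hom_el[H _ ->] /andP[lt_ij lt_j].
have lt_i := ltn_trans lt_ij lt_j.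
rewrite !tcomp_el ?insertion_parallel ?lt_ij // arity_insertion //; lia.
Qed.

Definition tid : U := tinj (op_id O).

Lemma hom_tid : hom 1 tid. Proof. exact: hom_tinj. Qed.

Lemma tcomp_id m f i : hom m f -> (i < m)%N -> tcomp i f tid = f.
Proof.
move=> /hom_el[F <- ->] lt_i; rewrite -[tid]/(total_el (id_elt O)) tcomp_el //.
by rewrite insertion_id.
Qed.

Lemma id_tcomp n g : hom n g -> tcomp 0 tid g = g.
Proof.
move=> /hom_el[G _ ->]; rewrite -[tid]/(total_el (id_elt O)) tcomp_el //.
by rewrite id_insertion.
Qed.

End TotalModule.

(** * Equality in abelian groups by reflection *)

Inductive zterm := ZVar of nat | ZAdd of zterm & zterm | ZOpp of zterm | ZZero.

Fixpoint zeval (V : zmodType) (env : seq V) (e : zterm) : V :=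
  match e with
  | ZVar i => nth 0 env i
  | ZAdd a b => zeval env a + zeval env b
  | ZOpp a => - zeval env a
  | ZZero => 0
  end.

Fixpoint zcoef (i : nat) (e : zterm) : int :=
  match e with
  | ZVar j => (i == j)%:Z
  | ZAdd a b => zcoef i a + zcoef i b
  | ZOpp a => - zcoef i a
  | ZZero => 0
  end.

Lemma zeval_coef (V : zmodType) (env : seq V) e :
  zeval env e = \sum_(i < size env) env`_i *~ zcoef i e.
Proof.
elim: e => [j|a IHa b IHb|a IHa|] /=.
- case: (ltnP j (size env)) => [lt_j|le_j].
    rewrite (bigD1 (Ordinal lt_j)) //= eqxx mulr1z big1 ?addr0 // => i ne_i.
    by rewrite (_ : (i == j :> nat) = false) ?mulr0z //; apply: negbTE.
  rewrite nth_default // big1 // => i _.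
  by rewrite (_ : (i == j :> nat) = false) ?mulr0z //; have := ltn_ord i; lia.
- by rewrite IHa IHb -big_split; apply: eq_bigr => i _; rewrite mulrzDr.
- by rewrite IHa -sumrN; apply: eq_bigr => i _; rewrite mulrNz.
- by rewrite big1 // => i _; rewrite mulr0z.
Qed.

(** Two formal sums agree in every abelian group when every atom has the same
   integer coefficient in both; the premise is decided by computation. *)
Lemma zeval_eq (V : zmodType) (env : seq V) e e' :
  all (fun i => zcoef i e == zcoef i e') (iota 0 (size env)) ->
  zeval env e = zeval env e'.
Proof.
move=> /allP eqc; rewrite !zeval_coef; apply: eq_bigr => i _.
by rewrite (eqP (eqc i _)) // mem_iota add0n ltn_ord.
Qed.

Ltac z_insert x l :=
  match l with
  | nil => constr:(cons x nil)
  | cons ?y ?l' =>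
      match constr:(Set) with
      | _ => let _ := match constr:(Set) with _ => unify x y end in l
      | _ => let r := z_insert x l' in constr:(cons y r)
      end
  end.
Ltac z_atoms e l :=
  match e with
  | (?a + ?b)%R => let l1 := z_atoms a l in z_atoms b l1
  | (- ?a)%R => z_atoms a l
  | 0%R => l
  | _ => z_insert e l
  end.
Ltac z_index x l :=
  match l with
  | cons ?y ?l' =>
      match constr:(Set) with
      | _ => let _ := match constr:(Set) with _ => unify x y end in constr:(0%N)
      | _ => let n := z_index x l' in constr:(S n)
      end
  end.
Ltac z_reify e l :=
  match e with
  | (?a + ?b)%R => let x := z_reify a l in let y := z_reify b l in
      constr:(ZAdd x y)
  | (- ?a)%R => let x := z_reify a l in constr:(ZOpp x)
  | 0%R => constr:(ZZero)
  | _ => let n := z_index e l in constr:(ZVar n)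
  end.
(** Closes equalities that hold in every abelian group, the maximal subterms
   that are not sums, opposites or zero being the atoms. *)
Ltac abel :=
  match goal with
  | |- ?a = ?b :> ?V =>
      let l0 := z_atoms a (@nil V) in
      let l := z_atoms b l0 in
      let x := z_reify a l in
      let y := z_reify b l in
      let H := fresh in
      pose proof (@zeval_eq _ l x y) as H;
      exact (H isT)
  end.

Lemma signZ (k : pzRingType) (V : lmodType k) n (x : V) :
  (-1) ^+ n *: x = if odd n then - x else x.
Proof. by rewrite -signr_odd; case: odd; rewrite ?scaleN1r ?scale1r. Qed.

(** Closes linear identities whose coefficients are powers of -1, by case
   analysis on the parity of every variable in the exponents. *)
Ltac signs :=
  rewrite ?signZ ?(oddD, oddM, oddS) /=;
  repeat (match goal with |- context [odd ?n] => case: (odd n) => /= end);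
  abel.

(** * Signed partial compositions *)

Section Signed.
Variables (k : comPzRingType) (O : operad k).
Local Notation U := (total O).

Definition twist (i : nat) (x : U) : U := fun n => (-1) ^+ (n.+1 * i) *: x n.

Lemma twist_is_linear i : linear (twist i).
Proof.
move=> a x y; apply: total_ext => n.
rewrite -[RHS]/(a *: twist i x n + twist i y n) /twist.
by rewrite -[(a *: x + y) n]/(a *: x n + y n) scalerDr !scalerA mulrC.
Qed.

Lemma twistE i n x : hom n x -> twist i x = (-1) ^+ (n.+1 * i) *: x.
Proof.
move=> hx; apply: total_ext => d; rewrite -[RHS]/((-1) ^+ (n.+1 * i) *: x d).
rewrite /twist; case: (eqVneq n d) => [-> //|ne].
by rewrite (hom_neq hx ne) !scaler0.
Qed.

(** Operadic suspension: an operation of arity n is given the degree n - 1,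
   and moving y past the i inputs on the left of the insertion point costs the
   sign (-1)^((n-1)i). As a result, nested insertions associate without sign
   and parallel ones commute up to the Koszul sign of these degrees. *)
Definition scomp (i : nat) (x y : U) : U := tcomp i x (twist i y).
Local Notation "x *[ i ] y" := (scomp i x y).

Lemma scomp_linl i y : linear (fun x => x *[i] y).
Proof. exact: tcomp_linl. Qed.

Lemma scomp_linr i x : linear (scomp i x).
Proof. by move=> a y y'; rewrite /scomp twist_is_linear tcomp_linr. Qed.

HB.instance Definition _ i x := GRing.isLinear.Build k U U *:%R
  (scomp i x) (scomp_linr i x).

Definition lscomp i y x := x *[i] y.
HB.instance Definition _ i y := GRing.isLinear.Build k U U *:%R
  (lscomp i y) (scomp_linl i y).

Lemma scompDl i x x' y : (x + x') *[i] y = x *[i] y + x' *[i] y.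
Proof. exact: (linearD (lscomp i y)). Qed.
Lemma scompNl i x y : (- x) *[i] y = - (x *[i] y).
Proof. exact: (linearN (lscomp i y)). Qed.
Lemma scompZl i a x y : (a *: x) *[i] y = a *: (x *[i] y).
Proof. exact: (linearZ_LR (lscomp i y)). Qed.
Lemma scomp0l i y : 0 *[i] y = 0.
Proof. exact: (linear0 (lscomp i y)). Qed.
Lemma scomp_suml i y I (r : seq I) (P : pred I) (F : I -> U) :
  (\sum_(j <- r | P j) F j) *[i] y = \sum_(j <- r | P j) F j *[i] y.
Proof. exact: (linear_sum (lscomp i y)). Qed.
Lemma scompDr i x y y' : x *[i] (y + y') = x *[i] y + x *[i] y'.
Proof. exact: linearD. Qed.
Lemma scompNr i x y : x *[i] (- y) = - (x *[i] y).
Proof. exact: linearN. Qed.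
Lemma scompZr i a x y : x *[i] (a *: y) = a *: (x *[i] y).
Proof. exact: linearZ_LR. Qed.
Lemma scomp_sumr i x I (r : seq I) (P : pred I) (F : I -> U) :
  x *[i] (\sum_(j <- r | P j) F j) = \sum_(j <- r | P j) x *[i] F j.
Proof. exact: linear_sum. Qed.

Lemma scompE n i x y : hom n y -> x *[i] y = (-1) ^+ (n.+1 * i) *: tcomp i x y.
Proof. by move=> hy; rewrite /scomp (twistE i hy) tcompZr. Qed.

Lemma tcompE n i x y : hom n y -> tcomp i x y =
  (-1) ^+ (n.+1 * i) *: (x *[i] y).
Proof. by move=> hy; rewrite (scompE _ _ hy) scalerA -exprD signZ oddD addbb.
  Qed.

Lemma hom_scomp m n i f g : hom m f -> hom n g -> hom (m + n).-1 (f *[i] g).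
Proof. by move=> hf hg; rewrite (scompE _ _ hg); apply/homZ/hom_tcomp. Qed.

Lemma scomp_out m n i f g : hom m f -> hom n g -> (m <= i)%N -> f *[i] g = 0.
Proof.
by move=> hf hg le_mi; rewrite (scompE _ _ hg) (tcomp_out hf hg le_mi) scaler0.
Qed.

(** The Koszul sign of two operations of arities m and n in the suspended
   degrees m - 1 and n - 1, written with successors to avoid truncation. *)
Definition koszul (m n : nat) : k := (-1) ^+ (m.+1 * n.+1).

Section Laws.
Variables (m n p : nat) (f g h : U).
Hypotheses (hf : hom m f) (hg : hom n g) (hh : hom p h).

Lemma scomp_nested i j : (i < m)%N -> (j < n)%N ->
  (f *[i] g) *[i + j] h = f *[i] (g *[j] h).
Proof.
move=> lt_i lt_j.
have hgh := hom_scomp j hg hh.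
rewrite (scompE _ _ hh) (scompE _ _ hg) (scompE _ _ hgh) (scompE _ _ hh).
rewrite tcompZl tcompZr (tcomp_nested hf hg hh) // !scalerA -!exprD !signZ.
case: n lt_j => // n' _; rewrite addSn /= !(oddD, oddM, oddS) /=.
by case: (odd i); case: (odd j); case: (odd n'); case: (odd p).
Qed.

Lemma scomp_parallel i j : (i < j < m)%N ->
  (f *[i] g) *[(j + n).-1] h = koszul n p *: ((f *[j] h) *[i] g).
Proof.
move=> lt_ij; rewrite !(scompE _ _ hh) !(scompE _ _ hg) /koszul !tcompZl.
rewrite (tcomp_parallel hf hg hh) // !scalerA -!exprD !signZ.
case: j lt_ij => [|j' _]; first by rewrite ltn0.
rewrite addSn /= !(oddD, oddM, oddS) /=.
by case: (odd i); case: (odd j'); case: (odd n); case: (odd p).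
Qed.

Lemma scomp_id i : (i < m)%N -> f *[i] tid O = f.
Proof.
move=> lt_i; rewrite (scompE _ _ (hom_tid O)) (tcomp_id hf) // signZ.
by rewrite oddM.
Qed.

Lemma id_scomp : tid O *[0] f = f.
Proof. by rewrite (scompE _ _ hf) muln0 scale1r (id_tcomp hf). Qed.
End Laws.
End Signed.

Local Notation "x *[ i ] y" := (scomp i x y).

(** * Signed cofaces *)

Section Faces.
Variables (k : comPzRingType) (O : operad k) (M : multiplication O).
Local Notation U := (total O).

Definition tmu : U := tinj (op_mu M).
Definition te : U := tinj (op_e M).
Local Notation mu := tmu.
Local Notation e := te.
Local Notation id1 := (tid O).

Lemma hom_mu : hom 2 mu. Proof. exact: hom_tinj. Qed.
Lemma hom_e : hom 0 e. Proof. exact: hom_tinj. Qed.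
Local Hint Resolve hom_mu hom_e hom_tid hom_scomp homZ homN homD homB hom0 :
  core.

Lemma mu_mu : mu *[1] mu = - (mu *[0] mu).
Proof.
rewrite (scompE 1 _ hom_mu) (scompE 0 _ hom_mu) muln0 expr0 scale1r signZ /=.
congr (- _); have := congr1 (@tinj _ O _) (mu_assoc M).
by rewrite (tcomp_pcomp _ ord0) (tcomp_pcomp _ ord_max) => ->.
Qed.

Lemma mu_e0 : mu *[0] e = id1.
Proof.
rewrite (scompE _ _ hom_e) expr0 scale1r /tid -(mu_unitl M).
by rewrite (tcomp_pcomp (op_mu M) ord0).
Qed.

Lemma mu_e1 : mu *[1] e = - id1.
Proof.
rewrite (scompE _ _ hom_e) signZ /= /tid -(mu_unitr M).
by rewrite (tcomp_pcomp (op_mu M) ord_max).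
Qed.

(** The coface delta_i with the sign (-1)^i it has in the differential
   (tinj_coface), for arguments of arity q. In terms of suspended insertions
   this sign no longer depends on i in the middle range. *)
Definition face (q i : nat) (x : U) : U :=
  if i == 0 then (-1) ^+ q.+1 *: (mu *[1] x)
  else if (i <= q)%N then - (x *[i.-1] mu)
  else (-1) ^+ q.+1 *: (mu *[0] x).

#[global] Arguments face : simpl never.

Lemma face_is_linear q i : linear (face q i).
Proof.
move=> a x y; rewrite /face; case: ifP => _; last case: ifP => _.
- by rewrite scompDr scompZr scalerDr !scalerA mulrC.
- by rewrite scompDl scompZl opprD scalerN.
- by rewrite scompDr scompZr scalerDr !scalerA mulrC.
Qed.
HB.instance Definition _ q i := GRing.isLinear.Build k U U *:%R
  (face q i) (face_is_linear q i).

Lemma face0 q x : face q 0 x = (-1) ^+ q.+1 *: (mu *[1] x).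
Proof. by []. Qed.
Lemma face_mid q i x : (0 < i <= q)%N -> face q i x = - (x *[i.-1] mu).
Proof. by rewrite /face; case: i => // i /andP[_ ->]. Qed.
Lemma face_top q i x : (q < i)%N -> face q i x = (-1) ^+ q.+1 *: (mu *[0] x).
Proof. by rewrite /face; case: i => // i lt_q; rewrite [(_ <= q)%N]leqNgt lt_q.
  Qed.

Lemma hom_face q i x : hom q x -> hom q.+1 (face q i x).
Proof.
move=> hx; rewrite /face; case: ifP => _; last case: ifP => _.
- exact/homZ/(hom_scomp 1 hom_mu hx).
- by apply/homN; have := hom_scomp i.-1 hx hom_mu; rewrite addn2.
- exact/homZ/(hom_scomp 0 hom_mu hx).
Qed.
Local Hint Resolve hom_face : core.

Section Insertion.
Variables (m n : nat) (f g : U).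
Hypotheses (hf : hom m f) (hg : hom n g).

(** A coface at the left of the insertion point only sees f, and shifts this
   point by one. *)
Lemma face_scomp_le q i j : q.+1 = (m + n)%N -> (i <= j < m)%N ->
  face q i (f *[j] g) = (-1) ^+ n.+1 *: (face m i f *[j.+1] g).
Proof.
move=> eq_q /andP[le_ij lt_j]; case: i le_ij => [|i] le_ij.
  rewrite !face0 scompZl -(scomp_nested hom_mu hf hg _ lt_j) // add1n scalerA.
  by rewrite -exprD eq_q !signZ !oddD /=; case: (odd m); case: (odd n).
rewrite !face_mid; try lia; rewrite scompNl scalerN /=; congr (- _).
have [_ hmu] := (hg, hom_mu).
have := scomp_parallel hf hom_mu hg (i := i) (j := j).
rewrite addn2 /= => -> //; last by lia.
by rewrite /koszul scalerA -exprD signZ !(oddD, oddM, oddS) /=; case: odd.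
Qed.

(** The cofaces numbered j.+1 to j + n split the inputs of the inserted g. *)
Lemma face_scomp_mid q i j : q.+1 = (m + n)%N -> (j < m)%N ->
  (j < i <= j + n)%N ->
  face q i (f *[j] g) = f *[j] face n (i - j) g.
Proof.
move=> eq_q lt_j /andP[lt_ji le_i]; rewrite !face_mid; try lia.
rewrite scompNr -(scomp_nested hf hg hom_mu) //; last lia.
by congr (- (_ *[_] _)); lia.
Qed.

Lemma face_scomp_gt q i j : q.+1 = (m + n)%N -> (j < m)%N -> (j + n < i)%N ->
  face q i (f *[j] g) = (-1) ^+ n.+1 *: (face m (i.+1 - n) f *[j] g).
Proof.
move=> eq_q lt_j lt_i; case: (leqP i q) => [le_iq|lt_qi].
  rewrite !face_mid; try lia; rewrite scompNl scalerN; congr (- _).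
  have := scomp_parallel hf hg hom_mu (i := j) (j := (i - n)%N).
  rewrite (_ : ((i - n) + n).-1 = i.-1)%N; last by lia.
  rewrite (_ : (i.+1 - n).-1 = (i - n)%N); last by lia.
  move=> ->; last by lia.
  by rewrite /koszul !signZ !(oddD, oddM, oddS) /=; case: odd.
rewrite !face_top; try lia.
rewrite scompZl -(scomp_nested hom_mu hf hg _ lt_j) // add0n scalerA.
by rewrite -exprD eq_q !signZ !oddD /=; case: (odd m); case: (odd n).
Qed.

(** Splitting the input j of f and inserting g at the left copy amounts to
   multiplying g on the right before inserting it: both are the two readings
   of a nested insertion of mu. This and face_scomp_bot are what makes the
   sums over insertion points telescope. *)
Lemma face_scomp_top j : (j < m)%N ->
  face m j.+1 f *[j] g = - ((-1) ^+ n.+1 *: (f *[j] face n n.+1 g)).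
Proof.
move=> lt_j; rewrite face_mid // face_top //
  scompNl scompZr scalerA -exprD addnn.
rewrite signZ odd_double.
by rewrite -(scomp_nested hf hom_mu hg) // addn0.
Qed.

Lemma face_scomp_bot j : (j < m)%N ->
  face m j.+1 f *[j.+1] g = - ((-1) ^+ n.+1 *: (f *[j] face n 0 g)).
Proof.
move=> lt_j; rewrite face_mid // face0 scompNl scompZr scalerA -exprD addnn.
rewrite signZ odd_double.
by rewrite -(scomp_nested hf hom_mu hg) // addn1.
Qed.
End Insertion.

Lemma face_mu0 : face 2 0 mu = mu *[0] mu.
Proof. by rewrite face0 signZ /= mu_mu opprK. Qed.
Lemma face_mu1 : face 2 1 mu = - (mu *[0] mu).
Proof. by rewrite face_mid. Qed.
Lemma face_mu2 : face 2 2 mu = mu *[0] mu.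
Proof. by rewrite face_mid // mu_mu opprK. Qed.
Lemma face_mu3 : face 2 3 mu = - (mu *[0] mu).
Proof. by rewrite face_top // signZ. Qed.
Lemma face_e0 : face 0 0 e = id1.
Proof. by rewrite face0 mu_e1 signZ /= opprK. Qed.
Lemma face_e1 : face 0 1 e = - id1.
Proof. by rewrite face_top // mu_e0 signZ. Qed.

(** The cosimplicial identity; the signs of the cofaces turn it into an
   anticommutation rule. *)
Lemma face_face q i j x : hom q x -> (j < i <= q.+2)%N ->
  face q.+1 i (face q j x) = - face q.+1 j (face q i.-1 x).
Proof.
move=> hx /andP[lt_ji le_i]; have [j0|j_gt0] := posnP j.
  rewrite j0 (face0 q x) linearZ /=; case: (ltnP i 2) => [lt_i2|le_2i].
    have -> : i = 1%N by lia.
    rewrite /= [face q.+1 0 _]linearZ /= -scalerN; congr (_ *: _).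
    rewrite !(face_scomp_le hom_mu hx) ?face_mu0 ?face_mu1 ?scompNl ?scalerN //;
      lia.
  case: (leqP i q.+1) => [le_iq|lt_qi].
    rewrite (face_scomp_mid hom_mu hx) //; last by lia.
    by rewrite face0 subn1 [(-1) ^+ q.+2]exprS mulN1r scaleNr opprK.
  have -> : i = q.+2 by lia.
  rewrite (face_scomp_gt hom_mu hx) //.
  rewrite (_ : q.+3 - q = 3)%N; last by lia.
  rewrite /= (face_top x (ltnSn q)) [face q.+1 0 _]linearZ /=
    (face_scomp_le hom_mu hx) //.
  by rewrite face_mu0 face_mu3 scompNl !scalerN.
case: (leqP j q) => [le_jq|lt_qj].
  rewrite (face_mid x (q := q) (i := j)) ?j_gt0 // linearN /=.
  have [ij|ne_ij] := eqVneq i j.+1.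
    rewrite ij /= (face_mid x (q := q) (i := j)) ?j_gt0 // linearN /=.
    rewrite !(face_scomp_mid hx hom_mu); try lia.
    rewrite (_ : j.+1 - j.-1 = 2)%N; last by lia.
    rewrite (_ : j - j.-1 = 1)%N; last by lia.
    by rewrite face_mu1 face_mu2 scompNr opprK.
  rewrite (face_scomp_gt hx hom_mu); try lia.
  rewrite (face_mid _ (q := q.+1) (i := j)); last by lia.
  rewrite signZ /= !opprK; congr (face _ _ _ *[_] _); lia.
have [-> ->] : j = q.+1 /\ i = q.+2 by lia.
rewrite /= (face_top x (ltnSn q)) linearZ linearZ /= -scalerN; congr (_ *: _).
rewrite !(face_scomp_gt hom_mu hx) //.
rewrite (_ : q.+3 - q = 3)%N; last by lia.
rewrite (_ : q.+2 - q = 2)%N; last by lia.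
by rewrite face_mu2 face_mu3 scompNl scalerN.
Qed.

End Faces.

(** * Signed rotations *)

Section Cyclic.
Variables (k : comPzRingType) (O : operad k) (M : multiplication O).
Variable (T : cyclic_structure O).
Hypothesis tau_muT : op_tau T 2 (op_mu M) = op_mu M.
Local Notation U := (total O).
Local Notation mu := (tmu M).

(** The sign makes the operator commute with signed cofaces (turn_faceS), and
   its power n.+1 is still the identity, since n (n + 1) is even. *)
Definition turn (x : U) : U := fun n => (-1) ^+ n *: op_tau T n (x n).

Lemma turn_is_linear : linear turn.
Proof.
move=> a x y; apply: total_ext => n.
rewrite -[RHS]/(a *: turn x n + turn y n) /turn.
by rewrite -[(a *: x + y) n]/(a *: x n + y n) linearP scalerDr !scalerA mulrC.
Qed.
HB.instance Definition _ := GRing.isLinear.Build k U U *:%R turn turn_is_linear.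

Lemma turn_tinj n (f : O n) : turn (tinj f) = (-1) ^+ n *: tinj (op_tau T n f).
Proof.
rewrite -linearZ /=; apply: total_ext => d; rewrite /turn.
case: (eqVneq n d) => [<-|ne]; first by rewrite !tinjK.
by rewrite !tinj_neq // linear0 scaler0.
Qed.

Lemma hom_turn n x : hom n x -> hom n (turn x).
Proof. by move=> ->; rewrite turn_tinj; apply: homZ; apply: hom_tinj. Qed.

Lemma hom_iter n a x : hom n x -> hom n (iter a turn x).
Proof. by move=> hx; elim: a => //= a; apply: hom_turn. Qed.

Lemma iter_turn_is_linear a : linear (iter a turn).
Proof. by elim: a => // a IH b x y; rewrite !iterS IH linearP. Qed.

Definition turns a x := iter a turn x.
HB.instance Definition _ a := GRing.isLinear.Build k U U *:%R (turns a)
  (iter_turn_is_linear a).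

#[global] Arguments turns : simpl never.
Lemma turnsD a b x : turns a (turns b x) = turns (a + b) x.
Proof. by rewrite /turns iterD. Qed.
Lemma turnsS a x : turns a.+1 x = turn (turns a x).
Proof. by []. Qed.
Lemma turnsSr a x : turns a.+1 x = turns a (turn x).
Proof. by rewrite /turns iterSr. Qed.

Lemma hom_turns n a x : hom n x -> hom n (turns a x).
Proof. exact: hom_iter. Qed.

Lemma turns_order n x : hom n x -> turns n.+1 x = x.
Proof.
move=> ->; move: (x n) => f.
have tE a : turns a (tinj f) = (-1) ^+ (n * a) *: tinj (iter a (op_tau T n) f).
  elim: a => [|a IH]; first by rewrite muln0 scale1r.
  by rewrite turnsS IH linearZ /= turn_tinj scalerA -exprD mulnS addnC.
by rewrite tE tau_order signZ oddM /= andbN.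
Qed.

Local Hint Resolve hom_mu hom_e hom_tid hom_turn hom_turns : core.

Lemma turn_mu : turn mu = mu.
Proof. by rewrite turn_tinj tau_muT /= sqrrN expr1n scale1r. Qed.

Lemma turn_scomp m n f g i : hom m f -> hom n g -> (i.+1 < m)%N ->
  turn (f *[i.+1] g) = turn f *[i] g.
Proof.
move=> hf hg lt_i; rewrite !(scompE _ _ hg) hf hg linearZ /=.
rewrite -(tcomp_pcomp (f m) (Ordinal lt_i)) !turn_tinj.
rewrite (tau_pcomp T _ _ (j := Ordinal (ltnW lt_i))) // tcomp_pcomp /= tcompZl.
rewrite !scalerA -!exprD !signZ; case: (m) lt_i => // m' _.
rewrite addSn /= !(oddD, oddM, oddS).
by case: (odd i); case: (odd m'); case: (odd n).
Qed.

(** Rotating past the inserted operation exchanges the roles of the two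
   operations, as in the first axiom of cyclic operads. *)
Lemma turn_scomp0 m n f g : hom m f -> hom n g -> (0 < m)%N -> (0 < n)%N ->
  turn (f *[0] g) = - (koszul k m n *: (turn g *[n.-1] turn f)).
Proof.
case: m => // m' hf'; case: n => // n' hg' _ _.
rewrite (scompE _ _ hg') (scompE _ _ (hom_turn hf')) muln0 scale1r hf' hg'.
rewrite -(tcomp_pcomp (f m'.+1) ord0) !turn_tinj tau_pcomp1 tinj_gcast.
rewrite tcomp_pcomp tcompZl tcompZr /koszul !scalerA -!exprD !signZ.
rewrite !addSn /= !(oddD, oddM, oddS).
by case: (odd m'); case: (odd n'); rewrite ?opprK.
Qed.

Lemma turns_scomp m n f g a i : hom m f -> hom n g -> (i + a < m)%N ->
  turns a (f *[i + a] g) = turns a f *[i] g.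
Proof.
move=> hf hg; elim: a i => [|a IH] i lt_ia; first by rewrite addn0.
rewrite !turnsS addnS -addSn IH; last by lia.
by rewrite (turn_scomp (hom_turns a hf) hg) //; lia.
Qed.

(** When the n.+1 rotations pass over all of g, this operation is back in its
   original position and f has been turned twice; in particular, for g of
   arity 0, one rotation of f *[0] g turns f twice. The case of arity 0, which
   the first axiom of cyclic operads does not cover, follows from the second
   one applied m.-1 times, since a full turn is the identity. *)
Lemma turns_wrap m n f g : hom m f -> hom n g -> (0 < m)%N ->
  turns n.+1 (f *[0] g) = turns 2 f *[m.-1] g.
Proof.
move=> hf hg m_gt0; case: n hg => [|n] hg.
  have hy : hom m.-1 (turns 2 f *[m.-1] g).
    by have := hom_scomp m.-1 (hom_turns 2 hf) hg; rewrite addn0.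
  rewrite -[RHS](turns_order hy) [RHS]turnsS -[LHS]/(turn (f *[0] g)).
  congr turn.
  have := turns_scomp (hom_turns 2 hf) hg (a := m.-1) (i := 0%N).
  rewrite add0n => ->; last by lia.
  by rewrite turnsD addn2 prednK // turns_order.
rewrite turnsSr (turn_scomp0 hf hg) // linearN linearZ /= turnsS.
rewrite (turns_scomp (a := n) (i := 0%N) (hom_turn hg) (hom_turn hf)) //.
rewrite -turnsSr.
rewrite (turn_scomp0 (hom_turns n.+1 hg) (hom_turn hf)) //
  -turnsS turns_order //.
by rewrite scalerN opprK scalerA /koszul -exprD signZ mulnC addnn odd_double.
Qed.

End Cyclic.

(** * The differential and insertions *)

Section Differential.
Variables (k : comPzRingType) (O : operad k) (M : multiplication O).
Local Notation U := (total O).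
Local Notation face := (face M).
Local Hint Resolve hom_mu hom_e hom_tid hom0 : core.

Definition face_sum (q a : nat) (x : U) : U := \sum_(0 <= i < a) face q i x.

Lemma face_sum_is_linear q a : linear (face_sum q a).
Proof.
move=> c x y; rewrite /face_sum scaler_sumr -big_split; apply: eq_bigr => i _.
by rewrite linearP.
Qed.
HB.instance Definition _ q a := GRing.isLinear.Build k U U *:%R
  (face_sum q a) (face_sum_is_linear q a).

Lemma face_sum0 q x : face_sum q 0 x = 0.
Proof. by rewrite /face_sum big_nil. Qed.
Lemma face_sumS q a x : face_sum q a.+1 x = face_sum q a x + face q a x.
Proof. by rewrite /face_sum big_nat_recr. Qed.

Lemma hom_face_sum q a x : hom q x -> hom q.+1 (face_sum q a x).
Proof. by move=> hx; apply: hom_sum => i _; apply: hom_face. Qed.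

Definition diff (x : U) : U := fun n =>
  if n is n'.+1 return O n then codiff M (x n') else 0.

Lemma diff_is_linear : linear diff.
Proof.
move=> c x y; apply: total_ext => -[|n].
  by rewrite -[RHS]/(c *: 0 + 0) scaler0 addr0.
rewrite -[LHS]/(codiff M (c *: x n + y n)).
by rewrite -[RHS]/(c *: codiff M (x n) + codiff M (y n)) linearP.
Qed.
HB.instance Definition _ := GRing.isLinear.Build k U U *:%R diff diff_is_linear.

Lemma diff_tinj q (f : O q) : diff (tinj f) = tinj (codiff M f).
Proof.
apply: total_ext => -[|d]; first by rewrite tinj_neq.
rewrite -[LHS]/(codiff M (tinj f d)); case: (eqVneq q d) => [<-|ne].
  by rewrite !tinjK.
by rewrite !tinj_neq ?linear0.
Qed.

Lemma tinj_coface q i (f : O q) : (i <= q.+1)%N ->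
  tinj (coface M i f) = (-1) ^+ i *: face q i (tinj f).
Proof.
case: i => [|i] le_i.
  rewrite face0 scale1r /coface (tcomp_pcomp (op_mu M) ord_max f) (tcompE _ _
    (hom_tinj f)) muln1.
  by rewrite !signZ.
rewrite /coface; case: insubP => [j lt_i ij|].
  rewrite tinj_gcast tcomp_pcomp (tcompE _ _ (hom_mu M)) ij face_mid ?lt_i //.
  by rewrite !signZ oddM /=; case: odd; rewrite ?opprK.
rewrite -leqNgt => le_qi; have -> : i = q by lia.
rewrite face_top // (tcomp_pcomp (op_mu M) ord0 f) (tcompE _ _ (hom_tinj f))
  muln0 scale1r.
by rewrite scalerA -exprD addnn signZ odd_double.
Qed.

Lemma diffE q x : hom q x -> diff x = face_sum q q.+2 x.
Proof.
move=> ->; move: (x q) => f; rewrite diff_tinj /codiff linear_sum /face_sum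
  big_mkord.
apply: eq_bigr => i _; rewrite linearZ /= tinj_coface -1?ltnS //.
by rewrite scalerA -exprD addnn signZ odd_double.
Qed.

Lemma hom_diff q x : hom q x -> hom q.+1 (diff x).
Proof. by move=> hx; rewrite (diffE hx); apply: hom_face_sum. Qed.

(** The part of the differential that splits the inputs of x. *)
Definition inner_faces (n : nat) (x : U) : U :=
  diff x - face n 0 x - face n n.+1 x.

Lemma inner_faces_sum n x : hom n x ->
  inner_faces n x = \sum_(1 <= i < n.+1) face n i x.
Proof.
move=> hx; rewrite /inner_faces (diffE hx) /face_sum big_nat_recr //=
  big_nat_recl //=.
by rewrite [in RHS]big_add1 /=; abel.
Qed.

Lemma face_sum_scomp_le m n q j a f g : hom m f -> hom n g ->
  q.+1 = (m + n)%N ->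
  (a <= j.+1)%N -> (j < m)%N ->
  face_sum q a (f *[j] g) = (-1) ^+ n.+1 *: (face_sum m a f *[j.+1] g).
Proof.
move=> hf hg eq_q le_a lt_j; rewrite /face_sum scomp_suml scaler_sumr.
by apply: eq_big_nat => i /andP[_ lt_i]; apply: face_scomp_le => //; lia.
Qed.

Lemma face_sum_scomp m n q j f g : hom m f -> hom n g -> q.+1 = (m + n)%N ->
  (j < m)%N ->
  face_sum q (j + n).+1 (f *[j] g) =
  (-1) ^+ n.+1 *: (face_sum m j.+1 f *[j.+1] g) + f *[j] inner_faces n g.
Proof.
move=> hf hg eq_q lt_j; rewrite -(face_sum_scomp_le hf hg eq_q) //.
rewrite /face_sum (@big_cat_nat _ _ _ j.+1) //=; last by lia.
congr (_ + _); rewrite inner_faces_sum // scomp_sumr -{1}[j.+1]add1n big_addn.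
rewrite (_ : (j + n).+1 - j = n.+1)%N; last by lia.
apply: eq_big_nat => i /andP[i_gt0 lt_i].
rewrite (face_scomp_mid M hf hg eq_q lt_j); last by lia.
by rewrite addnK.
Qed.

Lemma diff_face_sum q a x : hom q x -> (a <= q.+2)%N ->
  diff x - face_sum q a x = \sum_(a <= i < q.+2) face q i x.
Proof.
move=> hx le_a; rewrite (diffE hx) /face_sum (@big_cat_nat _ _ _ a) //=.
abel.
Qed.

(** The cofaces of f *[j] g fall into three blocks: those on the left of g act
   on f and shift the insertion point, those in the middle split the inputs of
   g, those on the right act on f. *)
Lemma diff_scomp m n j f g : hom m f -> hom n g -> (j < m)%N ->
  diff (f *[j] g) = (-1) ^+ n.+1 *: (face_sum m j.+1 f *[j.+1] g)
    + f *[j] inner_faces n g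
    + (-1) ^+ n.+1 *: ((diff f - face_sum m j.+2 f) *[j] g).
Proof.
move=> hf hg lt_j; have eq_q : (m + n).-1.+1 = (m + n)%N by lia.
rewrite (diffE (hom_scomp j hf hg)) -(face_sum_scomp hf hg eq_q lt_j).
rewrite {1}/face_sum (@big_cat_nat _ _ _ (j + n).+1) //=; last by lia.
congr (_ + _); rewrite (diff_face_sum hf); last by lia.
rewrite scomp_suml scaler_sumr.
rewrite -[(j + n).+1]add0n -[j.+2]add0n !big_addn.
rewrite (_ : _ - (j + n).+1 = m.+2 - j.+2)%N; last by lia.
apply: eq_big_nat => i lt_i.
rewrite (face_scomp_gt M hf hg eq_q lt_j); last by lia.
by congr (_ *: (face _ _ _ *[_] _)); lia.
Qed.

End Differential.

(** * Homotopies for the cup product *)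

Section Gerstenhaber.
Variables (k : comPzRingType) (O : operad k) (M : multiplication O).
Local Notation U := (total O).
Local Notation mu := (tmu M).
Local Notation e := (te M).
Local Notation face := (face M).
Local Notation face_sum := (face_sum M).
Local Notation diff := (diff M).
Local Hint Resolve hom_mu hom_e hom_tid hom0 hom_face hom_diff : core.

(** The missing extreme cofaces of g in diff_scomp are, by face_scomp_top and
   face_scomp_bot, the missing middle cofaces of f. After this exchange, the
   Leibniz rule fails by the difference of the expression face_sum q a.+1 x
   *[a] f at a.+1 and at a. *)
Lemma diff_scomp_telescope q n a x f : hom q x -> hom n f -> (a < q)%N ->
  diff (x *[a] f) = (-1) ^+ n.+1 *: (diff x *[a] f) + x *[a] diff f
    + (-1) ^+ n.+1 *: (face_sum q a.+2 x *[a.+1] f - face_sum q a.+1 x *[a] f).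
Proof.
move=> hx hf lt_a; rewrite (diff_scomp M hx hf lt_a) /inner_faces.
rewrite !linearD !linearN /= !(face_sumS M q a.+1) !(scompDl, scompNl).
rewrite (face_scomp_top M hx hf lt_a) (face_scomp_bot M hx hf lt_a).
rewrite !signZ; case: odd => /=; abel.
Qed.

(** Truncated circle product, over the first a inputs of x. Partial sums are
   needed in the proof of the Poisson rule, and a bound beyond the arity of x
   is harmless (pcirc_widen). *)
Definition pcirc (a : nat) (x f : U) : U := \sum_(0 <= i < a) x *[i] f.

Lemma pcirc_is_linear a x : linear (pcirc a x).
Proof.
move=> c f g; rewrite /pcirc scaler_sumr -big_split; apply: eq_bigr => i _.
by rewrite linearP.
Qed.
HB.instance Definition _ a x := GRing.isLinear.Build k U U *:%R
  (pcirc a x) (pcirc_is_linear a x).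

Lemma pcirc_linl a f : linear (fun x => pcirc a x f).
Proof.
move=> c x y; rewrite /pcirc scaler_sumr -big_split; apply: eq_bigr => i _.
by rewrite scompDl scompZl.
Qed.
Definition lpcirc a f x := pcirc a x f.
HB.instance Definition _ a f := GRing.isLinear.Build k U U *:%R
  (lpcirc a f) (pcirc_linl a f).

Lemma pcircDl a x y f : pcirc a (x + y) f = pcirc a x f + pcirc a y f.
Proof. exact: (linearD (lpcirc a f)). Qed.
Lemma pcircNl a x f : pcirc a (- x) f = - pcirc a x f.
Proof. exact: (linearN (lpcirc a f)). Qed.
Lemma pcircZl a c x f : pcirc a (c *: x) f = c *: pcirc a x f.
Proof. exact: (linearZ_LR (lpcirc a f)). Qed.
Lemma pcirc0l a f : pcirc a 0 f = 0.
Proof. exact: (linear0 (lpcirc a f)). Qed.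
Lemma pcircDr a x f g : pcirc a x (f + g) = pcirc a x f + pcirc a x g.
Proof. exact: linearD. Qed.
Lemma pcircNr a x f : pcirc a x (- f) = - pcirc a x f.
Proof. exact: linearN. Qed.
Lemma pcircZr a c x f : pcirc a x (c *: f) = c *: pcirc a x f.
Proof. exact: linearZ_LR. Qed.
Lemma pcirc0r a x : pcirc a x 0 = 0.
Proof. exact: linear0. Qed.

Lemma pcircS a x f : pcirc a.+1 x f = pcirc a x f + x *[a] f.
Proof. by rewrite /pcirc big_nat_recr. Qed.
Lemma pcirc_0 x f : pcirc 0 x f = 0.
Proof. by rewrite /pcirc big_nil. Qed.

Lemma hom_pcirc m n a x f : hom m x -> hom n f -> hom (m + n).-1 (pcirc a x f).
Proof. by move=> hx hf; apply: hom_sum => i _; apply: hom_scomp. Qed.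

Lemma pcirc_widen m n a x f : hom m x -> hom n f -> (m <= a)%N ->
  pcirc a x f = pcirc m x f.
Proof.
move=> hx hf le_m; rewrite /pcirc (@big_cat_nat _ _ _ m) //= [X in _
  + X]big1_seq.
  by rewrite addr0.
move=> i /andP[_]; rewrite mem_index_iota => /andP[le_mi _].
exact: scomp_out hx hf le_mi.
Qed.

Lemma diff_pcirc q n a x f : hom q x -> hom n f -> (a <= q)%N ->
  diff (pcirc a x f) = (-1) ^+ n.+1 *: pcirc a (diff x) f + pcirc a x (diff f)
    + (-1) ^+ n.+1 *: (face_sum q a.+1 x *[a] f - face q 0 x *[0] f).
Proof.
move=> hx hf; elim: a => [|a IH] lt_a.
  by rewrite !pcirc_0 linear0 face_sumS face_sum0 add0r subrr !scaler0 !addr0.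
rewrite !pcircS linearD /= IH ?(ltnW lt_a) // (diff_scomp_telescope hx hf lt_a).
rewrite !signZ; case: odd => /=; abel.
Qed.

(** This composite equals the one in the definition of the cup product by the
   parallel axiom (tinj_cupc), and lets the left factor be inserted last, in
   the 0-th coface of the right one (cupE). *)
Definition cup (f g : U) : U := tcomp 0 (tcomp 1 mu g) f.

Lemma cup_linl g : linear (cup^~ g).
Proof. exact: tcomp_linr. Qed.
Lemma cup_linr f : linear (cup f).
Proof. by move=> c x y; rewrite /cup tcomp_linr tcomp_linl. Qed.
HB.instance Definition _ f := GRing.isLinear.Build k U U *:%R
  (cup f) (cup_linr f).
Definition lcup g f := cup f g.
HB.instance Definition _ g := GRing.isLinear.Build k U U *:%R
  (lcup g) (cup_linl g).

Lemma cupDl x y f : cup (x + y) f = cup x f + cup y f.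
Proof. exact: (linearD (lcup f)). Qed.
Lemma cupNl x f : cup (- x) f = - cup x f.
Proof. exact: (linearN (lcup f)). Qed.
Lemma cupZl c x f : cup (c *: x) f = c *: cup x f.
Proof. exact: (linearZ_LR (lcup f)). Qed.
Lemma cup0l f : cup 0 f = 0.
Proof. exact: (linear0 (lcup f)). Qed.
Lemma cupDr x f g : cup x (f + g) = cup x f + cup x g.
Proof. exact: linearD. Qed.
Lemma cupNr x f : cup x (- f) = - cup x f.
Proof. exact: linearN. Qed.
Lemma cupZr c x f : cup x (c *: f) = c *: cup x f.
Proof. exact: linearZ_LR. Qed.
Lemma cup0r x : cup x 0 = 0.
Proof. exact: linear0. Qed.

Lemma cupE m n f g : hom m f -> hom n g -> cup f g = face n 0 g *[0] f.
Proof.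
move=> hf hg; rewrite /cup (tcompE _ _ hg) (tcompE _ _ hf) muln0 muln1.
by rewrite scale1r face0.
Qed.

Lemma hom_cup m n f g : hom m f -> hom n g -> hom (m + n) (cup f g).
Proof.
move=> hf hg; rewrite (cupE hf hg) addnC.
exact: (hom_scomp 0 (hom_face M 0 hg) hf).
Qed.

Lemma cupA m n p f g h : hom m f -> hom n g -> hom p h ->
  cup f (cup g h) = cup (cup f g) h.
Proof.
move=> hf hg hh; rewrite /cup.
have hmh := hom_tcomp 1 (hom_mu M) hh; have hmg := hom_tcomp 1 (hom_mu M) hg.
have hmm := hom_tcomp 0 (hom_mu M) (hom_mu M).
have muA : tcomp 1 mu mu = tcomp 0 mu mu.
  rewrite (tcompE _ _ (hom_mu M)) [in RHS](tcompE _ _ (hom_mu M)) mu_mu.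
  by rewrite !signZ /= opprK.
rewrite -(tcomp_nested (i := 1) (j := 0) (hom_mu M) hmh hg) //.
rewrite -(tcomp_nested (i := 1) (j := 1) (hom_mu M) (hom_mu M) hh) // muA.
rewrite -(tcomp_nested (i := 0) (j := 0) hmh hmg hf) //.
rewrite -(tcomp_nested (i := 0) (j := 1) hmh (hom_mu M) hg) //.
by rewrite -(tcomp_parallel (i := 0) (j := 1) (hom_mu M) (hom_mu M) hh).
Qed.

Lemma cup1l n g : hom n g -> cup e g = g.
Proof.
move=> hg; rewrite /cup -(tcomp_parallel (hom_mu M) (hom_e M) hg (i := 0) (j :=
  1)) //.
by rewrite (tcompE _ _ (hom_e M)) mu_e0 scale1r (id_tcomp hg).
Qed.

Lemma cup1r m f : hom m f -> cup f e = f.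
Proof.
move=> hf; rewrite /cup (tcompE _ _ (hom_e M)) mu_e1 scalerN scaleN1r opprK.
exact: id_tcomp hf.
Qed.

Lemma diff_face0 n g : hom n g ->
  diff (face n 0 g) = face n.+1 0 (face n 0 g) - face n.+1 0 (diff g).
Proof.
move=> hg; rewrite (diffE M (hom_face M 0 hg)) {1}/face_sum big_nat_recl //=.
congr (_ + _); rewrite (diffE M hg) linear_sum -sumrN; apply:
  eq_big_nat => i lt_i.
by rewrite (face_face M hg).
Qed.

(** The cup product is an insertion at the input 0 of a coface of g, so this
   is diff_scomp_telescope at a = 0, where the correction only involves the
   first two cofaces of that coface. *)
Lemma diff_cup m n f g : hom m f -> hom n g ->
  diff (cup f g) = cup (diff f) g + (-1) ^+ m *: cup f (diff g).
Proof.
move=> hf hg; have h0 := hom_face M 0 hg; have hdf := hom_diff M hf.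
have hdg := hom_diff M hg.
rewrite (cupE hf hg) (cupE hdf hg) (cupE hf hdg).
rewrite (diff_scomp_telescope h0 hf) // !face_sumS face_sum0 add0r.
rewrite (face_face M (i := 1) (j := 0) hg) //=.
rewrite diff_face0 // subrr scomp0l sub0r scompDl scompNl.
rewrite !signZ /=; case: odd => /=; abel.
Qed.

(** Inserting g at the last input of mu(f, -) also gives the cup product, by
   the parallel axiom. *)
Lemma cup_top m n f g : hom m f -> hom n g ->
  face m m.+1 f *[m] g = - ((-1) ^+ (m * n) *: cup f g).
Proof.
move=> hf hg; rewrite (cupE hf hg) face_top // face0 !scompZl.
have := scomp_parallel (hom_mu M) hf hg (i := 0) (j := 1) isT.
rewrite add1n /= => ->; rewrite /koszul !scalerA -!exprD !signZ.
rewrite !(oddD, oddM, oddS); case: (odd m); case: (odd n) => /=; abel.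
Qed.

(** The telescoped correction leaves its two end terms, the insertions of g at
   the first input of mu(-, f) and at the last input of mu(f, -), which are
   the two cup products. *)
Lemma diff_circ m n f g : hom m f -> hom n g ->
  diff (pcirc m f g) = (-1) ^+ n.+1 *: pcirc m.+1 (diff f) g
    + pcirc m f (diff g)
    + (-1) ^+ n *: (cup g f - (-1) ^+ (m * n) *: cup f g).
Proof.
move=> hf hg; rewrite (diff_pcirc hf hg) // pcircS.
have -> : face_sum m m.+1 f = diff f - face m m.+1 f.
  by rewrite (diffE M hf) [in RHS]face_sumS addrK.
rewrite -(cupE hg hf) scompDl scompNl (cup_top hf hg).
rewrite !signZ /=; case: (odd n); case: (odd (m * n)) => /=; abel.
Qed.

(** The brace operation h{f, g} up to sign, with g at one of the first b
   inputs. *)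
Definition brace (b : nat) (h f g : U) : U :=
  \sum_(0 <= j < b) pcirc j (h *[j] g) f.

Lemma pcirc_cup_left r m n h f g : hom r h -> hom m f -> hom n g ->
  pcirc r (cup h g) f = cup (pcirc r h f) g.
Proof.
move=> hh hf hg; have h0 := hom_face M 0 hg.
rewrite (cupE (hom_pcirc r hh hf) hg) (cupE hh hg) /pcirc scomp_sumr.
by apply: eq_big_nat => i lt_i; rewrite -(scomp_nested h0 hh hf).
Qed.

(** The inputs of a cup product are those of f followed by those of g. *)
Lemma pcirc_cup r m n h f g : hom r h -> hom m f -> hom n g ->
  pcirc (m + n) (cup f g) h =
  cup (pcirc m f h) g + (-1) ^+ (m * r.+1) *: cup f (pcirc n g h).
Proof.
move=> hh hf hg; have h0 := hom_face M 0 hg.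
rewrite -(pcirc_cup_left hf hh hg) /pcirc (@big_cat_nat _ _ _ m) ?leq_addr //=.
congr (_ + _); rewrite linear_sum /=
  scaler_sumr -[X in index_iota X]add0n big_addn.
rewrite addKn; apply: eq_big_nat => l lt_l.
rewrite (cupE hf (hom_scomp l hg hh)) (cupE hf hg).
have eq_q : (n + r).-1.+1 = (n + r)%N by lia.
rewrite (face_scomp_le M hg hh eq_q) // [in RHS]scompZl.
have := scomp_parallel h0 hf hh (i := 0) (j := l.+1).
rewrite addSn /= => ->; last by rewrite ltnS; case/andP: lt_l.
rewrite /koszul scalerA -exprD !signZ !(oddD, oddM, oddS).
by case: (odd m); case: (odd r).
Qed.

(** For fixed j the sum over the position of f on the left of g is a truncated
   circle product, whose coboundary is given by diff_pcirc; its upper end term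
   and the correction for the insertion of g combine into a telescoping
   sequence in j. The end terms that survive are the cup products on the
   right, the collisions of f and g giving the insertion of their product. *)
Lemma diff_brace r m n h f g : hom r h -> hom m f -> hom n g ->
    diff h = 0 -> diff f = 0 -> diff g = 0 ->
  diff (brace r h f g) =
  (-1) ^+ m.+1 *: (pcirc r h (cup f g) - (-1) ^+ (n * r.+1) *: cup (pcirc r h f)
    g
    - cup f (pcirc r h g)).
Proof.
move=> hh hf hg dh df dg; pose X j := face_sum r j.+1 h *[j] g.
(* X and Z are the telescoping sequences of the insertions of g and of f. *)
pose Z j := pcirc j (X j) f.
have step j : (j < r)%N -> diff (pcirc j (h *[j] g) f) =
    (-1) ^+ m.+1 *: ((-1) ^+ n.+1 *: (Z j.+1 - Z j) + h *[j] cup f g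
      - cup f (h *[j] g)).
  move=> lt_j; have hx := hom_scomp j hh hg.
  have eq_q : (r + n).-1.+1 = (r + n)%N by lia.
  rewrite (diff_pcirc hx hf) ?df; last by lia.
  rewrite (diff_scomp_telescope hh hg lt_j) dh dg scomp0l !linear0 add0r addr0.
  rewrite (face_sum_scomp_le M hh hg eq_q) // -(cupE hf hx) -/(X j) -/(X j.+1).
  have -> : face_sum r j.+1 h *[j.+1] g = X j.+1 - face r j.+1 h *[j.+1] g.
    by rewrite /X (face_sumS M r j.+1) scompDl addrK.
  rewrite (face_scomp_bot M hh hg) // opprK !scompZl scompDl scompZl.
  have := scomp_nested (j := 0) hh (hom_face M 0 hg) hf lt_j isT.
  rewrite addn0 => ->.
  rewrite -(cupE hf hg) /Z pcircS add0r pcircZl pcircDl pcircNl.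
  signs.
rewrite /brace linear_sum /= (eq_big_nat _ _ (fun j H => step j (andP H).2)).
rewrite -scaler_sumr sumrB big_split /= -scaler_sumr telescope_sumr //.
rewrite /Z pcirc_0 subr0 /X.
have -> : face_sum r r.+1 h = - face r r.+1 h.
  by apply/eqP; rewrite -addr_eq0 -(face_sumS M r r.+1) -(diffE M hh) dh.
rewrite scompNl (cup_top hh hg) opprK pcircZl (pcirc_cup_left hh hf hg).
rewrite -[\sum_(0 <= i < r) h *[i] cup f g]/(pcirc r h (cup f g)).
rewrite -linear_sum -[\sum_(0 <= i < r) h *[i] g]/(pcirc r h g).
signs.
Qed.
End Gerstenhaber.

(** * The pre-Lie identity and the Jacobi identity *)

Section Jacobi.
Variables (k : comPzRingType) (O : operad k).
Local Notation U := (total O).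
Local Hint Resolve hom0 : core.

Lemma triangle_sum (V : nmodType) m (F : nat -> nat -> V) :
  \sum_(0 <= i < m) \sum_(i.+1 <= l < m) F i l =
  \sum_(0 <= l < m) \sum_(0 <= i < l) F i l.
Proof.
elim: m => [|m IH]; first by rewrite !big_nil.
rewrite big_nat_recr //= [X in _ + X]big_geq // addr0 big_nat_recr //= -IH.
rewrite -big_split; apply: eq_big_nat => i /andP[_ lt_i].
by rewrite big_nat_recr.
Qed.

(** The inputs of f *[i] g are the inputs of f on the left of i, those of g,
   and the remaining inputs of f. *)
Lemma pcirc_scomp m n p i (f g h : U) : hom m f -> hom n g -> hom p h ->
  (i < m)%N ->
  pcirc (m + n).-1 (f *[i] g) h = pcirc i (f *[i] g) h + f *[i] (pcirc n g h)
    + koszul k n p *: (\sum_(i.+1 <= l < m) (f *[l] h) *[i] g).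
Proof.
move=> hf hg hh lt_i; rewrite {1}/pcirc (@big_cat_nat _ _ _ (i + n)) //=;
  last by lia.
rewrite (@big_cat_nat _ _ _ i) ?leq_addr //=; congr (_ + _ + _).
  rewrite -{1}[i]add0n big_addn addKn scomp_sumr; apply: eq_big_nat => l lt_l.
  by rewrite addnC (scomp_nested hf hg hh).
rewrite scaler_sumr -[(i + n)%N]add0n -[i.+1]add0n !big_addn.
rewrite (_ : (m + n).-1 - (i + n) = m - i.+1)%N; last by lia.
apply: eq_big_nat => l lt_l; rewrite -(scomp_parallel hf hg hh); last by lia.
by congr (_ *[_] _); lia.
Qed.

(** The associator of the circle product is symmetric in g and h, up to the
   Koszul sign: the pre-Lie identity. *)
Lemma pcirc_assoc m n p (f g h : U) : hom m f -> hom n g -> hom p h ->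
  pcirc (m + n).-1 (pcirc m f g) h =
  pcirc m f (pcirc n g h) + brace m f h g + koszul k n p *: brace m f g h.
Proof.
move=> hf hg hh; rewrite {2}/pcirc -/(lpcirc _ h _) linear_sum /=.
rewrite (eq_big_nat _ _ (fun i H => pcirc_scomp hf hg hh (andP H).2)).
rewrite !big_split /= -scaler_sumr triangle_sum.
by congr (_ + _); rewrite addrC.
Qed.

(** The Gerstenhaber bracket, where a and b stand for the suspended degrees:
   only their parity matters for the sign, and they may be any numbers not
   smaller than the arities as bounds of the sums. Taking the successors of
   the arities (tinj_bracketc) makes degrees add up without truncation in
   iterated brackets. *)
Definition bracket (a b : nat) (f g : U) : U :=
  (-1) ^+ (a * b) *: pcirc a f g - pcirc b g f.

Lemma bracketC a b f g : bracket a b f g =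
  - ((-1) ^+ (a * b) *: bracket b a g f).
Proof. rewrite /bracket mulnC; signs. Qed.

Lemma bracket_linl a b g : linear (fun f => bracket a b f g).
Proof.
move=> c x y; rewrite /bracket pcircDl pcircZl pcircDr pcircZr scalerBr.
by rewrite !signZ; case: odd; rewrite ?scalerN; abel.
Qed.
Lemma bracket_linr a b f : linear (bracket a b f).
Proof.
move=> c x y; rewrite /bracket pcircDl pcircZl pcircDr pcircZr scalerBr.
by rewrite !signZ; case: odd; rewrite ?scalerN; abel.
Qed.

(** Expanding by the pre-Lie identity, the iterated circle products cancel and
   so do the braces. *)
Lemma bracket_jacobi m n p f g h (a := m.+1) (b := n.+1) (c := p.+1) :
    hom m f -> hom n g -> hom p h ->
  bracket a (b + c) f (bracket b c g h) = bracket (a + b) c (bracket a b f g) h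
    + (-1) ^+ (a * b) *: bracket b (a + c) g (bracket a c f h).
Proof.
move=> hf hg hh.
have w (x y : U) q r d : hom q x -> hom r y -> (q <= d)%N ->
  pcirc d x y = pcirc q x y.
  exact: pcirc_widen.
have w2 (x y z : U) q r s d : hom q x -> hom r y -> hom s z -> (q + r <= d)%N ->
    pcirc d (pcirc q x y) z = pcirc (q + r).-1 (pcirc q x y) z.
  move=> hx hy hz le_d; apply: (pcirc_widen (hom_pcirc q hx hy) hz).
  by lia.
rewrite /bracket /a /b /c.
rewrite !(w f h m p m.+1) // !(w f g m n m.+1) // !(w g h n p n.+1) //.
rewrite !(w g f n m n.+1) // !(w h f p m p.+1) // !(w h g p n p.+1) //.
rewrite !(pcircDl, pcircDr, pcircNl, pcircNr, pcircZl, pcircZr).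
rewrite (w f _ m _ m.+1 hf (hom_pcirc n hg hh)) //.
rewrite (w f _ m _ m.+1 hf (hom_pcirc p hh hg)) //.
rewrite (w g _ n _ n.+1 hg (hom_pcirc m hf hh)) //.
rewrite (w g _ n _ n.+1 hg (hom_pcirc p hh hf)) //.
rewrite (w h _ p _ p.+1 hh (hom_pcirc m hf hg)) //.
rewrite (w h _ p _ p.+1 hh (hom_pcirc n hg hf)) //.
rewrite !(w2 _ _ _ _ _ _ _ hf hg hh) ?(w2 _ _ _ _ _ _ _ hg hf hh); try lia.
rewrite !(w2 _ _ _ _ _ _ _ hf hh hg) ?(w2 _ _ _ _ _ _ _ hh hf hg); try lia.
rewrite !(w2 _ _ _ _ _ _ _ hg hh hf) ?(w2 _ _ _ _ _ _ _ hh hg hf); try lia.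
rewrite (pcirc_assoc hf hg hh) (pcirc_assoc hg hf hh) (pcirc_assoc hf hh hg).
rewrite (pcirc_assoc hh hf hg) (pcirc_assoc hg hh hf) (pcirc_assoc hh hg hf)
  /koszul.
signs.
Qed.
End Jacobi.

(** * The Connes operator and the Batalin-Vilkovisky identity *)

Section Connes.
Variables (k : comPzRingType) (O : operad k) (M : multiplication O).
Variable (T : cyclic_structure O).
Hypothesis tau_muT : op_tau T 2 (op_mu M) = op_mu M.
Local Notation U := (total O).
Local Notation e := (te M).
Local Notation face := (face M).
Local Notation face_sum := (face_sum M).
Local Notation diff := (diff M).
Local Notation turn := (turn T).
Local Notation turns := (turns T).
Local Notation cup := (cup M).
Local Hint Resolve hom_mu hom_e hom_tid hom0 hom_face hom_diff : core.
Local Hint Resolve hom_turn hom_turns : core.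

Lemma turn_face0 q x : hom q x -> turn (face q 0 x) = face q q.+1 x.
Proof.
move=> hx; rewrite face0 face_top // linearZ /=.
by rewrite (turn_scomp (i := 0) T (hom_mu M) hx) // (turn_mu tau_muT).
Qed.

(** The two end cases are those where the rotation passes over mu; they use
   the invariance of mu. *)
Lemma turn_faceS q i x : hom q x -> (i <= q)%N ->
  turn (face q i.+1 x) = face q i (turn x).
Proof.
move=> hx le_i; have [i_eq|ne_i] := eqVneq i q.
  rewrite i_eq face_top // linearZ /=; have [q0|q_gt0] := posnP q.
    have := turns_wrap T (hom_mu M) hx isT;
      rewrite q0 -[turns 1 _]/(turn _) => ->.
    rewrite face0; congr (_ *: (_ *[_] _)).
      by rewrite turnsS -[turns 1 _]/(turn _) !(turn_mu tau_muT).
    by rewrite -[RHS]/(turns 1 x) turns_order // -q0.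
  rewrite (turn_scomp0 T (hom_mu M) hx) //
    (turn_mu tau_muT) face_mid ?q_gt0 //=.
  rewrite /koszul; signs.
rewrite face_mid; last by lia.
case: i le_i ne_i => [|i] le_i ne_i /=; last first.
  rewrite linearN /= (turn_scomp T hx (hom_mu M)); last by lia.
  by rewrite face_mid //; lia.
rewrite linearN /= (turn_scomp0 T hx (hom_mu M)) //; last by lia.
rewrite (turn_mu tau_muT) face0 /koszul /=; signs.
Qed.

(** The extra degeneracy sigma_n of the cocyclic module, which plugs the root
   with e. *)
Definition extra_deg (q : nat) (x : U) : U := turn x *[q.-1] e.

Lemma extra_deg_is_linear q : linear (extra_deg q).
Proof. by move=> c x y; rewrite /extra_deg linearP /= scompDl scompZl. Qed.
HB.instance Definition _ q := GRing.isLinear.Build k U U *:%R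
  (extra_deg q) (extra_deg_is_linear q).

Lemma hom_extra_deg q x : hom q x -> hom q.-1 (extra_deg q x).
Proof.
by move=> hx; have := hom_scomp q.-1 (hom_turn T hx) (hom_e M); rewrite addn0.
Qed.

Lemma extra_deg_face0 q x : hom q x -> extra_deg q.+1 (face q 0 x) = - x.
Proof.
move=> hx; rewrite /extra_deg turn_face0 // face_top // scompZl /=.
have := scomp_parallel (hom_mu M) hx (hom_e M) (i := 0) (j := 1) isT.
rewrite add1n /= => ->; rewrite mu_e1 scompNl (id_scomp hx) /koszul; signs.
Qed.

Lemma extra_deg_face q i x : hom q x -> (i < q)%N ->
  extra_deg q.+1 (face q i.+1 x) = - face q.-1 i (extra_deg q x).
Proof.
move=> hx lt_i; rewrite /extra_deg turn_faceS // ?(ltnW lt_i) //.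
rewrite (face_scomp_le M (hom_turn T hx) (hom_e M)) //; try lia.
by rewrite expr1 scaleN1r opprK prednK //; lia.
Qed.

Lemma extra_deg_face_top q x : hom q x ->
  extra_deg q.+1 (face q q.+1 x) = turn x.
Proof.
move=> hx; rewrite /extra_deg turn_faceS //; have ht := hom_turn T hx.
have [q0|q_gt0] := posnP q; last first.
  have := face_scomp_bot M ht (hom_e M) (j := q.-1); rewrite prednK // => ->.
    by rewrite face_e0 (scomp_id ht) ?expr1 ?scaleN1r ?opprK //; lia.
  by lia.
rewrite q0 face0 scompZl /= in ht *; have :=
  scomp_parallel (hom_mu M) (hom_e M) ht.
move=> /(_ 0 1 isT) /=; rewrite mu_e0 (id_scomp ht) => E.
by rewrite [RHS]E /koszul; signs.
Qed.

(** Makes the input p of x the root and plugs the former root with e; see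
   rerootE, where the former root has become the input q - p.+1. *)
Definition reroot (q p : nat) (x : U) : U := turns p (extra_deg q x).

#[global] Arguments reroot : simpl never.

Lemma reroot_is_linear q p : linear (reroot q p).
Proof. by move=> c x y; rewrite /reroot !linearP. Qed.
HB.instance Definition _ q p := GRing.isLinear.Build k U U *:%R
  (reroot q p) (reroot_is_linear q p).

Lemma hom_reroot q p x : hom q x -> hom q.-1 (reroot q p x).
Proof. by move=> hx; apply/hom_turns/hom_extra_deg. Qed.

Lemma face_turns r i p y : hom r y -> (i + p <= r.+1)%N ->
  face r i (turns p y) = turns p (face r (i + p) y).
Proof.
move=> hy; elim: p i => [|p IH] i le_ip; first by rewrite addn0.
rewrite turnsS -turn_faceS ?IH; try by [|lia|apply: hom_turns].
by rewrite addSnnS -turnsS.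
Qed.

(** The 0-th coface of a rotated element is the last one of the previous
   rotation (turn_face0), so one extra rotation appears whenever the index
   passes the end. *)
Lemma face_turns_wrap r i p y : hom r y ->
    (r.+1 <= i + p)%N -> (i <= r.+1)%N -> (p <= r.+1)%N ->
  face r i (turns p y) = turns p.+1 (face r (i + p - r.+1) y).
Proof.
move=> hy le_r le_i le_p; pose a := (r.+1 - i)%N; pose b := (i + p - r.+1)%N.
have {1}-> : p = (a + b)%N by rewrite /a /b; lia.
have hz : hom r (turns b y) by apply: hom_turns.
rewrite -turnsD (face_turns hz); last by rewrite /a; lia.
have -> : (i + a = r.+1)%N by rewrite /a; lia.
rewrite -turn_face0 // -turnsSr (face_turns hy) ?turnsD ?add0n.
  by congr turns; rewrite /a /b; lia.
by rewrite /b; lia.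
Qed.

Lemma reroot_face0 q p x : hom q x -> reroot q.+1 p (face q 0 x) = - turns p x.
Proof. by move=> hx; rewrite /reroot extra_deg_face0 // linearN. Qed.

Lemma reroot_face_top q p x : hom q x ->
  reroot q.+1 p (face q q.+1 x) = turns p.+1 x.
Proof. by move=> hx; rewrite /reroot extra_deg_face_top // turnsSr. Qed.

(** A coface of the rerooted element is the rerooted element of a coface of x,
   at the same input if the coface is on the right of the input p, and at the
   next input otherwise; the summands of the differential split accordingly.
   Rerooting the two extreme cofaces of x gives opposite rotations of x, so
   they may be included in the partial sums. *)
Lemma diff_reroot q p x : hom q x -> (p < q)%N ->
  - diff (reroot q p x) = reroot q.+1 p (diff x) - reroot q.+1 p (face_sum q
    p.+1 x)
    + reroot q.+1 p.+1 (face_sum q p.+2 x).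
Proof.
move=> hx lt_p; have hs := hom_extra_deg hx; have hr := hom_reroot p hx.
have q_gt0 : (0 < q)%N by apply: leq_ltn_trans lt_p.
pose r := q.-1; have qr : q = r.+1 by rewrite /r prednK.
have up : \sum_(p.+1 <= i < q.+1) face q i x =
    diff x - face_sum q p.+1 x - face q q.+1 x.
  by rewrite (diff_face_sum M hx) ?big_nat_recr //= ?addrK //; lia.
have down : \sum_(1 <= i < p.+2) face q i x = face_sum q p.+2 x - face q 0 x.
  by rewrite /face_sum [in RHS]big_nat_recl //= addrC addKr big_add1.
have -> : - diff (reroot q p x) = reroot q.+1 p (\sum_(p.+1 <=
  i < q.+1) face q i x)
    + reroot q.+1 p.+1 (\sum_(1 <= i < p.+2) face q i x).
  rewrite (diffE M hr) /face_sum -/r -sumrN.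
  rewrite (@big_cat_nat _ _ _ (r.+1 - p)) //=; last by lia.
  congr (_ + _); rewrite linear_sum /=.
    rewrite -[p.+1]add0n big_addn (_ : q.+1 - p.+1 = r.+1 - p)%N; last by lia.
    apply: eq_big_nat => i /andP[_ lt_i]; rewrite face_turns //; last by lia.
    by rewrite -linearN /= -extra_deg_face ?addnS //; lia.
  rewrite -[1%N]add0n -[(r.+1 - p)%N]add0n !big_addn.
  rewrite (_ : r.+2 - (r.+1 - p) = p.+2 - 1)%N; last by lia.
  apply: eq_big_nat => i /andP[_ lt_i]; rewrite face_turns_wrap //; try lia.
  rewrite (_ : i + (r.+1 - p) + p - r.+1 = i)%N; last by lia.
  by rewrite -linearN /= -extra_deg_face ?addn1 //; lia.
rewrite up down !linearB /= reroot_face0 // reroot_face_top //; abel.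
Qed.

(** For a = 0 this is B up to sign; the other values of a serve in the
   homotopy for the Batalin-Vilkovisky identity. *)
Definition reroots (q a : nat) (x : U) : U := \sum_(a <= p < q) reroot q p x.

Lemma reroots_is_linear q a : linear (reroots q a).
Proof.
move=> c x y; rewrite /reroots scaler_sumr -big_split; apply: eq_bigr => i _.
by rewrite linearP.
Qed.
HB.instance Definition _ q a := GRing.isLinear.Build k U U *:%R
  (reroots q a) (reroots_is_linear q a).

Lemma hom_reroots q a x : hom q x -> hom q.-1 (reroots q a x).
Proof. by move=> hx; apply: hom_sum => i _; apply: hom_reroot. Qed.

Lemma reroots_geq q a x : (q <= a)%N -> reroots q a x = 0.
Proof. by move=> le_q; rewrite /reroots big_geq. Qed.

Lemma reroots_rec q a x : (a < q)%N ->
  reroots q a x = reroot q a x + reroots q a.+1 x.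
Proof. by move=> lt_a; rewrite /reroots big_ltn. Qed.

(** Summing diff_reroot over p telescopes; the upper end term is a full turn,
   which is the identity. *)
Lemma diff_reroots q a x : hom q x -> (a <= q)%N ->
  - diff (reroots q a x) = reroots q.+1 a (diff x) - x - reroot q.+1 a (face_sum
    q a.+1 x).
Proof.
move=> hx le_a; pose F p := reroot q.+1 p (face_sum q p.+1 x).
have -> : - diff (reroots q a x) =
    \sum_(a <= p < q) (reroot q.+1 p (diff x) + (F p.+1 - F p)).
  rewrite /reroots linear_sum -sumrN; apply: eq_big_nat => p /andP[_ lt_p].
  by rewrite diff_reroot // /F; abel.
rewrite big_split /= telescope_sumr // /reroots [in RHS]big_nat_recr //=.
have -> : F q = reroot q.+1 q (diff x) - x.
  rewrite /F (_ : face_sum q q.+1 x = diff x - face q q.+1 x).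
    by rewrite linearB /= reroot_face_top // turns_order.
  by rewrite (diffE M hx) [in RHS](face_sumS M q q.+1) addrK.
by rewrite /F; abel.
Qed.

(** The sign is the one that relates signed rotations and insertions to the
   operators in the definition of B (tinj_connesB). *)
Definition connes (q : nat) (x : U) : U := - reroots q 0 x.

(** At a = 0 the two end terms in diff_reroots cancel. *)
Lemma diff_connes q x : hom q x ->
  diff (connes q x) = - connes q.+1 (diff x).
Proof.
move=> hx; rewrite /connes linearN /= diff_reroots // opprK.
rewrite (_ : face_sum q 1 x = face q 0 x) ?reroot_face0 //;
  last by rewrite face_sumS face_sum0 add0r.
by rewrite -[turns 0 x]/x opprK subrK.
Qed.

Lemma rerootE q p x : hom q x -> (p < q)%N ->
  reroot q p x = turns p.+1 x *[(q - p.+1)%N] e.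
Proof.
move=> hx lt_p; rewrite turnsSr -(turns_scomp T (hom_turn T hx) (hom_e M)).
  by rewrite /reroot /extra_deg; congr (turns _ (_ *[_] _)); lia.
by lia.
Qed.

(** Insert g at the input j of f, then put the root at an input of f on the
   right of g; in f *[j] g these inputs start at j + n. *)
Definition bv_homotopy (m n : nat) (f g : U) : U :=
  \sum_(0 <= j < m) reroots (m + n).-1 (j + n) (f *[j] g).

(** The corrections coming from diff_scomp_telescope and from diff_reroots
   have the same shape and combine into a telescoping sequence in j. *)
Lemma diff_bv_homotopy m n f g : hom m f -> hom n g -> diff f = 0 ->
  diff g = 0 ->
  - diff (bv_homotopy m n f g) =
  \sum_(0 <= j < m) reroot (m + n) (j + n) (f *[j] face n n.+1 g)
    - pcirc m f g + (-1) ^+ n *: reroots (m + n) n (cup g f).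
Proof.
move=> hf hg df dg; pose Y j := face_sum m j.+1 f *[j] g.
pose W j := reroots (m + n) (j + n) (Y j).
have step j : (j < m)%N -> - diff (reroots (m + n).-1 (j + n) (f *[j] g)) =
    (-1) ^+ n.+1 *: (W j.+1 - W j) +
    reroot (m + n) (j + n) (f *[j] face n n.+1 g) - f *[j] g.
  move=> lt_j; have hx := hom_scomp j hf hg.
  have eq_q : (m + n).-1.+1 = (m + n)%N by lia.
  rewrite (diff_reroots hx) ?eq_q; last by lia.
  rewrite (diff_scomp_telescope M hf hg lt_j) df dg scomp0l !linear0 !add0r.
  rewrite -/(Y j) -/(Y j.+1).
  have -> : face_sum (m + n).-1 (j + n).+1 (f *[j] g) =
      (-1) ^+ n.+1 *: Y j.+1 - f *[j] face n n.+1 g.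
    rewrite (face_sum_scomp M hf hg eq_q lt_j) /inner_faces dg sub0r scompDr
      !scompNr.
    rewrite /Y (face_sumS M m j.+1) scompDl (face_scomp_bot M hf hg lt_j);
      signs.
  have -> x y : reroots (m + n) (j + n) ((-1) ^+ n.+1 *: (x - y)) =
      (-1) ^+ n.+1 *: (reroots (m + n) (j + n) x - reroots (m + n) (j + n) y).
    by rewrite linearZ linearB.
  have -> x y : reroot (m + n) (j + n) ((-1) ^+ n.+1 *: x - y) =
      (-1) ^+ n.+1 *: reroot (m + n) (j + n) x - reroot (m + n) (j + n) y.
    by rewrite linearB linearZ.
  rewrite /W addSn (reroots_rec (Y j.+1)) ?ltn_add2r //; signs.
rewrite /bv_homotopy linear_sum -sumrN /=.
rewrite (eq_big_nat _ _ (fun j H => step j (andP H).2)).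
rewrite sumrB big_split /= -scaler_sumr telescope_sumr // /W reroots_geq //.
rewrite /Y face_sumS face_sum0 !add0r -(cupE M hg hf) -/(pcirc m f g).
signs.
Qed.

(** In f *[j] mu(g, -) the last input belongs to mu and replaces the input j
   of f. Putting the root there yields f rerooted at j, with its new root
   attached to mu next to g: a cup product. *)
Lemma reroot_scomp_face_top m n j f g : hom m f -> hom n g -> (j < m)%N ->
  reroot (m + n) (j + n) (f *[j] face n n.+1 g) =
  (-1) ^+ (m * n + n).+1 *: cup (reroot m j f) g.
Proof.
move=> hf hg lt_j; have ht := hom_face M n.+1 hg.
have hx : hom (m + n) (f *[j] face n n.+1 g).
  by have := hom_scomp j hf ht; rewrite addnS.
rewrite (rerootE hx); last by rewrite ltn_add2r.
have -> : turns (j + n).+1 (f *[j] face n n.+1 g) =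
    - (koszul k m n.+1 *: (face n 0 g *[0] turns j.+1 f)).
  rewrite (_ : (j + n).+1 = n.+1 + j)%N; last by lia.
  rewrite -turnsD; have := turns_scomp T (a := j) (i := 0) hf ht lt_j.
  rewrite add0n => ->; rewrite turnsSr.
  rewrite (turn_scomp0 T (hom_turns T j hf) ht) //; last by lia.
  rewrite linearN linearZ /= -turnsS.
  have := turns_scomp T (a := n) (i := 0) (hom_turn T ht) (hom_turns T j.+1 hf).
  rewrite add0n => -> //; rewrite -turnsSr -(turn_face0 hg) -turnsSr.
  by rewrite (turns_order T (hom_face M 0 hg)).
rewrite scompNl scompZl (rerootE hf lt_j).
have hz := hom_scomp (m - j.+1) (hom_turns T j.+1 hf) (hom_e M).
rewrite (cupE M hz hg).
rewrite -(scomp_nested (hom_face M 0 hg) (hom_turns T j.+1 hf) (hom_e M)) //;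
  last by lia.
rewrite add0n (_ : m + n - (j + n).+1 = m - j.+1)%N; last by lia.
rewrite /koszul; signs.
Qed.

(** Both elements have the same rotations, being three branches f, g and the
   root attached to mu; plugging the root with e removes mu and leaves, for
   either order of the factors, g inserted at the former root of f. *)
Lemma reroot_cup_swap m n p f g : hom m f -> hom n g -> (0 < m)%N ->
  reroot (m + n) (p + n) (cup g f) = (-1) ^+ (m * n) *: reroot (m
    + n) p (cup f g).
Proof.
move=> hf hg m_gt0.
have hgf := hom_cup M hg hf; rewrite addnC in hgf.
have hfg := hom_cup M hf hg; have ht := hom_turn T hf.
have mK : m.-1.+1 = m by rewrite prednK.
have -> x : reroot (m + n) (p + n) x = turns p (reroot (m + n) n x).
  by rewrite /reroot turnsD.
rewrite -[reroot (m + n) p _]/(turns p (extra_deg (m + n) _)) -linearZ;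
  congr turns.
pose F := face m m (turn f); have hF : hom m.+1 F by apply: hom_face.
have -> : reroot (m + n) n (cup g f) = (-1) ^+ n *: (turn f *[m.-1] g).
  rewrite (rerootE hgf) ?(cupE M hg hf); last by lia.
  rewrite (turns_wrap T (hom_face M 0 hf) hg) //= turnsS -[turns 1 _]/(turn _).
  rewrite turn_face0 // turn_faceS // -/F.
  have lt_m : (m.-1 < m < m.+1)%N by lia.
  have := scomp_parallel hF (hom_e M) hg lt_m; rewrite addn0.
  have lt_m1 : (m.-1 < m)%N by lia.
  have := face_scomp_top M ht (hom_e M) lt_m1; rewrite mK => ->.
  rewrite face_e1 scompNr (scomp_id ht) ?mK // (_ : m + n - n.+1 = m.-1)%N;
    last by lia.
  rewrite expr1 scaleN1r opprK scompNl => E.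
  have -> : F *[m] g *[m.-1] e = koszul k 0 n *: (koszul k 0 n *: (F *[m] g
    *[m.-1] e)).
    by rewrite /koszul scalerA -exprD addnn signZ odd_double.
  rewrite -E /koszul; signs.
have -> : cup f g = - ((-1) ^+ (m * n) *: (face m m.+1 f *[m] g)).
  by rewrite (cup_top M hf hg); signs.
rewrite linearN linearZ /= /extra_deg.
have := turn_scomp T (hom_face M m.+1 hf) hg (i := m.-1).
rewrite mK => -> //; rewrite turn_faceS //.
have lt_m1 : (m.-1 < m)%N by lia.
have := face_scomp_top M ht hg lt_m1; rewrite mK => ->.
rewrite (_ : (m + n).-1 = m.-1 + n)%N; last by lia.
rewrite scompNl scompZl (scomp_nested ht (hom_face M n.+1 hg) (hom_e M)) //.
rewrite (cup_top M hg (hom_e M)) (cup1r M hg) muln0 scale1r scompNr.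
signs.
Qed.

Lemma reroots_cup_swap m n f g : hom m f -> hom n g ->
  reroots (m + n) n (cup g f) =
  (-1) ^+ (m * n) *: \sum_(0 <= p < m) reroot (m + n) p (cup f g).
Proof.
move=> hf hg; rewrite /reroots -{1}[n]add0n big_addn addnK scaler_sumr.
apply: eq_big_nat => p /andP[_ lt_p]; apply: reroot_cup_swap => //; lia.
Qed.

Lemma cup_comm m n f g : hom m f -> hom n g -> diff f = 0 -> diff g = 0 ->
  cup g f = (-1) ^+ (m * n) *: cup f g + diff ((-1) ^+ n *: pcirc m f g).
Proof.
move=> hf hg df dg; rewrite linearZ /= (diff_circ M hf hg) df dg.
rewrite pcirc0l pcirc0r; signs.
Qed.

Lemma connes0 x : connes 0 x = 0.
Proof. by rewrite /connes reroots_geq ?oppr0. Qed.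

Lemma hom_connes q x : hom q x -> hom q.-1 (connes q x).
Proof. by move=> hx; apply/homN/hom_reroots. Qed.

(** By diff_bv_homotopy the circle product is, up to a coboundary, the sum of
   two families of rerooted elements, identified by reroot_scomp_face_top and
   reroot_cup_swap. *)
Lemma pcirc_connes m n f g : hom m f -> hom n g -> diff f = 0 -> diff g = 0 ->
  pcirc m f g = (-1) ^+ (m * n + n) *: (cup (connes m f) g
      + \sum_(0 <= p < m) reroot (m + n) p (cup f g))
        + diff (bv_homotopy m n f g).
Proof.
move=> hf hg df dg; rewrite -[diff _]opprK (diff_bv_homotopy hf hg df dg).
rewrite (reroots_cup_swap hf hg).
rewrite (eq_big_nat _ _ (fun j H => reroot_scomp_face_top hf hg (andP H).2)).
rewrite -scaler_sumr -[\sum_(0 <= i < m) cup _ g](linear_sum (lcup M g)) /=.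
rewrite /lcup -/(reroots m 0 f) /connes cupNl; signs.
Qed.

(** The bracket is an antisymmetrization of the circle product. In
   pcirc_connes for (f, g) and for (g, f), the partial sums of rerooted cup
   products are the first m and the last n terms of B(f cup g), and the order
   of the factors (B g) cup f is restored by cup_comm, at the cost of one more
   coboundary. *)
Theorem bracket_connes m n f g : hom m f -> hom n g -> diff f = 0 ->
  diff g = 0 ->
  exists w, bracket m.+1 n.+1 f g =
    (-1) ^+ m *: (connes (m + n) (cup f g) - cup (connes m f) g
      - (-1) ^+ m *: cup f (connes n g)) + diff w.
Proof.
move=> hf hg df dg; rewrite /bracket.
rewrite (pcirc_widen hf hg (leqnSn m)) (pcirc_widen hg hf (leqnSn n)).
rewrite (pcirc_connes hf hg df dg) (pcirc_connes hg hf dg df).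
have dB : diff (connes n g) = 0 by rewrite diff_connes //
  dg /connes linear0 !oppr0.
have -> : \sum_(0 <= p < n) reroot (n + m) p (cup g f) =
    (-1) ^+ (m * n) *: reroots (m + n) m (cup f g).
  rewrite [(m + n)%N]addnC mulnC (reroots_cup_swap hg hf) scalerA -exprD addnn.
  by rewrite signZ odd_double.
have -> : connes (m + n) (cup f g) = - (\sum_(0 <= p < m) reroot (m
  + n) p (cup f g)
     + reroots (m + n) m (cup f g)).
  by rewrite /connes /reroots (@big_cat_nat _ _ _ m) ?leq_addr.
have [v ->] : exists v, cup (connes n g) f =
    (-1) ^+ (m * n.+1) *: cup f (connes n g) + diff v.
  (* For n = 0 the operator B vanishes, whereas the sign of cup_comm would use
     the degree n - 1. *)
  case: n hg dB {dg} => [|n] hg dB.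
    by exists 0; rewrite connes0 cup0l cup0r !linear0 addr0.
  exists ((-1) ^+ n *: pcirc m f (connes n.+1 g)).
  rewrite (cup_comm hf (hom_connes hg) df dB); congr (_ *: _ + _).
  by rewrite -signr_odd -[RHS]signr_odd !oddM /= negbK.
exists ((-1) ^+ (m.+1 * n.+1) *: bv_homotopy m n f g - bv_homotopy n m g f
  - (-1) ^+ (n * m + m) *: v).
rewrite !linearD !linearN !linearZ /=.
signs.
Qed.
End Connes.

(** * The cosimplicial and cocyclic modules *)

Section Cosimplicial.
Variables (k : comPzRingType) (O : operad k) (M : multiplication O).
Local Notation e := (te M).
Local Notation face := (face M).
Local Notation face_sum := (face_sum M).
Local Notation diff := (diff M).
Local Hint Resolve hom_mu hom_e hom_tid hom0 hom_face hom_diff : core.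

Lemma triangle_sum_le (V : nmodType) m (F : nat -> nat -> V) :
  \sum_(0 <= i < m) \sum_(i <= l < m) F i l =
  \sum_(0 <= l < m) \sum_(0 <= i < l.+1) F i l.
Proof.
elim: m => [|m IH]; first by rewrite !big_nil.
rewrite big_nat_recr //= [in RHS]big_nat_recr //= -IH big_nat1.
rewrite [in RHS]big_nat_recr //= addrA; congr (_ + _).
rewrite -big_split; apply: eq_big_nat => i /andP[_ lt_i].
by rewrite big_nat_recr // ltnW.
Qed.

(** By face_face the terms with i < j cancel those with j <= i. *)
Lemma diff_diff q x : hom q x -> diff (diff x) = 0.
Proof.
move=> hx; pose F j i := face q.+1 j (face q i x).
rewrite (diffE M (hom_diff M hx)) (diffE M hx) /face_sum.
under eq_bigr do rewrite linear_sum /=.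
rewrite -[LHS]/(\sum_(0 <= j < q.+3) \sum_(0 <= i < q.+2) F j i).
rewrite (eq_big_nat _ _ (F2 := fun j =>
  \sum_(0 <= i < j) F j i + \sum_(j <= i < q.+2) F j i)); last first.
  by move=> j /andP[_ lt_j]; rewrite (@big_cat_nat _ _ _ j).
rewrite big_split /= big_nat_recl //= big_nil add0r.
rewrite [X in _ + X]big_nat_recr //= [X in _ + (_ + X)]big_geq // addr0.
rewrite triangle_sum_le -big_split big1_seq // => j /andP[_].
rewrite mem_index_iota => /andP[_ lt_j]; rewrite -big_split big1_seq // => i.
rewrite mem_index_iota => /andP[_ lt_i] /=;
  rewrite /F (face_face M hx) ?addNr //.
by lia.
Qed.

Lemma tinj_codegeneracy n j (f : O n.+1) :
  tinj (codegeneracy M j f) = (-1) ^+ j *: (tinj f *[j] e).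
Proof.
rewrite /codegeneracy; case: insubP => [j' lt_j <-|ge_j].
  by rewrite tinj_gcast (tcomp_pcomp f j' (op_e M)) (tcompE _ _ (hom_e M))
    mul1n.
by rewrite (scomp_out (hom_tinj f) (hom_e M)) ?linear0 // leqNgt.
Qed.

Lemma deg_deg q i j x : hom q x -> (i <= j)%N -> (j.+1 < q)%N ->
  x *[i] e *[j] e = - (x *[j.+1] e *[i] e).
Proof.
move=> hx le_ij lt_j.
have := scomp_parallel hx (hom_e M) (hom_e M) (i := i) (j := j.+1).
by rewrite addn0 /= => ->; rewrite ?ltnS ?le_ij // /koszul expr1 scaleN1r.
Qed.

Lemma deg_face_lt q i j x : hom q x -> (i < j)%N -> (j <= q)%N ->
  face q i x *[j] e = - face q.-1 i (x *[j.-1] e).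
Proof.
move=> hx lt_ij le_j; rewrite (face_scomp_le M hx (hom_e M)); try lia.
by rewrite prednK ?expr1 ?scaleN1r ?opprK //; lia.
Qed.

Lemma deg_face_gt q i j x : hom q x -> (j.+1 < i)%N -> (i <= q.+1)%N ->
  face q i x *[j] e = - face q.-1 i.-1 (x *[j] e).
Proof.
move=> hx lt_ji le_i; rewrite (face_scomp_gt M hx (hom_e M)); try lia.
by rewrite subn0 prednK ?expr1 ?scaleN1r ?opprK //; lia.
Qed.

Lemma deg_face q j x : hom q x -> (j <= q)%N -> face q j x *[j] e = x.
Proof.
move=> hx; case: j => [|j] lt_j; first by rewrite -(cupE M (hom_e M) hx) (cup1l
  M hx).
rewrite (face_scomp_bot M hx (hom_e M) lt_j) face_e0 (scomp_id hx) //; signs.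
Qed.

Lemma deg_faceS q j x : hom q x -> (j <= q)%N -> face q j.+1 x *[j] e = - x.
Proof.
move=> hx; rewrite leq_eqVlt => /orP[/eqP->|lt_j].
  by rewrite (cup_top M hx (hom_e M)) (cup1r M hx) muln0 scale1r.
rewrite (face_scomp_top M hx (hom_e M) lt_j) face_e1 scompNr (scomp_id hx) //;
  signs.
Qed.

Theorem coface_codegeneracy_cosimplicial :
  is_cosimplicial (@coface k O M) (@codegeneracy k O M).
Proof.
have hi := @hom_tinj k O; split.
- by move=> n i _; apply: coface_is_linear.
- by move=> n j _; apply: codegeneracy_is_linear.
- move=> n i j x lt_ij le_j; apply: (@tinj_inj _ O).
  rewrite !tinj_coface; try lia; rewrite !linearZ /=
    (face_face M (hi n x)) ?lt_ij //.
  by case: j lt_ij le_j => // j lt_ij le_j; signs.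
- move=> n i j x le_ij le_j; apply: (@tinj_inj _ O).
  rewrite !tinj_codegeneracy !scompZl (deg_deg (hi _ x)) //; signs.
- move=> n i j x lt_ij le_j; apply: (@tinj_inj _ O).
  rewrite tinj_codegeneracy !tinj_coface ?tinj_codegeneracy; try lia.
  rewrite scompZl (deg_face_lt (hi _ x)) // !linearZ /=.
  by case: j lt_ij le_j => // j lt_ij le_j; signs.
- move=> n j x le_j; apply: (@tinj_inj _ O).
  rewrite tinj_codegeneracy tinj_coface ?scompZl ?(deg_face (hi _ x)) //;
    last by lia.
  signs.
- move=> n j x le_j; apply: (@tinj_inj _ O).
  rewrite tinj_codegeneracy tinj_coface ?scompZl ?(deg_faceS (hi _ x)) //;
    signs.
move=> n i j x lt_ji le_i; apply: (@tinj_inj _ O).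
rewrite tinj_codegeneracy !tinj_coface ?tinj_codegeneracy; try lia.
rewrite scompZl (deg_face_gt (hi _ x)) // !linearZ /=.
by case: i lt_ji le_i => // i lt_ji le_i; signs.
Qed.

Section CocyclicModule.
Variable (T : cyclic_structure O).
Hypothesis tau_muT : op_tau T 2 (op_mu M) = op_mu M.
Local Notation turn := (turn T).
Local Notation turns := (turns T).

Lemma tinj_tau n (f : O n) : tinj (op_tau T n f) = (-1) ^+ n *: turn (tinj f).
Proof. by rewrite turn_tinj; signs. Qed.

Theorem operad_cocyclic :
  is_cocyclic (@coface k O M) (@codegeneracy k O M) (@op_tau k O T).
Proof.
have hi := @hom_tinj k O; split.
- exact: coface_codegeneracy_cosimplicial.
- exact: tau_order.
- move=> n [//|i] x _ le_i; apply: (@tinj_inj _ O).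
  rewrite tinj_tau !tinj_coface ?tinj_tau //; last exact: ltnW.
  by rewrite !linearZ /= (turn_faceS tau_muT (hi _ x)) //; signs.
- move=> n x; apply: (@tinj_inj _ O); rewrite tinj_tau !tinj_coface //.
  by rewrite linearZ /= (turn_face0 tau_muT (hi _ x)); signs.
- move=> n [//|i] x _ le_i; apply: (@tinj_inj _ O).
  rewrite tinj_tau !tinj_codegeneracy tinj_tau linearZ /= scompZl.
  rewrite (turn_scomp T (hi _ x) (hom_e M)) //; signs.
move=> n x; apply: (@tinj_inj _ O).
rewrite tinj_tau !tinj_codegeneracy !tinj_tau !linearZ /= !scompZl.
have := turns_wrap T (hi _ x) (hom_e M) isT.
rewrite -[turns 1 _]/(turn _) => ->; rewrite -[turns 2 _]/(turn (turn _)) /=.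
signs.
Qed.
End CocyclicModule.
End Cosimplicial.

(** * Normalized cochains *)

Section Normalization.
Variables (k : comPzRingType) (O : operad k) (M : multiplication O).
Local Notation U := (total O).
Local Notation e := (te M).
Local Notation face := (face M).
Local Notation face_sum := (face_sum M).
Local Notation diff := (diff M).
Local Hint Resolve hom_mu hom_e hom_tid hom0 hom_face hom_diff : core.

(** Normalized cochains, on the product of all arities: the sign between x
   *[j] e and the codegeneracy j is irrelevant to the vanishing. *)
Definition nondeg (q : nat) (x : U) : Prop :=
  forall j, (j < q)%N -> x *[j] e = 0.

Lemma normalizedP n (f : O n) : reflect (nondeg n (tinj f)) (normalized M f).
Proof.
case: n f => [|n] f; first by apply: ReflectT.
apply: (iffP forallP) => [nf j lt_j|nf j]; last first.
  by apply/eqP/(@tinj_inj _ O); rewrite tinj_codegeneracy nf // !linear0.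
have /eqP/(congr1 (@tinj _ O n)) := nf (Ordinal lt_j).
rewrite tinj_codegeneracy linear0 signZ /=; case: odd => // /eqP.
by rewrite oppr_eq0 => /eqP.
Qed.

Lemma hom_deg q j x : hom q x -> hom q.-1 (x *[j] e).
Proof. by move=> hx; have := hom_scomp j hx (hom_e M); rewrite addn0. Qed.

Lemma deg_deg0 q i j x : hom q x -> (i < j < q)%N -> x *[i] e = 0 ->
  x *[j] e *[i] e = 0.
Proof.
move=> hx /andP[lt_ij lt_j] x0; apply/eqP; rewrite -oppr_eq0; apply/eqP.
by case: j lt_ij lt_j => // j le_ij lt_j; rewrite -(deg_deg M hx) ?x0 ?scomp0l.
Qed.

Lemma deg_face_sum_le q a j x : hom q x -> (a <= j <= q)%N -> x *[j.-1] e = 0 ->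
  face_sum q a x *[j] e = 0.
Proof.
move=> hx /andP[le_a le_j] x0; rewrite /face_sum scomp_suml big1_seq //
  => i /andP[_].
rewrite mem_index_iota => /andP[_ lt_i].
rewrite (deg_face_lt M hx) //; last exact: leq_trans lt_i le_a.
by rewrite x0 linear0 oppr0.
Qed.

(** The cofaces numbered j and j.+1 are the two sections of the codegeneracy
   j, so with their signs they cancel. *)
Lemma deg_face_sum q a j x : hom q x -> (j < a <= q.+2)%N -> (j <= q)%N ->
    (j = 0%N \/ x *[j.-1] e = 0) ->
  face_sum q a x *[j] e =
  if (a == j.+1)%N then x else - \sum_(j.+1 <= i < a.-1) face q.-1 i (x *[j] e).
Proof.
move=> hx /andP[lt_ja le_a] le_jq x0.
have loj : face_sum q j x *[j] e = 0.
  case: x0 => [->|x0]; first by rewrite face_sum0 scomp0l.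
  by rewrite deg_face_sum_le ?leqnn.
case: eqVneq => [->|ne_a]; first by rewrite face_sumS scompDl loj add0r
  deg_face.
have -> : face_sum q a x = face_sum q j.+2 x + \sum_(j.+2 <= i < a) face q i x.
  by rewrite /face_sum (@big_cat_nat _ _ _ j.+2) //=; lia.
rewrite !face_sumS !scompDl loj deg_face // deg_faceS //
  add0r subrr add0r scomp_suml.
rewrite -sumrN -[in LHS](prednK (_ : 0 < a)%N) ?big_add1; last by lia.
rewrite /=; apply: eq_big_nat => i /andP[lt_ji lt_i].
by rewrite (deg_face_gt M hx) //; lia.
Qed.

(** If the first p codegeneracies of g vanish, then subtracting the coboundary
   of the next one makes one more of them vanish: this coboundary reduces to
   the first p.+1 cofaces, because the others are, up to sign, the image of dg
   under the codegeneracy p, which is zero. *)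
Lemma normalize_step q p g : hom q g -> (p < q)%N ->
    (forall j, (j < p)%N -> g *[j] e = 0) -> diff g *[p] e = 0 ->
  forall j, (j <= p)%N -> (g - diff (g *[p] e)) *[j] e = 0.
Proof.
move=> hg lt_p g0 dg0; set y := g *[p] e.
have hy : hom q.-1 y by apply: hom_deg.
have y0 j : (j < p)%N -> y *[j] e = 0.
  by move=> lt_j; rewrite /y (deg_deg0 hg) ?g0 ?lt_j.
(* By deg_face_sum, dg *[p] e is minus the sum of the cofaces of y numbered
   above p. *)
have dy : diff y = face_sum q.-1 p.+1 y.
  have g0' : p = 0%N \/ g *[p.-1] e = 0.
    by case: p g0 {dg0 y hy y0 lt_p} => [|p] g0; [left|right; apply: g0].
  have lt_p2 : (p < q.+2 <= q.+2)%N by lia.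
  have := deg_face_sum hg lt_p2 (ltnW lt_p) g0'; rewrite -(diffE M hg) dg0.
  rewrite gtn_eqF; last by lia.
  move/esym/eqP; rewrite oppr_eq0 => /eqP E; apply/eqP; rewrite -subr_eq0.
  by rewrite (diff_face_sum M hy) prednK ?E //; lia.
move=> j le_j; rewrite scompDl scompNl dy.
have yj : j = 0%N \/ y *[j.-1] e = 0.
  by case: j le_j => [|j] lt_j; [left|right; apply: y0].
rewrite (deg_face_sum hy) //; try lia.
have [<-|ne_j] := eqVneq p j; first by rewrite eqxx -/y subrr.
rewrite eqSS (negbTE ne_j) g0 ?y0; try lia.
by rewrite big1 ?oppr0 ?addr0 // => i _; rewrite linear0.
Qed.

(** The inclusion of normalized cochains is a quasi-isomorphism; this form,
   with a normalized coboundary instead of a cocycle, gives at once that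
   cocycles are cohomologous to normalized ones and that a normalized
   coboundary bounds a normalized cochain. *)
Theorem normalize n (f : O n.+1) : normalized M (codiff M f) ->
  exists w : O n, normalized M (f - codiff M w).
Proof.
move=> ndf; suff E p : (p <= n.+1)%N -> exists w : O n, forall j, (j < p)%N ->
    tinj (f - codiff M w) *[j] e = 0.
  by have [w nw] := E _ (leqnn _); exists w; apply/normalizedP.
elim: p => [|p IH] lt_p; first by exists 0.
have [w nw] := IH (ltnW lt_p); set g := f - codiff M w in nw.
have hg := hom_tinj g; have hy := hom_deg p hg.
exists (w + (tinj g *[p] e) n) => j le_j.
have -> : tinj (f - codiff M (w + (tinj g *[p] e) n)) =
    tinj g - diff (tinj g *[p] e).
  rewrite [in RHS]hy diff_tinj -linearB /=; congr tinj.
  by rewrite linearD /= opprD addrA.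
apply: (normalize_step hg lt_p nw) => //.
have -> : diff (tinj g) = tinj (codiff M f).
  have dd : diff (tinj (codiff M w)) = 0.
    by rewrite -diff_tinj (diff_diff M (hom_tinj w)).
  rewrite -diff_tinj /g linearB /= linearB /=; by rewrite dd subr0.
by move/normalizedP: ndf => -> //; apply: leqW.
Qed.

Section ConnesNormalized.
Variable (T : cyclic_structure O).
Local Notation turn := (turn T).
Local Notation turns := (turns T).
Local Notation reroot := (reroot M T).
Local Notation extra_deg := (extra_deg M T).
Local Notation connes := (connes M T).

Lemma turns_eq0 q b z : hom q z -> turns b z = 0 -> z = 0.
Proof.
move=> hz z0.
have ord a : turns (q.+1 * a) z = z.
  elim: a => [|a IH]; first by rewrite muln0.
  by rewrite mulnS -turnsD IH (turns_order T hz).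
rewrite -(ord b) mulSn addnC -turnsD z0 linear0 //.
Qed.

(** After p rotations the former root is the input q - p, so at any other
   input l one inserts e at an input of f itself. *)
Lemma deg_turns q p l f : hom q f -> nondeg q f -> (l < q)%N -> (p <= q)%N ->
  (l + p != q)%N -> turns p f *[l] e = 0.
Proof.
move=> hf nf lt_l le_p ne_l; case: (ltnP (l + p) q) => [lt_lp|].
  by rewrite -(turns_scomp T hf (hom_e M)) // nf // linear0.
rewrite leq_eqVlt eq_sym (negbTE ne_l) /= => lt_q; set y := turns p f.
have hy : hom q y by apply: hom_turns.
have hz := hom_deg l hy; pose b := (q.+1 - p)%N.
(* Completing the turn by b more rotations brings f back, with e inserted at
   the input l - b. *)
apply: (@turns_eq0 q.-1 b) => //.
have -> : l = (l - b + b)%N by rewrite /b; lia.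
rewrite (turns_scomp T hy (hom_e M)); last by rewrite /b; lia.
rewrite /y turnsD (_ : b + p = q.+1)%N; last by rewrite /b; lia.
by rewrite (turns_order T hf) nf // /b; lia.
Qed.

(** The element already has e at one input of a rotation of f, namely the
   former root; one more e must hit an input of f. *)
Lemma reroot_nondeg q p f : hom q f -> nondeg q f -> (p < q)%N ->
  nondeg q.-1 (reroot q p f).
Proof.
move=> hf nf lt_p j lt_j; rewrite (rerootE M T hf lt_p); set y := turns p.+1 f.
have hy : hom q y by apply: hom_turns.
have y0 l : (l < q)%N -> (l + p.+1 != q)%N -> y *[l] e = 0.
  by move=> lt_l ne_l; rewrite (deg_turns hf nf).
case: (leqP (q - p.+1) j) => [le_j|lt_jq].
  by rewrite (deg_deg M hy) ?y0 ?scomp0l ?oppr0 //; lia.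
by rewrite (deg_deg0 hy) ?y0 //; lia.
Qed.

(** Two copies of e are inserted in a rotation of f, all of whose inputs but
   one are inputs of f; so one of them hits an input of f. *)
Lemma extra_deg_reroot q p f : hom q f -> nondeg q f -> (p < q)%N ->
  (1 < q)%N ->
  extra_deg q.-1 (reroot q p f) = 0.
Proof.
move=> hf nf lt_p q_gt1; rewrite (rerootE M T hf lt_p) /extra_deg.
set y := turns p.+1 f; have hy : hom q y by apply: hom_turns.
have [ne_pq|eq_pq] := ltnP p.+1 q.
  have -> : (q - p.+1 = (q - p.+2).+1)%N by lia.
  rewrite (turn_scomp T hy (hom_e M)); last by lia.
  rewrite /y -turnsS (deg_deg M (hom_turns T p.+2 hf)); try lia.
  by rewrite prednK ?(deg_turns hf nf) ?scomp0l ?oppr0 //; lia.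
have -> : (q - p.+1 = 0)%N by lia.
have := turns_wrap T hy (hom_e M); rewrite -[turns 1 _]/(turn _) => ->;
  last by lia.
have -> : turns 2 y = turn f.
  by rewrite /y turnsD (_ : 2 + p.+1 = 1
    + q.+1)%N -?turnsD ?(turns_order T hf) //; lia.
have ht := hom_turn T hf; rewrite (deg_deg0 ht) //; first by lia.
by rewrite -[turn f]/(turns 1 f) (deg_turns hf nf) //; lia.
Qed.

Theorem connes_nondeg q f : hom q f -> nondeg q f -> nondeg q.-1 (connes q f).
Proof.
move=> hf nf j lt_j; rewrite /connes scompNl /reroots scomp_suml big1_seq ?oppr0
  //.
move=> p /andP[_]; rewrite mem_index_iota => /andP[_ lt_p].
exact: reroot_nondeg.
Qed.

Theorem connes_connes q f : hom q f -> nondeg q f ->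
  connes q.-1 (connes q f) = 0.
Proof.
move=> hf nf; rewrite {1}/connes /reroots big1_seq ?oppr0 // => p /andP[_].
rewrite mem_index_iota => /andP[_ lt_p]; rewrite {1}/reroot /connes /reroots.
rewrite !linearN linear_sum linear_sum big1_seq ?oppr0 // => r /andP[_].
rewrite mem_index_iota => /andP[_ lt_r] /=.
by rewrite extra_deg_reroot ?linear0 //; lia.
Qed.

Lemma tinj_iter_tau n a (f : O n) :
  tinj (iter a (op_tau T n) f) = (-1) ^+ (n * a) *: turns a (tinj f).
Proof.
elim: a => [|a IH]; first by rewrite muln0 scale1r.
by rewrite iterS tinj_tau IH linearZ /= scalerA -exprD mulnS.
Qed.

Lemma tinj_connesB n (f : O n.+1) : tinj (connesB M T f) = connes n.+1 (tinj f).
Proof.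
rewrite /connesB /connes /reroots big_mkord linear_sum -sumrN.
apply: eq_bigr => i _; rewrite linearZ /=
  tinj_iter_tau tinj_codegeneracy tinj_tau.
rewrite scompZl !linearZ /= -/(reroot n.+1 i (tinj f)) !scalerA -!exprD.
rewrite !signZ !(oddD, oddM, oddS) /= ; case: (odd n); case: (odd i); signs.
Qed.

End ConnesNormalized.
End Normalization.

(** * Classes of cocycles *)

Section QuotientProjection.
Variables (k : pzRingType) (V : lmodType k) (S : submodClosed V).

Definition proj (x : V) : quot_by S := \pi_(quot_by S) x.

Lemma proj_is_linear : linear proj.
Proof. by move=> a x y; rewrite /proj pi_quotD -pi_scale. Qed.

Lemma proj_eq0 x : proj x = 0 <-> x \in S.
Proof.
have -> : (0 : quot_by S) = proj 0.
  by have := proj_is_linear (-1) 0 0; rewrite scaler0 addr0 scaleN1r addNr.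
have := Quotient.idealrBE (GRing.ZmodClosed.clone V (zmod_pred S) _) x 0.
rewrite subr0 => E; split=> [xE|xS]; first by apply: (etrans E); apply/eqP.
by apply/eqP; rewrite -E.
Qed.
End QuotientProjection.

Section Classes.
Variables (k : pzRingType) (C : int -> lmodType k).
Variable d : forall i, {linear C i -> C (i + 1)}.
Variable N : forall i, submodClosed (C i).
Local Notation H := (cohomology d N).

Definition is_cocycle i (x : C i) : Prop := x \in N i /\ d i x = 0.

Definition coclass i (x : C i) : H i :=
  if insub x is Some u then \pi_(H i) (u : cocycle d N i) else 0.

Lemma closedE i (x : C i) :
  is_cocycle x -> x \in GRing.SubmodClosed.clone k (C i) (@cocycle_pred k C d N
    i) _.
Proof. by case=> Nx dx; rewrite inE /= Nx dx eqxx. Qed.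

Lemma classE i (u : cocycle d N i) : coclass (val u) = \pi_(H i) u.
Proof. by rewrite /coclass valK. Qed.

Lemma closed_val i (x : C i) : is_cocycle x -> {u : cocycle d N i | val u = x}.
Proof. by move=> cx; exists (Sub x (closedE cx)). Qed.

Lemma val_closed i (u : cocycle d N i) : is_cocycle (val u).
Proof. by have /andP[Nu /eqP du] := valP u. Qed.

Lemma class_linear i a (x y : C i) : is_cocycle x -> is_cocycle y ->
  coclass (a *: x + y) = a *: coclass x + coclass y.
Proof.
move=> /closed_val[u <-] /closed_val[v <-].
rewrite -[a *: _ + _]/(val (a *: u + v)) !classE.
exact: proj_is_linear.
Qed.

Lemma class_surj i (a : H i) : exists2 x : C i, is_cocycle x & coclass x = a.
Proof.
by elim/quotW: a => u; exists (val u); [apply: val_closed | apply: classE].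
Qed.

Lemma class_eq0 i (x : C i) : is_cocycle x ->
  coclass x = 0 <->
  exists2 y : C (i - 1), y \in N (i - 1) & gcast (subrK 1 i) (d _ y) = x.
Proof.
move=> /closed_val[u <-]; rewrite classE.
apply: (iff_trans (proj_eq0 (GRing.SubmodClosed.clone k (cocycle d N i)
  (@coboundary_pred k C d N i) _) u)).
by rewrite inE; split=> /asboolP.
Qed.

Lemma representsP i j (x : C i) (a : H j) :
  represents x a <-> exists e : i = j, is_cocycle x /\ gcast e (coclass x) = a.
Proof.
split=> [[e [u [ux ->]]]|[e [cx <-]]].
  exists e; case: _ / e u ux => u ux.
  by rewrite -[x]/(gcast erefl x) -ux; split; [apply: val_closed|apply: classE].
exists e; case: _ / e; have [u ux] := closed_val cx; exists u; split=> //.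
by rewrite -ux; apply: classE.
Qed.
End Classes.

(** * Integer degrees *)

Section GradedCochains.
Variables (k : comPzRingType) (O : operad k) (M : multiplication O).
Local Notation U := (total O).
Local Notation diff := (diff M).
Local Notation H := (operad_cohomology M).
Local Hint Resolve hom_mu hom_e hom_tid hom0 hom_face hom_diff : core.

(** The total module is indexed by natural numbers while cochains live in all
   integer degrees; in negative degrees they are zero. *)
Definition zinj (z : int) : cochain O z -> U :=
  match z with Posz n => @tinj k O n | Negz _ => fun=> 0 end.

Definition zproj (z : int) (x : U) : cochain O z :=
  match z with Posz n => x n | Negz _ => 0 end.

Lemma zinj_is_linear z : linear (@zinj z).
Proof.
case: z => n a x y /=; first by rewrite linearP.
by rewrite scaler0 addr0.
Qed.
HB.instance Definition _ z := GRing.isLinear.Build k (cochain O z) U *:%R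
  (@zinj z) (@zinj_is_linear z).

Lemma zproj_is_linear z : linear (zproj z).
Proof. by case: z => n a x y //=; rewrite scaler0 addr0. Qed.
HB.instance Definition _ z := GRing.isLinear.Build k U (cochain O z) *:%R
  (zproj z) (zproj_is_linear z).

Lemma zinjK z : cancel (@zinj z) (zproj z).
Proof. by case: z => n x /=; [apply: tinjK | rewrite [x]thinmx0]. Qed.

Lemma zinj_inj z : injective (@zinj z).
Proof. exact: can_inj (@zinjK z). Qed.

Lemma zinj_gcast z z' (E : z = z') (x : cochain O z) :
  zinj (gcast E x) = zinj x.
Proof. by case: _ / E. Qed.

Lemma zinj_zd z (x : cochain O z) : zinj (zd M x) = diff (zinj x).
Proof.
case: z x => n x; last by rewrite /= !linear0.
by rewrite [zd _ _]/= zinj_gcast /= diff_tinj.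
Qed.

Definition homz (z : int) (x : U) : Prop := x = zinj (zproj z x).

Lemma homz_zinj z (x : cochain O z) : homz z (zinj x).
Proof. by rewrite /homz zinjK. Qed.

Lemma homz_hom z x : homz z x -> hom `|z|%N x.
Proof. by case: z => // n ->; apply: hom0. Qed.

Lemma homz0 z : homz z 0.
Proof. by rewrite /homz !linear0. Qed.

Lemma zproj_diff z x : gcast (subrK 1 z) (zd M (zproj (z - 1) x)) =
  zproj z (diff x).
Proof.
apply: zinj_inj; rewrite zinj_gcast zinj_zd.
case: z => [[|n]|n] /=; [|rewrite subn1|]; rewrite ?linear0 //.
by rewrite /= diff_tinj.
Qed.

(** The class of the component in degree z. It is additive and blind to casts
   between degrees (cl_gcast), so identities between cochains of the total
   module pass to cohomology. *)
Definition cl (z : int) (x : U) : H z := coclass _ _ (zproj z x).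

Lemma cl_closed z x : diff x = 0 -> is_cocycle (@zd k O M)
    (fun z => GRing.SubmodClosed.clone k _ (@everything k (cochain O z)) _)
    (zproj z x).
Proof.
move=> dx; split=> //; apply: zinj_inj; rewrite zinj_zd linear0.
case: z => n /=; last exact: linear0.
have <- : tinj (diff x n.+1) = diff (tinj (x n)) by rewrite diff_tinj.
by rewrite dx -[(0 : U) n.+1]/(0 : O n.+1) linear0.
Qed.

Lemma cl_eq0 z x : diff x = 0 -> cl z x = 0 ->
  exists2 w, homz (z - 1) w & zinj (zproj z x) = diff w.
Proof.
move=> dx /(class_eq0 (cl_closed z dx))[w _ dw]; exists (zinj w).
  exact: homz_zinj.
by rewrite -zinj_zd -(zinj_gcast (subrK 1 z)) dw.
Qed.

Lemma clP z a x y : diff x = 0 -> diff y = 0 ->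
  cl z (a *: x + y) = a *: cl z x + cl z y.
Proof.
by move=> /(cl_closed z) cx /(cl_closed z) cy; rewrite /cl linearP class_linear.
Qed.

Lemma cl0 z : cl z 0 = 0.
Proof.
have E (V : lmodType k) (v : V) : -1 *: v + v = 0 by rewrite scaleN1r addNr.
have d0 : diff 0 = 0 by apply: linear0.
have <- : -1 *: 0 + 0 = 0 :> U by apply: E.
by apply: etrans (clP z (-1) d0 d0) _; apply: E.
Qed.
Lemma clD z x y : diff x = 0 -> diff y = 0 -> cl z (x + y) = cl z x + cl z y.
Proof. by move=> dx dy; have := clP z 1 dx dy; rewrite !scale1r. Qed.
Lemma clZ z a x : diff x = 0 -> cl z (a *: x) = a *: cl z x.
Proof. by move=> dx; have := clP z a dx (linear0 diff);
  rewrite !addr0 cl0 addr0. Qed.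
Lemma clN z x : diff x = 0 -> cl z (- x) = - cl z x.
Proof. by move=> dx; rewrite -scaleN1r clZ // scaleN1r. Qed.

Lemma clB z x y : diff x = 0 -> diff y = 0 -> cl z (x - y) = cl z x - cl z y.
Proof.
by move=> dx dy; rewrite -(clN z dy) -clD // linearN /= dy oppr0.
Qed.

Lemma cl_gcast z z' (E : z = z') x : gcast E (cl z x) = cl z' x.
Proof. by case: _ / E. Qed.

Lemma cl_diff z w : diff (diff w) = 0 -> cl z (diff w) = 0.
Proof.
move=> ddw; apply/class_eq0; first exact: cl_closed.
by exists (zproj (z - 1) w); rewrite ?zproj_diff.
Qed.

Lemma cl_eq z x y w : diff y = 0 -> diff x = 0 -> x = y + diff w ->
  cl z x = cl z y.
Proof.
move=> dy dx Exy; have dw : diff (diff w) = 0.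
  by move: dx; rewrite Exy linearD /= dy add0r.
by rewrite Exy clD // cl_diff // addr0.
Qed.

Local Opaque operad_cohomology.

Lemma cl_inj z x y : homz z x -> homz z y -> diff x = 0 -> diff y = 0 ->
  cl z x = cl z y -> exists2 w, homz (z - 1) w & x = y + diff w.
Proof.
move=> hx hy dx dy Exy; have dxy : diff (x - y) = 0 by rewrite linearB /=
  dx dy subr0.
have /(cl_eq0 dxy)[w hw dw] : cl z (x - y) = 0.
  apply: etrans (clB z dx dy) _.
  by rewrite Exy; apply: (@subrr (H z)).
exists w => //; move: dw; rewrite !linearB /= -hx -hy => <-.
by rewrite addrC subrK.
Qed.

Local Transparent operad_cohomology.

Lemma cl_surj z (a : H z) : exists x, [/\ homz z x, diff x = 0 & cl z x = a].
Proof.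
have [x [_ dx] <-] := class_surj a.
exists (zinj x); split; first exact: homz_zinj.
  by rewrite -zinj_zd dx linear0.
by rewrite /cl zinjK.
Qed.

Lemma has_classP n (f : O n) z (a : H z) :
  has_class f a <-> [/\ n%:Z = z, diff (tinj f) = 0 & cl z (tinj f) = a].
Proof.
split=> [/representsP[E [[_ df] <-]]|[E df <-]].
  split=> //; first by rewrite -[tinj f]/(zinj (f :
    cochain O n%:Z)) -zinj_zd df linear0.
  by case: _ / E; rewrite /cl -[tinj f]/(zinj (f : cochain O n%:Z)) zinjK.
apply/representsP; exists E; split.
  by have := cl_closed n%:Z df; rewrite -[tinj f]/(zinj (f :
    cochain O n%:Z)) zinjK.
by case: _ / E; rewrite /cl -[tinj f]/(zinj (f : cochain O n%:Z)) zinjK.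
Qed.

End GradedCochains.

(** * Operations on cochains up to coboundary *)

Section GradedOperations.
Variables (k : comPzRingType) (O : operad k) (M : multiplication O).
Variable (T : cyclic_structure O).
Hypothesis tau_muT : op_tau T 2 (op_mu M) = op_mu M.
Local Notation U := (total O).
Local Notation diff := (diff M).
Local Notation cup := (cup M).
Local Notation connes := (connes M T).
Local Hint Resolve hom_mu hom_e hom_tid hom0 hom_face hom_diff : core.

Lemma homz_eq z z' (x : U) : homz z x -> z = z' -> homz z' x.
Proof. by move=> hx <-. Qed.

Lemma homz_neg n (x : U) : homz (Negz n) x -> x = 0.
Proof. by []. Qed.

Definition cohomologous (x y : U) : Prop := exists w, x = y + diff w.

Lemma cl_cohomologous z x y : diff x = 0 -> diff y = 0 -> cohomologous x y ->
  cl M z x = cl M z y.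
Proof. by move=> dx dy [w]; apply: cl_eq. Qed.

(** The Connes operator on all arities at once; cBE identifies it on
   homogeneous elements. *)
Definition cB (x : U) : U := fun n => connesB M T (x n.+1).

Lemma cB_is_linear : linear cB.
Proof.
move=> a x y; apply: total_ext => n.
by rewrite -[LHS]/(connesB M T (a *: x n.+1 + y n.+1)) linearP.
Qed.
HB.instance Definition _ := GRing.isLinear.Build k U U *:%R cB cB_is_linear.

Lemma cBE q x : hom q x -> cB x = connes q x.
Proof.
move=> ->; move: (x q) => {x} f; case: q f => [|q] f.
  by rewrite connes0; apply: total_ext => n; rewrite /cB tinj_neq // linear0.
rewrite -tinj_connesB; apply: total_ext => n; rewrite /cB.
have [<-|ne] := eqVneq q n; first by rewrite !tinjK.
by rewrite !tinj_neq // linear0.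
Qed.

Lemma hom_cB q x : hom q x -> hom q.-1 (cB x).
Proof. by move=> hx; rewrite (cBE hx); apply: hom_connes. Qed.

Lemma diff_cB q x : hom q x -> diff (cB x) = - cB (diff x).
Proof.
by move=> hx; rewrite (cBE hx) (cBE (hom_diff M hx)) (diff_connes tau_muT).
Qed.

Lemma zinj_zB z (x : cochain O z) : zinj (zB M T x) = cB (zinj x).
Proof.
case: z x => [[|n]|n] x; rewrite ?[zB _ _ _]/= ?linear0 //.
- by rewrite (cBE (hom_tinj x)) connes0.
- by rewrite zinj_gcast /= (cBE (hom_tinj x)) tinj_connesB.
Qed.

Lemma homz_cB z x : homz z x -> homz (z - 1) (cB x).
Proof. by move=> ->; rewrite -zinj_zB; apply: homz_zinj. Qed.

Lemma homz_cup i j x y : homz i x -> homz j y -> homz (i + j) (cup x y).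
Proof.
case: i => m hx; last by rewrite (homz_neg hx) cup0l => _; apply: homz0.
case: j => n hy; last by rewrite (homz_neg hy) cup0r; apply: homz0.
exact: (hom_cup M hx hy).
Qed.

(** The indices have the parity of the degrees i - 1 and j - 1, and are large
   enough as bounds. *)
Definition zbracket (i j : int) (x y : U) : U := bracket `|i|.+1 `|j|.+1 x y.

Lemma bracket0l a b (y : U) : bracket a b 0 y = 0.
Proof. by rewrite /bracket pcirc0l pcirc0r scaler0 subr0. Qed.
Lemma bracket0r a b (x : U) : bracket a b x 0 = 0.
Proof. by rewrite /bracket pcirc0l pcirc0r scaler0 subr0. Qed.

Lemma pcirc_hom0 a (x y : U) : hom 0 x -> hom 0 y -> pcirc a x y = 0.
Proof. by move=> hx hy; rewrite (pcirc_widen hx hy) // pcirc_0. Qed.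

Lemma bracket_hom0 a b (x y : U) : hom 0 x -> hom 0 y -> bracket a b x y = 0.
Proof. by move=> hx hy; rewrite /bracket !pcirc_hom0 // scaler0 subr0. Qed.

Lemma homz_bracket a b i j (x y : U) : homz i x -> homz j y ->
  homz (i + j - 1) (bracket a b x y).
Proof.
case: i => m hx; last by rewrite (homz_neg hx) bracket0l => _; apply: homz0.
case: j => n hy; last by rewrite (homz_neg hy) bracket0r; apply: homz0.
have [mn0|mn_gt0] := posnP (m + n).
  rewrite bracket_hom0; [exact: homz0|rewrite (_ :
    0%N = m)|rewrite (_ : 0%N = n)];
    by [|lia].
have -> : (m%:Z + n%:Z - 1 = (m + n).-1%:Z)%R by lia.
apply: homB; first by apply/homZ/(hom_pcirc _ hx hy).
by rewrite addnC; apply: (hom_pcirc _ hy hx).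
Qed.

Lemma bracket_ext a b a' b' m n (x y : U) : hom m x -> hom n y ->
    (m <= a)%N -> (m <= a')%N -> (n <= b)%N -> (n <= b')%N ->
    odd a = odd a' -> odd b = odd b' ->
  bracket a b x y = bracket a' b' x y :> U.
Proof.
move=> hx hy ma ma' nb nb' oa ob; rewrite /bracket.
rewrite !(pcirc_widen hx hy) // !(pcirc_widen hy hx) // !signZ !oddM.
by rewrite oa ob.
Qed.

(** As bounds, the successor of j + l - 1 and the number j + l + 2 have the
   same parity and are large enough, so they define the same bracket. For j =
   l = 0 the degree j + l - 1 is negative, but then the inner bracket is zero.
 *)
Lemma zbracket_nestr i j l (x y z : U) : homz i x -> homz j y -> homz l z ->
  zbracket i (j + l - 1) x (zbracket j l y z) =
  bracket `|i|.+1 (`|j|.+1 + `|l|.+1) x (zbracket j l y z).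
Proof.
move=> hx hy hz; have hyz := homz_bracket `|j|.+1 `|l|.+1 hy hz.
case: j hy hyz => n hy; last by rewrite /zbracket (homz_neg hy) bracket0l
  !bracket0r.
case: l hz => p hz hyz; last by rewrite /zbracket (homz_neg hz) !bracket0r.
have [np0|np_gt0] := posnP (n + p).
  suff -> : zbracket n p y z = 0 by rewrite /zbracket !bracket0r.
  by apply: bracket_hom0; [rewrite (_ : 0%N = n)|rewrite (_ : 0%N = p)] => //;
    lia.
have E : (n%:Z + p%:Z - 1 = (n + p).-1%:Z)%R by lia.
move: hyz; rewrite E => hyz.
rewrite {1}/zbracket; apply: (bracket_ext (homz_hom hx) hyz) => //=; try lia.
Qed.

Lemma zbracketC i j x y : zbracket i j x y =
  - ((-1) ^+ (`|i|.+1 * `|j|.+1) *: zbracket j i y x).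
Proof. exact: bracketC. Qed.

Lemma zbracket_nestl i j l (x y z : U) : homz i x -> homz j y -> homz l z ->
  zbracket (i + j - 1) l (zbracket i j x y) z =
  bracket (`|i|.+1 + `|j|.+1) `|l|.+1 (zbracket i j x y) z.
Proof.
move=> hx hy hz; have hxy := homz_bracket `|i|.+1 `|j|.+1 hx hy.
case: i hx hxy => m hx; last by rewrite /zbracket (homz_neg hx) bracket0l
  !bracket0l.
case: j hy => n hy hxy; last by rewrite /zbracket (homz_neg hy) !bracket0r
  !bracket0l.
have [mn0|mn_gt0] := posnP (m + n).
  suff -> : zbracket m n x y = 0 by rewrite /zbracket !bracket0l.
  by apply: bracket_hom0; [rewrite (_ : 0%N = m)|rewrite (_ : 0%N = n)] => //;
    lia.
have E : (m%:Z + n%:Z - 1 = (m + n).-1%:Z)%R by lia.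
move: hxy; rewrite E => hxy.
rewrite {1}/zbracket; apply: (bracket_ext hxy (homz_hom hz)) => //=; try lia.
Qed.

Lemma diff_bracket m n x y : hom m x -> hom n y -> diff x = 0 -> diff y = 0 ->
  diff (bracket m.+1 n.+1 x y) = 0.
Proof.
move=> hx hy dx dy; rewrite /bracket (pcirc_widen hx hy (leqnSn m)).
rewrite (pcirc_widen hy hx (leqnSn n)) linearB linearZ /=.
rewrite (diff_circ M hx hy) (diff_circ M hy hx) dx dy !pcirc0l !pcirc0r.
rewrite !scaler0 !add0r [(n * m)%N]mulnC; signs.
Qed.

(** By diff_circ both circle products with a coboundary are coboundaries up to
   cup products, which cancel in the bracket. *)
Lemma bracket_diffl m n w y : hom m w -> hom n y -> diff y = 0 ->
  cohomologous (bracket m.+2 n.+1 (diff w) y) 0.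
Proof.
move=> hw hy dy; have hdw := hom_diff M hw.
exists ((-1) ^+ (m.+2 * n.+1 + n.+1) *: pcirc m w y - pcirc n y w).
rewrite add0r /bracket (pcirc_widen hdw hy (leqnSn m.+1)) (pcirc_widen hy hdw
  (leqnSn n)).
rewrite linearB linearZ /= (diff_circ M hw hy) (diff_circ M hy hw) dy !pcirc0l
  !pcirc0r.
rewrite !scaler0 !add0r addr0 [(n * m)%N]mulnC; signs.
Qed.

Lemma homz_pred i (w : U) : homz (i - 1) w ->
  w = 0 \/ exists2 m, i = m.+1%:Z & hom m w.
Proof.
case: i => [[|m]|m]; [by left| |by left].
have -> : (m.+1%:Z - 1 = m%:Z)%R by lia.
by right; exists m.
Qed.

Lemma cohomologous_refl x : cohomologous x x.
Proof. by exists 0; rewrite linear0 addr0. Qed.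
Lemma cohomologous_trans y x z : cohomologous x y -> cohomologous y z ->
  cohomologous x z.
Proof. by move=> [v ->] [w ->]; exists (w + v); rewrite linearD addrA. Qed.
Lemma cohomologousZ a x y : cohomologous x y -> cohomologous (a *: x) (a *: y).
Proof. by move=> [v ->]; exists (a *: v); rewrite linearZ scalerDr. Qed.

Lemma zbracket_cohomologousl i j x w y : homz (i - 1) w -> homz j y ->
  diff y = 0 ->
  cohomologous (zbracket i j (x + diff w) y) (zbracket i j x y).
Proof.
move=> hw hy dy; have /homz_pred[->|[m -> hmw]] := hw.
  by rewrite linear0 addr0; apply: cohomologous_refl.
have [v Ev] := bracket_diffl hmw (homz_hom hy) dy; exists v.
rewrite add0r in Ev; rewrite -Ev /zbracket.
have := bracket_linl m.+2 `|j|.+1 y 1 x (diff w).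
by rewrite !scale1r.
Qed.

Lemma zbracket_cohomologousr i j x y w : homz (j - 1) w -> homz i x ->
  diff x = 0 ->
  cohomologous (zbracket i j x (y + diff w)) (zbracket i j x y).
Proof.
move=> hw hx dx; rewrite zbracketC [zbracket i j x y]zbracketC -!scaleNr.
exact/cohomologousZ/zbracket_cohomologousl.
Qed.

Lemma cup_cohomologousl i j x w y : homz i w -> homz j y -> diff y = 0 ->
  cohomologous (cup (x + diff w) y) (cup x y).
Proof.
move=> /homz_hom hw /homz_hom hy dy; exists (cup w y).
by rewrite cupDl (diff_cup M hw hy) dy linear0 scaler0 addr0.
Qed.

Lemma cup_cohomologousr i j x y w : homz i x -> homz j w -> diff x = 0 ->
  cohomologous (cup x (y + diff w)) (cup x y).
Proof.
move=> /homz_hom hx /homz_hom hw dx; exists ((-1) ^+ `|i| *: cup x w).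
rewrite cupDr linearZ /= (diff_cup M hx hw) dx cup0l add0r.
by rewrite scalerA -exprD addnn signZ odd_double.
Qed.

Lemma bracket_cup r m n h f g : hom r h -> hom m f -> hom n g ->
    diff h = 0 -> diff f = 0 -> diff g = 0 ->
  cohomologous (bracket r.+1 (m + n).+1 h (cup f g))
    (cup (bracket r.+1 m.+1 h f) g
     + (-1) ^+ (m * r.+1) *: cup f (bracket r.+1 n.+1 h g)).
Proof.
move=> hh hf hg dh df dg; have hfg := hom_cup M hf hg.
exists ((-1) ^+ (r.+1 * (m + n).+1 + m.+1) *: brace r h f g).
rewrite linearZ /= (diff_brace hh hf hg dh df dg) /bracket.
rewrite (pcirc_widen hh hfg (leqnSn r)) (pcirc_widen hfg hh (leqnSn _)).
rewrite (pcirc_widen hh hf (leqnSn r)) (pcirc_widen hf hh (leqnSn m)).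
rewrite (pcirc_widen hh hg (leqnSn r)) (pcirc_widen hg hh (leqnSn n)).
rewrite (pcirc_cup M hh hf hg) !(cupDl, cupDr, cupNl, cupNr, cupZl, cupZr).
signs.
Qed.

End GradedOperations.

(** * The Batalin-Vilkovisky algebra on cohomology *)

Section BatalinVilkovisky.
Variables (k : comPzRingType) (O : operad k) (M : multiplication O).
Variable (T : cyclic_structure O).
Hypothesis tau_muT : op_tau T 2 (op_mu M) = op_mu M.
Local Notation U := (total O).
Local Notation e := (te M).
Local Notation diff := (diff M).
Local Notation cup := (cup M).
Local Notation cB := (cB M T).
Local Notation cl := (cl M).
Local Notation cohomologous := (cohomologous M).
Local Notation H := (operad_cohomology M).
Local Hint Resolve hom_mu hom_e hom_tid hom0 hom_face hom_diff : core.

Lemma odd_abszD (x y : int) : odd (absz (x + y)) =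
  odd (absz x) (+) odd (absz y).
Proof. by lia. Qed.

Definition zcocycle (z : int) (x : U) : Prop := homz z x /\ diff x = 0.

Lemma zcocycle_homz z x : zcocycle z x -> homz z x. Proof. by case. Qed.
Lemma zcocycle_hom z x : zcocycle z x -> hom `|z|%N x.
Proof. by case=> /homz_hom. Qed.
Lemma zcocycle_diff z x : zcocycle z x -> diff x = 0. Proof. by case. Qed.

Lemma homzP z a (x y : U) : homz z x -> homz z y -> homz z (a *: x + y).
Proof. by move=> hx hy; rewrite /homz !linearP /= -hx -hy. Qed.

Lemma zcocycleP z a x y : zcocycle z x -> zcocycle z y ->
  zcocycle z (a *: x + y).
Proof.
move=> [hx dx] [hy dy]; split; first exact: homzP.
by rewrite linearP /= dx dy scaler0 addr0.
Qed.
Lemma zcocycle0 z : zcocycle z 0.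
Proof. by split; [apply: homz0 | apply: linear0]. Qed.
Lemma zcocycleD z x y : zcocycle z x -> zcocycle z y -> zcocycle z (x + y).
Proof. by move=> cx cy; rewrite -[x]scale1r; apply: zcocycleP. Qed.
Lemma zcocycleZ z a x : zcocycle z x -> zcocycle z (a *: x).
Proof. by move=> cx; rewrite -[_ *: _]addr0; apply: zcocycleP => //; apply:
  zcocycle0. Qed.
Lemma zcocycleN z x : zcocycle z x -> zcocycle z (- x).
Proof. by move=> cx; rewrite -scaleN1r; apply: zcocycleZ. Qed.
Lemma zcocycle_eq z z' x : zcocycle z x -> z = z' -> zcocycle z' x.
Proof. by move=> cx <-. Qed.

Lemma zcocycle_cup i j x y : zcocycle i x -> zcocycle j y ->
  zcocycle (i + j) (cup x y).
Proof.
move=> [hx dx] [hy dy]; split; first exact: homz_cup.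
by rewrite (diff_cup M (homz_hom hx) (homz_hom hy)) dx dy cup0l cup0r scaler0
  addr0.
Qed.

Lemma zcocycle_bracket i j x y : zcocycle i x -> zcocycle j y ->
  zcocycle (i + j - 1) (zbracket i j x y).
Proof.
move=> [hx dx] [hy dy]; split; first exact: homz_bracket.
exact: (diff_bracket (homz_hom hx) (homz_hom hy)).
Qed.

Lemma zcocycle_cB i x : zcocycle i x -> zcocycle (i - 1) (cB x).
Proof.
move=> [hx dx]; split; first exact: homz_cB.
by rewrite (diff_cB tau_muT (homz_hom hx)) dx linear0 oppr0.
Qed.

(** The Leibniz rule for e = e cup e gives de = de + de. *)
Lemma zcocycle_unit : zcocycle 0 e.
Proof.
split; first exact: hom_tinj.
have := diff_cup M (hom_e M) (hom_e M).
rewrite (cup1l M (hom_e M)) (cup1l M (hom_diff M (hom_e M))) expr0 scale1r.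
rewrite (cup1r M (hom_diff M (hom_e M))).
by move/eqP; rewrite -[X in X == _]addr0 (inj_eq (addrI _)) eq_sym => /eqP.
Qed.

Lemma cocycle_surj z (a : H z) : exists2 x, zcocycle z x & cl z x = a.
Proof. by have [x [hx dx xa]] := cl_surj a; exists x. Qed.

Local Opaque operad_cohomology.

(** A chosen homogeneous cocycle in a class, used to define the operations on
   cohomology; the lemmas hcup_cl, hbracket_cl and hB_cl compute them on any
   representative. *)
Definition rep z (a : H z) : U := sval (cid2 (cocycle_surj a)).

Lemma rep_zcocycle z (a : H z) : zcocycle z (rep a).
Proof. by rewrite /rep; case: cid2. Qed.
Lemma repK z (a : H z) : cl z (rep a) = a.
Proof. by rewrite /rep; case: cid2. Qed.

Lemma rep_cl z x : zcocycle z x ->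
  exists2 w, homz (z - 1) w & rep (cl z x) = x + diff w.
Proof.
move=> [hx dx]; have [hr dr] := rep_zcocycle (cl z x).
by apply: (cl_inj hr hx dr dx); apply: repK.
Qed.

Definition hcup i j (a : H i) (b : H j) : H (i + j) :=
  cl (i + j) (cup (rep a) (rep b)).
Definition hbracket i j (a : H i) (b : H j) : H (i + j - 1) :=
  cl (i + j - 1) (zbracket i j (rep a) (rep b)).
Definition hB i (a : H i) : H (i - 1) := cl (i - 1) (cB (rep a)).

Lemma zcocycle_cl_eq z x y : zcocycle z x -> zcocycle z y -> cohomologous x y ->
  cl z x = cl z y.
Proof. by move=> [_ dx] [_ dy]; apply: cl_cohomologous. Qed.

Lemma hcup_cl i j x y : zcocycle i x -> zcocycle j y ->
  hcup (cl i x) (cl j y) = cl (i + j) (cup x y).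
Proof.
move=> cx cy; have cr := rep_zcocycle (cl i x); have cs :=
  rep_zcocycle (cl j y).
have [v hv Ev] := rep_cl cx; have [w hw Ew] := rep_cl cy.
apply: zcocycle_cl_eq; [exact: zcocycle_cup | exact: zcocycle_cup|].
rewrite Ev; apply: cohomologous_trans; first exact:
  (cup_cohomologousl _ hv (zcocycle_homz cs) (zcocycle_diff cs)).
by rewrite Ew; apply: cup_cohomologousr (zcocycle_homz cx) hw (zcocycle_diff
  cx).
Qed.

Lemma hbracket_cl i j x y : zcocycle i x -> zcocycle j y ->
  hbracket (cl i x) (cl j y) = cl (i + j - 1) (zbracket i j x y).
Proof.
move=> cx cy; have cr := rep_zcocycle (cl i x); have cs :=
  rep_zcocycle (cl j y).
have [v hv Ev] := rep_cl cx; have [w hw Ew] := rep_cl cy.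
apply: zcocycle_cl_eq; [exact: zcocycle_bracket | exact: zcocycle_bracket|].
rewrite Ev.
apply: cohomologous_trans; first exact:
  (zbracket_cohomologousl _ hv (zcocycle_homz cs) (zcocycle_diff cs)).
by rewrite Ew; apply: zbracket_cohomologousr hw (zcocycle_homz cx)
  (zcocycle_diff cx).
Qed.

Lemma hB_cl i x : zcocycle i x -> hB (cl i x) = cl (i - 1) (cB x).
Proof.
move=> cx; have cr := rep_zcocycle (cl i x).
have [v hv Ev] := rep_cl cx; apply: zcocycle_cl_eq; [exact: zcocycle_cB | exact:
  zcocycle_cB|].
exists (- cB v); rewrite Ev linearD linearN /= (diff_cB tau_muT (homz_hom hv)).
by rewrite opprK.
Qed.

Lemma cl_lin z a x y : zcocycle z x -> zcocycle z y ->
  cl z (a *: x + y) = a *: cl z x + cl z y.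
Proof. by move=> [_ dx] [_ dy]; apply: clP. Qed.
Lemma cl_add z x y : zcocycle z x -> zcocycle z y ->
  cl z (x + y) = cl z x + cl z y.
Proof. by move=> [_ dx] [_ dy]; apply: clD. Qed.
Lemma cl_scale z a x : zcocycle z x -> cl z (a *: x) = a *: cl z x.
Proof. by move=> [_ dx]; apply: clZ. Qed.
Lemma cl_opp z x : zcocycle z x -> cl z (- x) = - cl z x.
Proof. by move=> [_ dx]; apply: clN. Qed.

Lemma hcup_linl i j (b : H j) : linear (fun a : H i => hcup a b).
Proof.
move=> s a a'; have [x cx <-] := cocycle_surj a; have [x' cx' <-] :=
  cocycle_surj a'.
have [y cy <-] := cocycle_surj b.
rewrite -(cl_lin s cx cx') !hcup_cl //; last exact: zcocycleP.
by rewrite cupDl cupZl cl_lin //; apply: zcocycle_cup.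
Qed.

Lemma hcup_linr i j (a : H i) : linear (fun b : H j => hcup a b).
Proof.
move=> s b b'; have [y cy <-] := cocycle_surj b; have [y' cy' <-] :=
  cocycle_surj b'.
have [x cx <-] := cocycle_surj a.
rewrite -(cl_lin s cy cy') !hcup_cl //; last exact: zcocycleP.
by rewrite cupDr cupZr cl_lin //; apply: zcocycle_cup.
Qed.

Lemma hbracket_linl i j (b : H j) : linear (fun a : H i => hbracket a b).
Proof.
move=> s a a'; have [x cx <-] := cocycle_surj a; have [x' cx' <-] :=
  cocycle_surj a'.
have [y cy <-] := cocycle_surj b.
rewrite -(cl_lin s cx cx') !hbracket_cl //; last exact: zcocycleP.
by rewrite /zbracket bracket_linl cl_lin //; apply: zcocycle_bracket.
Qed.

Lemma hbracket_linr i j (a : H i) : linear (fun b : H j => hbracket a b).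
Proof.
move=> s b b'; have [y cy <-] := cocycle_surj b; have [y' cy' <-] :=
  cocycle_surj b'.
have [x cx <-] := cocycle_surj a.
rewrite -(cl_lin s cy cy') !hbracket_cl //; last exact: zcocycleP.
by rewrite /zbracket bracket_linr cl_lin //; apply: zcocycle_bracket.
Qed.

Lemma hB_linear i : linear (@hB i).
Proof.
move=> s a a'; have [x cx <-] := cocycle_surj a; have [x' cx' <-] :=
  cocycle_surj a'.
rewrite -(cl_lin s cx cx') !hB_cl //; last exact: zcocycleP.
by rewrite linearP cl_lin //; apply: zcocycle_cB.
Qed.

HB.instance Definition _ i := GRing.isLinear.Build k (H i) (H (i - 1)) *:%R
  (@hB i) (@hB_linear i).
Definition hB_lin i : {linear H i -> H (i - 1)} := @hB i.

Lemma hcupA i j l (a : H i) (b : H j) (c : H l) :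
  gcast (addrA i j l) (hcup a (hcup b c)) = hcup (hcup a b) c.
Proof.
have [x cx <-] := cocycle_surj a; have [y cy <-] := cocycle_surj b;
  have [z cz <-] := cocycle_surj c.
rewrite !hcup_cl //; try exact: zcocycle_cup.
by rewrite cl_gcast (cupA M (zcocycle_hom cx) (zcocycle_hom cy) (zcocycle_hom
  cz)).
Qed.

Lemma hcup1l i (a : H i) : gcast (add0r i) (hcup (cl 0 e) a) = a.
Proof.
have [x cx <-] := cocycle_surj a; rewrite hcup_cl //; last exact: zcocycle_unit.
by rewrite cl_gcast (cup1l M (zcocycle_hom cx)).
Qed.

Lemma hcup1r i (a : H i) : gcast (addr0 i) (hcup a (cl 0 e)) = a.
Proof.
have [x cx <-] := cocycle_surj a; rewrite hcup_cl //; last exact: zcocycle_unit.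
by rewrite cl_gcast (cup1r M (zcocycle_hom cx)).
Qed.

Lemma hcupC i j (a : H i) (b : H j) :
  hcup a b = gsign k (i * j) *: gcast (addrC j i) (hcup b a).
Proof.
have [x cx <-] := cocycle_surj a; have [y cy <-] := cocycle_surj b.
rewrite !hcup_cl // cl_gcast -cl_scale; last first.
  by rewrite addrC; apply: zcocycle_cup.
apply: zcocycle_cl_eq; [exact: zcocycle_cup|by apply/zcocycleZ; rewrite addrC;
  apply: zcocycle_cup|].
exists ((-1) ^+ `|i| *: pcirc `|j| y x); rewrite /gsign abszM mulnC.
exact: cup_comm (zcocycle_hom cy) (zcocycle_hom cx) (zcocycle_diff cy)
  (zcocycle_diff cx).
Qed.

Lemma hbracketC i j (a : H i) (b : H j) :
  hbracket a b = - (gsign k ((i - 1) * (j - 1)) *: gcast (deg_brC i j) (hbracket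
    b a)).
Proof.
have [x cx <-] := cocycle_surj a; have [y cy <-] := cocycle_surj b.
have cyx : zcocycle (i + j - 1) (zbracket j i y x).
  by apply: zcocycle_eq (zcocycle_bracket cy cx) _; apply: deg_brC.
rewrite !hbracket_cl // cl_gcast -cl_scale // -cl_opp; last exact: zcocycleZ.
congr (cl _ _); rewrite zbracketC !signZ abszM !oddM !odd_abszD /=.
by case: (odd `|i|); case: (odd `|j|).
Qed.

Lemma hjacobi i j l (a : H i) (b : H j) (c : H l) :
  hbracket a (hbracket b c) =
    gcast (deg_jacobi1 i j l) (hbracket (hbracket a b) c) +
    gsign k ((i - 1) * (j - 1)) *:
      gcast (deg_jacobi2 i j l) (hbracket b (hbracket a c)).
Proof.
have [x cx <-] := cocycle_surj a; have [y cy <-] := cocycle_surj b;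
  have [z cz <-] := cocycle_surj c.
have cxy := zcocycle_bracket cx cy; have cyz := zcocycle_bracket cy cz;
  have cxz := zcocycle_bracket cx cz.
have c1 : zcocycle (i + (j + l - 1) - 1) (zbracket (i
  + j - 1) l (zbracket i j x y) z).
  by apply: zcocycle_eq (zcocycle_bracket cxy cz) _; apply: deg_jacobi1.
have c2 : zcocycle (i + (j + l - 1) - 1) (zbracket j (i
  + l - 1) y (zbracket i l x z)).
  by apply: zcocycle_eq (zcocycle_bracket cy cxz) _; apply: deg_jacobi2.
rewrite !hbracket_cl // !cl_gcast -cl_scale // -cl_add //;
  last exact: zcocycleZ.
congr (cl _ _); rewrite (zbracket_nestr (zcocycle_homz cx) (zcocycle_homz cy)
  (zcocycle_homz cz)).
rewrite (zbracket_nestl (zcocycle_homz cx) (zcocycle_homz cy) (zcocycle_homz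
  cz)).
rewrite (zbracket_nestr (zcocycle_homz cy) (zcocycle_homz cx) (zcocycle_homz
  cz)).
rewrite /zbracket (bracket_jacobi (zcocycle_hom cx) (zcocycle_hom cy)
  (zcocycle_hom cz)).
congr (_ + _); rewrite !signZ abszM !oddM !odd_abszD /=.
by case: (odd `|i|); case: (odd `|j|).
Qed.

Lemma hpoisson i j l (a : H i) (b : H j) (c : H l) :
  hbracket a (hcup b c) =
    gcast (deg_poisson1 i j l) (hcup (hbracket a b) c) +
    gsign k (j * (i - 1)) *:
      gcast (deg_poisson2 i j l) (hcup b (hbracket a c)).
Proof.
have [x cx <-] := cocycle_surj a; have [y cy <-] := cocycle_surj b;
  have [z cz <-] := cocycle_surj c.
have cxy := zcocycle_bracket cx cy; have cyz := zcocycle_cup cy cz; have cxz :=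
  zcocycle_bracket cx cz.
have c1 : zcocycle (i + (j + l) - 1) (cup (zbracket i j x y) z).
  by apply: zcocycle_eq (zcocycle_cup cxy cz) _; apply: deg_poisson1.
have c2 : zcocycle (i + (j + l) - 1) (cup y (zbracket i l x z)).
  by apply: zcocycle_eq (zcocycle_cup cy cxz) _; apply: deg_poisson2.
rewrite (hcup_cl cy cz) (hbracket_cl cx cyz) (hbracket_cl cx cy) (hbracket_cl cx
  cz).
rewrite (hcup_cl cxy cz) (hcup_cl cy cxz) !cl_gcast -(cl_scale _ c2).
rewrite -(cl_add c1 (zcocycleZ _ c2)).
apply: zcocycle_cl_eq; [exact: zcocycle_bracket|by apply: zcocycleD => //;
  apply: zcocycleZ|].
have := bracket_cup (zcocycle_hom cx) (zcocycle_hom cy) (zcocycle_hom cz)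
  (zcocycle_diff cx) (zcocycle_diff cy)
  (zcocycle_diff cz).
have -> : bracket `|i|.+1 (`|j| + `|l|).+1 x (cup y z) = zbracket i (j
  + l) x (cup y z).
  case: (j) cy => m [hy _]; last by rewrite (homz_neg hy) cup0l /zbracket
    !bracket0r.
  case: (l) cz => n [hz _]; last by rewrite (homz_neg hz) cup0r /zbracket
    !bracket0r.
  by [].
congr (cohomologous _ (_ + _)); rewrite !signZ abszM !oddM !odd_abszD /=.
by case: (odd `|i|); case: (odd `|j|).
Qed.

(** The vanishing of B B and the inclusion into the total complex both concern
   normalized cochains, hence the need for such representatives. *)
Lemma surj_nondeg z (a : H z) :
  exists x, [/\ zcocycle z x, nondeg M `|z| x & cl z x = a].
Proof.
have [x cx <-] := cocycle_surj a; case: z {a} x cx => [[|n]|n] x cx;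
  try by exists x.
  have [hx dx] := cx; have hx' : x = tinj (x n.+1) by [].
  have [|w nw] := normalize (M := M) (f := x n.+1).
    apply/normalizedP => j _; rewrite -diff_tinj -hx' dx; exact: scomp0l.
  have hw := diff_diff M (hom_tinj w).
  have cx' : zcocycle n.+1%:Z (x - diff (tinj w)).
    split; last by rewrite linearB /= dx hw subr0.
    by apply: homB => //; apply: hom_diff; apply: hom_tinj.
  exists (x - diff (tinj w)); split=> //.
    by rewrite [X in X - _]hx' diff_tinj -linearB; apply/normalizedP.
  by apply: zcocycle_cl_eq cx' cx _; exists (- tinj w); rewrite linearN.
exists 0; split; [exact: zcocycle0 | by move=> j _; apply: scomp0l |].
by rewrite (homz_neg cx.1).
Qed.

Lemma nondeg_bounding z w : homz (z - 1) w -> nondeg M `|z| (diff w) ->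
  exists w', [/\ homz (z - 1) w', nondeg M `|(z - 1)%R| w' & diff w' = diff w].
Proof.
case: z => [[|[|n]]|n] hw nw.
- by exists 0; rewrite (homz_neg hw); split=> // j _; apply: scomp0l.
- by exists w; split.
- have hw' : w = tinj (w n.+1) by [].
  have [|v nv] := normalize (M := M) (f := w n.+1).
    by apply/normalizedP; rewrite -diff_tinj -hw'.
  have hv := diff_diff M (hom_tinj v).
  exists (w - diff (tinj v)); split.
  + by apply: homB => //; apply: hom_diff; apply: hom_tinj.
  + rewrite (_ : absz (n.+2%:Z - 1) = n.+1); last by lia.
    by rewrite {1}hw' diff_tinj -linearB; apply/normalizedP.
  + by rewrite linearB /= hv subr0.
by exists 0; rewrite (homz_neg hw); split=> // j _; apply: scomp0l.
Qed.

Lemma cB_nondeg z x : homz z x -> nondeg M `|z| x ->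
  nondeg M `|(z - 1)%R| (cB x).
Proof.
move=> hx nx; have E := cBE M T (homz_hom hx); rewrite E.
have := connes_nondeg T (homz_hom hx) nx.
case: z hx nx E => [[|n]|n] hx nx E //.
- by rewrite connes0 => _ j _; apply: scomp0l.
- by rewrite (_ : absz (n.+1%:Z - 1) = n) //; lia.
- by rewrite -E (homz_neg hx) linear0 => _ j _; apply: scomp0l.
Qed.

Lemma cBB z x : homz z x -> nondeg M `|z| x -> cB (cB x) = 0.
Proof.
move=> /homz_hom hx nx.
rewrite (cBE M T (hom_cB M T hx)) (cBE M T hx).
exact: connes_connes.
Qed.

Lemma hBB i (a : H i) : hB (hB a) = 0.
Proof.
have [x [cx nx <-]] := surj_nondeg a.
rewrite (hB_cl cx) (hB_cl (zcocycle_cB cx)) (cBB (zcocycle_homz cx) nx).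
exact: cl0.
Qed.

Lemma hbv i j (a : H i) (b : H j) :
  hbracket a b = gsign k i *: (hB (hcup a b)
    - gcast (deg_bv1 i j) (hcup (hB a) b)
    - gsign k i *: gcast (deg_bv2 i j) (hcup a (hB b))).
Proof.
have [x cx <-] := cocycle_surj a; have [y cy <-] := cocycle_surj b.
have cxy := zcocycle_cup cx cy.
have c1 : zcocycle (i + j - 1) (cup (cB x) y).
  by apply: zcocycle_eq (zcocycle_cup (zcocycle_cB cx) cy) _; apply: deg_bv1.
have c2 : zcocycle (i + j - 1) (cup x (cB y)).
  by apply: zcocycle_eq (zcocycle_cup cx (zcocycle_cB cy)) _; apply: deg_bv2.
have c0 := zcocycle_cB cxy; have c3 := zcocycleZ (gsign k i) c2.
have c4 : zcocycle (i + j - 1) (cB (cup x y) - cup (cB x) y).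
  by apply: zcocycleD => //; apply: zcocycleN.
have c5 : zcocycle (i + j - 1) (cB (cup x y) - cup (cB x) y - gsign k i *: cup x
  (cB y)).
  by apply: zcocycleD => //; apply: zcocycleN.
rewrite (hbracket_cl cx cy) (hcup_cl cx cy) (hB_cl cxy) (hB_cl cx) (hB_cl cy).
rewrite (hcup_cl (zcocycle_cB cx) cy) (hcup_cl cx (zcocycle_cB cy)).
rewrite !cl_gcast -(cl_scale _ c2) -(cl_opp c1) -(cl_opp c3).
rewrite -(cl_add c0 (zcocycleN c1)) -(cl_add c4 (zcocycleN c3)) -(cl_scale _
  c5).
apply: zcocycle_cl_eq; [exact: zcocycle_bracket|exact: zcocycleZ|].
have [w] := bracket_connes tau_muT (zcocycle_hom cx) (zcocycle_hom cy)
  (zcocycle_diff cx) (zcocycle_diff cy).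
rewrite -(cBE M T (hom_cup M (zcocycle_hom cx) (zcocycle_hom cy))).
rewrite -(cBE M T (zcocycle_hom cx)) -(cBE M T (zcocycle_hom cy)).
by exists w.
Qed.

End BatalinVilkovisky.

(** * Cyclic cohomology and its exact couple *)

Section CyclicCohomology.
Variables (k : comPzRingType) (O : operad k) (M : multiplication O).
Variable (T : cyclic_structure O).
Hypothesis tau_muT : op_tau T 2 (op_mu M) = op_mu M.
Local Notation U := (total O).
Local Notation diff := (diff M).
Local Notation cB := (cB M T).
Local Notation cl := (cl M).
Local Notation zcocycle := (zcocycle M).
Local Notation nondeg := (nondeg M).
Local Notation H := (operad_cohomology M).
Local Notation HC := (cyclic_cohomology M T).
Local Notation hB := (@hB k O M T).

Definition tc z (c : tot_prod O z) (m : nat) : U := zinj (c m).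

Lemma homz_tc z (c : tot_prod O z) m : homz (z + (2 * m)%:Z) (tc c m).
Proof. exact: homz_zinj. Qed.

Lemma tc_ext z (c c' : tot_prod O z) : (forall m, tc c m = tc c' m) -> c = c'.
Proof.
by move=> E; apply: functional_extensionality_dep => m; apply/zinj_inj/E.
Qed.

Lemma tc_gcast z z' (E : z = z') (c : tot_prod O z) m :
  tc (gcast (G := tot_prod O) E c) m = tc c m.
Proof. by case: _ / E. Qed.

Lemma tc_tot_d z (c : tot_prod O z) m :
  tc (tot_d M T c) m = diff (tc c m) + cB (tc c m.+1).
Proof. by rewrite /tc /tot_d linearD /= !zinj_gcast zinj_zd zinj_zB. Qed.

Lemma tcP z a (c c' : tot_prod O z) m :
  tc (a *: c + c') m = a *: tc c m + tc c' m.
Proof. by rewrite /tc -[(a *: c + c') m]/(a *: c m + c' m) linearP. Qed.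

Definition untc z (F : nat -> U) : tot_prod O z :=
  fun m => zproj (z + (2 * m)%:Z) (F m).

Lemma untcK z F m : homz (z + (2 * m)%:Z) (F m) -> tc (untc z F) m = F m.
Proof. by move=> hF; rewrite /tc /untc -hF. Qed.

Lemma znormalizedP z (x : cochain O z) :
  reflect (nondeg `|z| (zinj x)) (x \in @znormalized k O M z).
Proof.
case: z x => n x; first exact: normalizedP.
by apply: ReflectT => j _; apply: scomp0l.
Qed.

Definition tot_cocycle z (c : tot_prod O z) : Prop :=
  is_cocycle (@tot_d k O M T)
    (fun z => GRing.SubmodClosed.clone k _ (@tot_pred k O M z) _) c.

Lemma tot_cocycleP z (c : tot_prod O z) : tot_cocycle c <->
  [/\ forall m, nondeg `|(z + (2 * m)%:Z)%R| (tc c m),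
      exists K, forall m, (K <= m)%N -> tc c m = 0
    & forall m, diff (tc c m) = - cB (tc c m.+1)].
Proof.
split=> [[/asboolP[cN [K cK]] dc]|[cN [K cK] dc]].
  split=> [m||m]; first exact/znormalizedP.
    by exists K => m /cK; rewrite /tc => ->; apply: linear0.
  apply/eqP; rewrite -addr_eq0 -tc_tot_d dc; apply/eqP.
  by rewrite /tc -[(0 : tot_prod O _) m]/(0 : cochain O _) linear0.
split.
  apply/asboolP; split=> [m|]; first exact/znormalizedP.
  by exists K => m /cK E; apply: zinj_inj; rewrite linear0.
apply: tc_ext => m; rewrite tc_tot_d dc addNr.
by rewrite /tc -[(0 : tot_prod O _) m]/(0 : cochain O _) linear0.
Qed.

Lemma tot_cocycle_linear z a (c c' : tot_prod O z) :
  tot_cocycle c -> tot_cocycle c' -> tot_cocycle (a *: c + c').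
Proof.
move=> /tot_cocycleP[nc [K cK] dc] /tot_cocycleP[nc' [L cL] dc'];
  apply/tot_cocycleP; split.
- by move=> m j lt_j; rewrite tcP scompDl scompZl nc // nc' // scaler0 addr0.
- exists (maxn K L) => m; rewrite geq_max => /andP[Km Lm].
  by rewrite tcP cK // cL // scaler0 addr0.
by move=> m; rewrite !tcP !linearD !linearZ /= dc dc' ?opprD ?scalerN.
Qed.

Definition tot_class z (c : tot_prod O z) : HC z := coclass _ _ c.

Lemma tot_class_linear z a (c c' : tot_prod O z) : tot_cocycle c ->
  tot_cocycle c' ->
  tot_class (a *: c + c') = a *: tot_class c + tot_class c'.
Proof. exact: class_linear. Qed.

Lemma tot_class_surj z (A : HC z) : exists2 c, tot_cocycle c & tot_class c = A.
Proof. exact: class_surj. Qed.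

Lemma tot_class_eq0 z (c : tot_prod O z) : tot_cocycle c ->
  tot_class c = 0 <-> exists2 w : tot_prod O (z - 1),
    w \in @tot_pred k O M (z - 1) & forall m, tc c m = tc (tot_d M T w) m.
Proof.
move=> cc; split=> [/(class_eq0 cc)[w Nw dw]|[w Nw dw]].
  by exists w => // m; rewrite -dw tc_gcast.
apply/(class_eq0 cc); exists w => //; apply: tc_ext => m.
by rewrite tc_gcast -dw.
Qed.

Lemma tot_class_represents i j (c : tot_prod O i) (A : HC j) :
  represents c A <-> exists e : i = j,
    tot_cocycle c /\ gcast e (tot_class c) = A.
Proof. exact: representsP. Qed.

Local Opaque operad_cohomology cyclic_cohomology.

Lemma sub_eq0 (V : lmodType k) (u v : V) : (-1) *: u + v = 0 -> v = u.
Proof. by rewrite scaleN1r addrC => /eqP; rewrite subr_eq0 => /eqP. Qed.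

Definition norm_cocycle z (x : U) : Prop := zcocycle z x /\ nondeg `|z| x.

Lemma norm_cocycleP z a x y : norm_cocycle z x -> norm_cocycle z y ->
  norm_cocycle z (a *: x + y).
Proof.
move=> [cx nx] [cy ny]; split; first exact: zcocycleP.
by move=> j lt_j; rewrite scompDl scompZl nx // ny // scaler0 addr0.
Qed.

Lemma norm_cocycle_cB z x : homz z x -> nondeg `|z| x -> diff (cB x) = 0 ->
  norm_cocycle (z - 1) (cB x).
Proof. by move=> hx nx dB; split; [split=> //; apply: homz_cB|apply: cB_nondeg].
  Qed.

Definition single z (x : U) : tot_prod O z :=
  untc z (fun m => if m is 0%N then x else 0).

Lemma homz_addr0 z (x : U) : homz z x -> homz (z + (2 * 0)%:Z) x.
Proof. by move=> hx; rewrite muln0 addr0. Qed.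

Lemma tc_single z x m : homz z x ->
  tc (single z x) m = if m is 0%N then x else 0.
Proof.
move=> hx; apply: untcK; case: m => [|m]; [exact: homz_addr0 | exact: homz0].
Qed.

Lemma single_linear z a x y : single z (a *: x + y) = a *: single z x
  + single z y.
Proof.
apply: functional_extensionality_dep => m.
rewrite -[RHS]/(a *: single z x m + single z y m) /single /untc.
by case: m => [|m]; rewrite ?linearP // !linear0 addr0.
Qed.

Lemma tot_singleE z (c : cochain O z) : tot_single c = single z (zinj c).
Proof.
apply: tc_ext => m; rewrite tc_single; last exact: homz_zinj.
by case: m => [|m]; rewrite /tc /tot_single ?zinj_gcast // linear0.
Qed.

Lemma single_tot_pred z x : homz z x -> nondeg `|z| x ->
  single z x \in @tot_pred k O M z.
Proof.
move=> hx nx; apply/asboolP; split=> [m|].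
  apply/znormalizedP; rewrite -/(tc _ m) tc_single //.
  by case: m => [|m]; rewrite ?muln0 ?addr0 // => j _; apply: scomp0l.
exists 1%N => m m_gt0; apply: zinj_inj; rewrite -/(tc _ m) tc_single // linear0.
by case: m m_gt0.
Qed.

Lemma single_cocycle z x : norm_cocycle z x -> tot_cocycle (single z x).
Proof.
move=> [[hx dx] nx]; split; first exact: single_tot_pred.
apply: tc_ext => m; rewrite tc_tot_d !tc_single // linear0 addr0.
rewrite /tc -[(0 : tot_prod O _) m]/(0 : cochain O _) linear0.
by case: m => [|m]; rewrite ?dx ?linear0.
Qed.

Lemma single_bound z x : norm_cocycle z x -> cl z x = 0 ->
  tot_class (single z x) = 0.
Proof.
move=> cx clx; have [[hx dx] nx] := cx.
have [w hw Ew] := cl_eq0 dx clx; rewrite -hx in Ew.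
have [|w' [hw' nw' Ew']] := nondeg_bounding (M := M) hw; first by rewrite -Ew.
apply/tot_class_eq0; first exact: single_cocycle.
exists (single (z - 1) w'); first exact: single_tot_pred.
move=> m; rewrite tc_tot_d !tc_single // linear0 addr0.
by case: m => [|m]; rewrite ?Ew' ?linear0.
Qed.

(** A normalized representative, as needed to land in the complex of
   normalized cochains. *)
Definition nrep z (a : H z) : U := sval (cid (surj_nondeg a)).
Lemma nrepP z (a : H z) : norm_cocycle z (nrep a) /\ cl z (nrep a) = a.
Proof. by rewrite /nrep; case: cid => x [cx nx xa]. Qed.

Definition hI z (a : H z) : HC z := tot_class (single z (nrep a)).

Lemma hI_cl z x : norm_cocycle z x -> hI (cl z x) = tot_class (single z x).
Proof.
move=> cx; have [cr Er] := nrepP (cl z x); apply: sub_eq0.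
rewrite -(tot_class_linear _ (single_cocycle cx) (single_cocycle cr))
  -single_linear.
apply: single_bound; first exact: norm_cocycleP.
rewrite (cl_lin _ cx.1 cr.1) Er scaleN1r; exact: addNr.
Qed.

Lemma hI_is_linear z : linear (@hI z).
Proof.
move=> s a b; have [ca Ea] := nrepP a; have [cb Eb] := nrepP b.
rewrite -{1}Ea -{1}Eb -(cl_lin s ca.1 cb.1) hI_cl; last exact: norm_cocycleP.
by rewrite single_linear tot_class_linear //; apply: single_cocycle.
Qed.
HB.instance Definition _ z := GRing.isLinear.Build k (H z) (HC z) *:%R
  (@hI z) (@hI_is_linear z).
Definition hI_lin z : {linear H z -> HC z} := @hI z.

(** The component of degree z of a total cocycle is a cocycle only up to B of
   the next component, so it is its image under B which is a cocycle, by dB +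
   Bd = 0 and B B = 0. *)
Lemma tc0P z (c : tot_prod O z) : tot_cocycle c ->
  [/\ homz z (tc c 0), nondeg `|z| (tc c 0) & diff (cB (tc c 0)) = 0].
Proof.
move=> /tot_cocycleP[nc _ dc]; have h1 := homz_tc c 1; have n1 := nc 1%N.
have h0 : homz z (tc c 0) by have := homz_tc c 0; rewrite muln0 addr0.
split=> //; first by have := nc 0%N; rewrite muln0 addr0.
by rewrite (diff_cB tau_muT (homz_hom h0)) dc linearN /= opprK (cBB T h1 n1).
Qed.

Lemma norm_cocycle_tc0 z (c : tot_prod O z) : tot_cocycle c ->
  norm_cocycle (z - 1) (cB (tc c 0)).
Proof. by case/tc0P=> h0 n0 d0; apply: norm_cocycle_cB. Qed.

Definition trep z (A : HC z) : tot_prod O z := sval (cid2 (tot_class_surj A)).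
Lemma trepP z (A : HC z) : tot_cocycle (trep A) /\ tot_class (trep A) = A.
Proof. by rewrite /trep; case: cid2. Qed.

Definition hdel z (A : HC z) : H (z - 1) := cl (z - 1) (cB (tc (trep A) 0)).

(** Changing c by the coboundary of w changes its component of degree z by d
   w_0 + B w_1, and B of this is - d B w_0. *)
Lemma hdel_tot_class z (c : tot_prod O z) : tot_cocycle c ->
  hdel (tot_class c) = cl (z - 1) (cB (tc c 0)).
Proof.
move=> cc; have [cr Er] := trepP (tot_class c); set r := trep _ in cr Er *.
have cd := tot_cocycle_linear (-1) cc cr.
have : tot_class ((-1) *: c + r) = 0 by rewrite tot_class_linear // Er scaleN1r;
  exact: addNr.
case/(tot_class_eq0 cd) => w Nw /(_ 0%N); rewrite tcP tc_tot_d scaleN1r => Ew.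
have {Ew} Er0 : tc r 0 = tc c 0 + (diff (tc w 0) + cB (tc w 1)).
  by rewrite -Ew addrA subrr add0r.
have hw0 := homz_tc w 0; have hw1 := homz_tc w 1.
have nw1 : nondeg `|(z - 1 + (2 * 1)%:Z)%R| (tc w 1).
  by move/asboolP: Nw => [nw _]; apply/znormalizedP.
apply: zcocycle_cl_eq (norm_cocycle_tc0 cr).1 (norm_cocycle_tc0 cc).1 _;
  exists (- cB (tc w 0)).
rewrite Er0 !linearD linearN /= (diff_cB tau_muT (homz_hom hw0)).
by rewrite (cBB T hw1 nw1) opprK addr0.
Qed.

Lemma hdel_is_linear z : linear (@hdel z).
Proof.
move=> s A B; have [cA EA] := trepP A; have [cB' EB] := trepP B.
have cd := tot_cocycle_linear s cA cB'.
rewrite -{1}EA -{1}EB -tot_class_linear // hdel_tot_class //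
  tcP linearP cl_lin //.
  exact: (norm_cocycle_tc0 cA).1.
exact: (norm_cocycle_tc0 cB').1.
Qed.
HB.instance Definition _ z := GRing.isLinear.Build k (HC z) (H (z - 1)) *:%R
  (@hdel z) (@hdel_is_linear z).
Definition hdel_lin z : {linear HC z -> H (z - 1)} := @hdel z.

Lemma hdel_hI z (a : H z) : hdel (hI a) = hB a.
Proof.
have [ca Ea] := nrepP a; rewrite -{1}Ea hI_cl // hdel_tot_class; last exact:
  single_cocycle.
rewrite tc_single; last exact: (zcocycle_homz ca.1).
by rewrite -{2}Ea (hB_cl tau_muT ca.1).
Qed.

(** For a total cocycle (c_0, c_1, ...) the cochain (0, c_0, c_1, ...) has the
   coboundary (B c_0, 0, 0, ...). *)
Lemma hI_hdel z (A : HC z) : hI (hdel A) = 0.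
Proof.
have [c cc <-] := tot_class_surj A; rewrite hdel_tot_class // hI_cl; last exact:
  norm_cocycle_tc0.
apply/tot_class_eq0; first by apply: single_cocycle; apply: norm_cocycle_tc0.
have [nc [K cK] dc] := (tot_cocycleP c).1 cc.
(* The shift of c by one place, of degree z - 2. *)
pose F m := if m is m'.+1 then tc c m' else 0.
have hF m : homz (z - 1 - 1 + (2 * m)%:Z) (F m).
  case: m => [|m]; first exact: homz0.
  by apply: homz_eq (homz_tc c m) _; lia.
exists (untc (z - 1 - 1) F).
  apply/asboolP; split=> [m|].
    apply/znormalizedP; rewrite -/(tc _ m) untcK //.
    case: m => [|m]; first by move=> j _; apply: scomp0l.
    by rewrite (_ : (z - 1 - 1 + (2 * m.+1)%:Z = z + (2 * m)%:Z)%R) //; lia.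
  exists K.+1 => m lt_m; apply: zinj_inj; rewrite -/(tc _ m) untcK // linear0.
  by case: m lt_m => // m; apply: cK.
move=> m; rewrite tc_single; last exact:
  (zcocycle_homz (norm_cocycle_tc0 cc).1).
rewrite tc_tot_d !untcK //.
by case: m => [|m] /=; rewrite ?linear0 ?add0r // dc addNr.
Qed.

End CyclicCohomology.

(** * The Lie bracket on cyclic cohomology *)

Section LieStructure.
Variables (k : comPzRingType) (O : operad k) (M : multiplication O).
Variable (T : cyclic_structure O).
Hypothesis tau_muT : op_tau T 2 (op_mu M) = op_mu M.
Local Notation U := (total O).
Local Notation cup := (cup M).
Local Notation cB := (cB M T).
Local Notation cl := (cl M).
Local Notation zcocycle := (zcocycle M).
Local Notation H := (operad_cohomology M).
Local Notation HC := (cyclic_cohomology M T).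
Local Notation hB := (@hB k O M T).
Local Notation hI := (@hI k O M T).
Local Notation hdel := (@hdel k O M T).

Definition operad_gerstenhaber : gerstenhaber H :=
  @Gerstenhaber k H (cl 0 (te M)) (@hcup k O M) (@hbracket k O M)
    (@hcup_linl k O M) (@hcup_linr k O M) (@hbracket_linl k O M) (@hbracket_linr
      k O M)
    (@hcupA k O M) (@hcup1l k O M) (@hcup1r k O M) (@hcupC k O M)
    (@hbracketC k O M) (@hjacobi k O M) (@hpoisson k O M).

Definition operad_bv : batalin_vilkovisky H :=
  @BatalinVilkovisky k H operad_gerstenhaber
    (hB_lin tau_muT)
    (@hBB k O M T tau_muT) (@hbv k O M T tau_muT).

Local Opaque operad_cohomology cyclic_cohomology.

Lemma gcastZ (G : int -> lmodType k) i j (E : i = j) a (x : G i) :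
  gcast E (a *: x) = a *: gcast E x.
Proof. by case: _ / E. Qed.
Lemma gcastD (G : int -> lmodType k) i j (E : i = j) (x y : G i) :
  gcast E (x + y) = gcast E x + gcast E y.
Proof. by case: _ / E. Qed.
Lemma gcast0 (G : int -> lmodType k) i j (E : i = j) : gcast E (0 : G i) = 0.
Proof. by case: _ / E. Qed.

Lemma hIZ z a (x : H z) : hI (a *: x) = a *: hI x.
Proof. exact: (linearZ_LR (hI_lin M T z)). Qed.
Lemma hID z (x y : H z) : hI (x + y) = hI x + hI y.
Proof. exact: (linearD (hI_lin M T z)). Qed.
Lemma hIN z (x : H z) : hI (- x) = - hI x.
Proof. exact: (linearN (hI_lin M T z)). Qed.
Lemma hdel0 z : hdel (0 : HC z) = 0.
Proof. exact: (linear0 (hdel_lin tau_muT z)). Qed.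
Definition lie i j (a : HC i) (b : HC j) : HC (i + j - 2) :=
  gsign k i *: gcast (deg_bracket i j) (hI (hcup (hdel a) (hdel b))).

Lemma hI_gcast z z' (E : z = z') (a : H z) : gcast E (hI a) = hI (gcast E a).
Proof. by case: _ / E. Qed.

Lemma hdel_cocycle z (a : HC z) : exists2 x,
  zcocycle (z - 1) x & hdel a = cl (z - 1) x.
Proof.
have [c cc <-] := tot_class_surj a; exists (cB (tc c 0)); last exact:
  hdel_tot_class.
exact: (norm_cocycle_tc0 tau_muT cc).1.
Qed.

Lemma lie_cl i j (a : HC i) (b : HC j) x y : zcocycle (i - 1) x ->
  zcocycle (j - 1) y ->
  hdel a = cl (i - 1) x -> hdel b = cl (j - 1) y ->
  lie a b = hI (cl (i + j - 2) (gsign k i *: cup x y)).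
Proof.
move=> cx cy Ea Eb; rewrite /lie Ea Eb (hcup_cl cx cy) hI_gcast cl_gcast.
rewrite cl_scale ?hIZ //.
by apply: zcocycle_eq (zcocycle_cup cx cy) _; apply: deg_bracket.
Qed.

Lemma lie_linl i j (b : HC j) : linear (fun a : HC i => lie a b).
Proof.
move=> s a a'; rewrite /lie (hdel_is_linear tau_muT s a a') hcup_linl hID hIZ
  gcastD gcastZ.
by rewrite scalerDr !scalerA mulrC.
Qed.

Lemma lie_linr i j (a : HC i) : linear (fun b : HC j => lie a b).
Proof.
move=> s b b'; rewrite /lie (hdel_is_linear tau_muT s b b') hcup_linr hID hIZ
  gcastD gcastZ.
by rewrite scalerDr !scalerA mulrC.
Qed.

Lemma hB_hdel z (a : HC z) : hB (hdel a) = 0.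
Proof.
by rewrite -(hdel_hI tau_muT) hI_hdel // hdel0.
Qed.

Lemma hI_hB z (a : H z) : hI (hB a) = 0.
Proof. by rewrite -(hdel_hI tau_muT) hI_hdel. Qed.

Lemma linear_at0 (V W : lmodType k) (h : V -> W) : linear h -> h 0 = 0.
Proof.
by move=> lh; have := lh (-1) 0 0; rewrite scaler0 addr0 scaleN1r addNr.
Qed.

Lemma hcup0l i j (b : H j) : hcup (0 : H i) b = 0.
Proof. exact: linear_at0 (hcup_linl b). Qed.
Lemma hcup0r i j (a : H i) : hcup a (0 : H j) = 0.
Proof. exact: linear_at0 (hcup_linr a). Qed.

Lemma hcupZr i j (a : H i) s (b : H j) : hcup a (s *: b) = s *: hcup a b.
Proof. by have := hcup_linr a s b 0; rewrite !addr0 hcup0r addr0. Qed.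

(** When B vanishes on a and b, the Batalin-Vilkovisky identity reduces to its
   first term. *)
Lemma hbracket_hB0 i j (a : H i) (b : H j) : hB a = 0 -> hB b = 0 ->
  hbracket a b = gsign k i *: hB (hcup a b).
Proof.
move=> Ba Bb; have := hbv tau_muT a b; rewrite Ba Bb hcup0l hcup0r => ->.
by rewrite !gcast0 scaler0 !subr0.
Qed.

(** Since B vanishes on the image of the connecting map, the bracket on HC is
   sent to the Gerstenhaber bracket. *)
Lemma hdel_lie i j (a : HC i) (b : HC j) x y : zcocycle (i - 1) x ->
  zcocycle (j - 1) y ->
    hdel a = cl (i - 1) x -> hdel b = cl (j - 1) y ->
  hdel (lie a b) = cl (i + j - 2 - 1) (- zbracket (i - 1) (j - 1) x y).
Proof.
move=> cx cy Ea Eb; have cxy : zcocycle (i + j - 2) (cup x y).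
  by apply: zcocycle_eq (zcocycle_cup cx cy) _; apply: deg_bracket.
have E : (i - 1) + (j - 1) - 1 = i + j - 2 - 1 by rewrite deg_bracket.
have cb : zcocycle (i + j - 2 - 1) (zbracket (i - 1) (j - 1) x y).
  exact: zcocycle_eq (zcocycle_bracket cx cy) E.
rewrite (lie_cl cx cy Ea Eb) (hdel_hI tau_muT) (hB_cl tau_muT (zcocycleZ _
  cxy)).
have Bx : hB (cl (i - 1) x) = 0 by rewrite -Ea hB_hdel.
have By : hB (cl (j - 1) y) = 0 by rewrite -Eb hB_hdel.
have := hbracket_hB0 Bx By; rewrite (hbracket_cl cx cy) (hcup_cl cx cy).
rewrite (hB_cl tau_muT (zcocycle_cup cx cy)) => /(congr1 (gcast E)).
rewrite gcastZ !cl_gcast (cl_opp cb) => ->.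
rewrite linearZ /= (cl_scale _ (zcocycle_cB tau_muT cxy)).
move: (cl _ (cB _)) => v; rewrite !signZ !odd_abszD /=.
by case: (odd `|i|); rewrite /= ?opprK.
Qed.

Lemma lieC i j (a : HC i) (b : HC j) :
  lie a b = - (gsign k (i * j) *: gcast (deg_lieC i j) (lie b a)).
Proof.
have [x cx Ea] := hdel_cocycle a; have [y cy Eb] := hdel_cocycle b.
have cxy : zcocycle (i + j - 2) (cup x y).
  by apply: zcocycle_eq (zcocycle_cup cx cy) _; apply: deg_bracket.
have cyx : zcocycle (i + j - 2) (cup y x).
  by apply: zcocycle_eq (zcocycle_cup cy cx) _; rewrite deg_bracket;
    apply: deg_lieC.
rewrite (lie_cl cx cy Ea Eb) (lie_cl cy cx Eb Ea) hI_gcast cl_gcast.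
rewrite (cl_scale _ cxy) (cl_scale _ cyx).
have := hcupC (cl (i - 1) x) (cl (j - 1) y).
rewrite (hcup_cl cx cy) (hcup_cl cy cx) => /(congr1 (gcast (deg_bracket i j))).
rewrite cl_gcast => ->; rewrite gcastZ !cl_gcast.
move: (cl _ (cup y x)) => v; rewrite !hIZ; move: (hI v) => w;
  rewrite !signZ !abszM !oddM !odd_abszD /=.
by case: (odd `|i|); case: (odd `|j|); rewrite /= ?opprK.
Qed.

(** Applying I to the Batalin-Vilkovisky identity for x and y z kills the term
   B(x y z); the Poisson rule expands {x, y z}, and B(y z) is {y, z} up to
   sign. *)
Lemma hI_jacobi i j l (x y z : U) (t := i + (j + l) - 1) :
    zcocycle i x -> zcocycle j y -> zcocycle l z ->
    hB (cl i x) = 0 -> hB (cl j y) = 0 -> hB (cl l z) = 0 ->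
  hI (cl t (cup (zbracket i j x y) z))
    + gsign k (j * (i - 1)) *: hI (cl t (cup y (zbracket i l x z))) =
  - (gsign k j *: hI (cl t (cup x (zbracket j l y z)))).
Proof.
move=> cx cy cz Bx By Bz; have cyz := zcocycle_cup cy cz.
have E1 := hpoisson (cl i x) (cl j y) (cl l z).
have E2 := hbv tau_muT (cl i x) (hcup (cl j y) (cl l z)).
have E3 := hbracket_hB0 By Bz.
have {}E3 : hB (hcup (cl j y) (cl l z)) =
  gsign k j *: hbracket (cl j y) (cl l z).
  by rewrite E3 scalerA -exprD addnn signZ odd_double.
rewrite E3 Bx hcup0l gcast0 subr0 E1 in E2.
rewrite (hbracket_cl cx cy) (hbracket_cl cx cz) (hbracket_cl cy cz) in E2.
rewrite (hcup_cl (zcocycle_bracket cx cy) cz) (hcup_cl cy (zcocycle_bracket cx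
  cz)) in E2.
rewrite hcupZr (hcup_cl cx (zcocycle_bracket cy cz)) gcastZ !cl_gcast -/t in E2.
move: E2 => /(congr1 (fun u : H t => hI u));
  rewrite hID !hIZ hID hIN !hIZ hI_hB.
rewrite add0r => ->; move: (hI _) => v; rewrite !signZ.
by case: (odd `|i|); rewrite ?opprK.
Qed.

(** The passage from hI_jacobi, in the degrees i - 1 and j - 1 of the images
   in H, to the Jacobi identity in the degrees i and j of HC. *)
Lemma jacobi_signs (V : lmodType k) (i j : int) (X Y Z : V) :
    Y + gsign k ((j - 1) * (i - 1 - 1)) *: Z = - (gsign k (j - 1) *: X) ->
  - (gsign k i *: X) =
  - (gsign k (i + j - 2) *: Y) + gsign k (i * j) *: - (gsign k j *: Z).
Proof.
move=> E; have -> : X = - (gsign k (j - 1) *: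
    (Y + gsign k ((j - 1) * (i - 1 - 1)) *: Z)).
  by rewrite E !signZ; case: odd; rewrite ?opprK.
rewrite !signZ !abszM !oddM !odd_abszD /=.
case: (odd `|i|); case: (odd `|j|) => /=; abel.
Qed.

Lemma lie_jacobi i j l (a : HC i) (b : HC j) (c : HC l) :
  lie a (lie b c) =
    gcast (deg_lie1 i j l) (lie (lie a b) c) +
    gsign k (i * j) *: gcast (deg_lie2 i j l) (lie b (lie a c)).
Proof.
have [x cx Ea] := hdel_cocycle a; have [y cy Eb] := hdel_cocycle b.
have [z cz Ec] := hdel_cocycle c.
have Bx : hB (cl (i - 1) x) = 0 by rewrite -Ea hB_hdel.
have By : hB (cl (j - 1) y) = 0 by rewrite -Eb hB_hdel.
have Bz : hB (cl (l - 1) z) = 0 by rewrite -Ec hB_hdel.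
pose t := i + (j + l - 2) - 2.
have bracket u v w w' : zcocycle (u - 1) w -> zcocycle (v - 1) w' ->
    zcocycle (u + v - 2 - 1) (- zbracket (u - 1) (v - 1) w w').
  move=> cw cw'; apply/zcocycleN/(zcocycle_eq (zcocycle_bracket cw cw')); lia.
have tE : t = (i - 1) + ((j - 1) + (l - 1)) - 1 by rewrite /t; lia.
have c1 : zcocycle t (cup (zbracket (i - 1) (j - 1) x y) z).
  by apply: zcocycle_eq (zcocycle_cup (zcocycle_bracket cx cy) cz) _;
    rewrite /t; lia.
have c2 : zcocycle t (cup y (zbracket (i - 1) (l - 1) x z)).
  by apply: zcocycle_eq (zcocycle_cup cy (zcocycle_bracket cx cz)) _;
    rewrite /t; lia.
have c3 : zcocycle t (cup x (zbracket (j - 1) (l - 1) y z)).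
  by apply: zcocycle_eq (zcocycle_cup cx (zcocycle_bracket cy cz)) _;
    rewrite /t; lia.
rewrite (lie_cl cx (bracket _ _ _ _ cy cz) Ea (hdel_lie cy cz Eb Ec)).
rewrite (lie_cl (bracket _ _ _ _ cx cy) cz (hdel_lie cx cy Ea Eb) Ec).
rewrite (lie_cl cy (bracket _ _ _ _ cx cz) Eb (hdel_lie cx cz Ea Ec)).
rewrite !hI_gcast !cl_gcast -/t cupNl !cupNr !scalerN.
rewrite (cl_opp (zcocycleZ _ c1)) (cl_opp (zcocycleZ _ c2)) (cl_opp (zcocycleZ _
  c3)).
rewrite (cl_scale _ c1) (cl_scale _ c2) (cl_scale _ c3) !hIN !hIZ.
have := hI_jacobi cx cy cz Bx By Bz; rewrite -tE; exact: jacobi_signs.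
Qed.

Definition operad_lie : lie_algebra_deg_m2 HC :=
  @LieAlgebraDegM2 k HC lie lie_linl lie_linr lieC lie_jacobi.

End LieStructure.

(** The two sign conventions for the circle product differ by the parity of i
   (n + 1), which is the sign of the suspension. *)
(** * The main theorem *)

Lemma tinj_bracketc (k : comPzRingType) (O : operad k) m n (f : O m) (g : O n) :
  tinj (bracketc f g) = bracket m.+1 n.+1 (tinj f) (tinj g).
Proof.
have circE p q (x : O p) (y : O q) : tinj (circ x y) =
    (-1) ^+ (p.+1 * q.+1) *: pcirc p.+1 (tinj x) (tinj y).
  rewrite (pcirc_widen (hom_tinj x) (hom_tinj y) (leqnSn p)) /circ linearZ /=.
  rewrite linear_sum /pcirc big_mkord /=; congr (_ *: _).
    by rewrite /gsign -signr_odd -[RHS]signr_odd abszM !oddM !odd_abszD /=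
      !addbT.
  apply: eq_bigr => i _; rewrite linearZ /=
    tcomp_pcomp (scompE _ _ (hom_tinj y)).
  by rewrite !signZ abszM !oddM !odd_abszD /=; case: (odd q).
rewrite /bracketc linearB [X in _ - X]linearZ /= tinj_gcast !circE /bracket;
  congr (_ - _).
rewrite /gsign scalerA -signr_odd abszM !oddM !odd_abszD /=.
rewrite -[X in _ * X]signr_odd oddM /= -signr_addb.
by case: (odd m); case: (odd n); rewrite scale1r.
Qed.

Lemma tinj_cupc (k : comPzRingType) (O : operad k) (M : multiplication O) m n
  (f : O m) (g : O n) : tinj (cupc M f g) = cup M (tinj f) (tinj g).
Proof.
rewrite /cupc (tcomp_pcomp (pcomp (op_mu M) ord0 f : O m.+1) ord_max g).
rewrite (tcomp_pcomp (op_mu M) ord0 f) /cup.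
by rewrite -(tcomp_parallel (hom_mu M) (hom_tinj f) (hom_tinj g) (i := 0) (j :=
  1)).
Qed.

Theorem theorem1p3 (k : comPzRingType) (O : cyclic_mult_operad k) :
  let M := cmo_mult O in
  let T := cmo_cyc O in
  is_cocyclic (@coface k O M) (@codegeneracy k O M) (@op_tau k O T) /\
  exists S : batalin_vilkovisky (operad_cohomology M),
    [/\ has_class (op_e M) (g_one S),
        forall (i j : int) (a : operad_cohomology M i)
          (b : operad_cohomology M j) (m n : nat) (f : O m) (g : O n),
          has_class f a -> has_class g b ->
          has_class (cupc M f g) (g_cup S a b),
        forall (i j : int) (a : operad_cohomology M i)
          (b : operad_cohomology M j) (m n : nat) (f : O m) (g : O n),
          (0 < m + n)%N -> has_class f a -> has_class g b ->
          has_class (bracketc f g) (g_br S a b)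
      & forall (i : int) (a : operad_cohomology M i) (n : nat) (f : O n.+1),
          normalized M f -> has_class f a ->
          has_class (connesB M T f) (bv_B S i a)] /\
    exists (I : forall i, {linear operad_cohomology M i ->
                                  cyclic_cohomology M T i})
      (partial : forall i, {linear cyclic_cohomology M T i ->
                                   operad_cohomology M (i - 1)})
      (L : lie_algebra_deg_m2 (cyclic_cohomology M T)),
      [/\ forall (i : int) (a : operad_cohomology M i) (c : cochain O i),
            c \in @znormalized k O M i -> represents c a ->
            represents (tot_single c) (I i a),
          forall (i : int) (a : cyclic_cohomology M T i) (c : tot_prod O i),
            represents c a ->
            represents (zB M T (c 0%N)) (partial i a)
        & forall (i j : int) (a : cyclic_cohomology M T i)
            (b : cyclic_cohomology M T j),
            lie_br L a b =
              gsign k i *: gcast (deg_bracket i j)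
                (I _ (g_cup S (partial i a) (partial j b)))].
Proof.
move=> M T; have tmu : op_tau T 2 (op_mu M) = op_mu M := tau_mu O.
have zcP' n (f : O n) z (a : operad_cohomology M z) : has_class f a ->
    [/\ n%:Z = z, zcocycle M n%:Z (tinj f) & cl M z (tinj f) = a].
  by move=> /has_classP[E df ca]; split=> //; split=> //; apply: hom_tinj.
split; first exact: (operad_cocyclic tmu).
exists (operad_bv tmu); split.
  split.
  - by apply/has_classP; split=> //; apply: zcocycle_diff (zcocycle_unit M).
  - move=> i j a b m n f g /zcP'[E cf].
    case: _ / E a => a <- /zcP'[E cg]; case: _ / E b => b <-.
    have cfg := zcocycle_cup cf cg; apply/has_classP; rewrite tinj_cupc;
      split=> //.
      exact: zcocycle_diff cfg.
    by rewrite -(hcup_cl cf cg).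
  - move=> i j a b m n f g mn_gt0 /zcP'[E cf].
    case: _ / E a => a <- /zcP'[E cg]; case: _ / E b => b <-.
    have cfg := zcocycle_bracket cf cg; apply/has_classP; rewrite tinj_bracketc;
      split.
    + by lia.
    + exact: zcocycle_diff cfg.
    + by rewrite -[RHS]/(hbracket _ _) (hbracket_cl cf cg).
  move=> i a n f nf /zcP'[E cf]; case: _ / E a => a <-; have cBf :=
    zcocycle_cB tmu cf.
  apply/has_classP; rewrite tinj_connesB -(cBE M T (hom_tinj f)); split.
  - by lia.
  - exact: zcocycle_diff cBf.
  by rewrite -[RHS]/(hB T _) (hB_cl tmu cf).
exists (hI_lin M T), (hdel_lin tmu), (operad_lie tmu); split=> //.
- move=> i a c nc /representsP[E [cc <-]]; rewrite (eq_irrelevance E erefl).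
  have nx : norm_cocycle M i (zinj c).
    split; last exact/znormalizedP.
    split; first exact: homz_zinj.
    by rewrite -zinj_zd cc.2 linear0.
  apply/tot_class_represents; exists erefl; rewrite tot_singleE; split.
    exact: single_cocycle.
  have -> : gcast erefl (coclass _ _ c) = cl M i (zinj c) by rewrite /cl zinjK.
  by rewrite -[RHS]/(hI T _) hI_cl.
move=> i a c /tot_class_represents[E [cc <-]]; rewrite (eq_irrelevance E erefl).
have cB0 := (norm_cocycle_tc0 tmu cc).1.
have E0 : i + (2 * 0)%:Z - 1 = i - 1 by rewrite muln0 addr0.
have zE : zinj (zB M T (c 0%N)) = cB M T (tc c 0) by rewrite zinj_zB.
apply/representsP; exists E0; split.
  split=> //; apply: zinj_inj; rewrite zinj_zd zE linear0; exact:
    zcocycle_diff cB0.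
rewrite -[RHS]/(hdel (tot_class M T c)) (hdel_tot_class tmu cc) -(cl_gcast M E0)
  -zE.
by rewrite /cl zinjK.
Qed.
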